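(* Let $H_0$, $H_1$, $H_2$ be the graphs defined in the context. For a class of graphs $\mathcal{G}$ let $\omega(\mathcal{G})$ be as defined in the context. (i) If $\mathcal{G}$ is the class of all $H_0$-minor-free graphs, then $\omega(\mathcal{G}) = 5/4$. (ii) If $\mathcal{G}$ is the class of all graphs having neither $H_1$ nor $H_2$ as a minor, then $\omega(\mathcal{G}) = q$, where $q \approx 1.225$ is the real root of $t^4-4t^3+4t^2-4t+4$ in the interval $(1,2)$. (iii) If $\mathcal{G}$ is the class of all graphs having none of $H_0, H_1, H_2$ as a minor, then $\omega(\mathcal{G}) = t_0$, where $t_0 \approx 1.296$ is the unique real root of $t^3-2t^2+4t-4$.
   Context: All graphs are finite and simple. $P(G,t)$ denotes the chromatic polynomial of $G$. A real number $t$ is a chromatic root of $G$ if $P(G,t)=0$; the roots $0$ and $1$ are called trivial, all other real chromatic roots non-trivial. For a class of graphs $\mathcal{G}$, $\omega(\mathcal{G})$ is the infimum of the non-trivial real chromatic roots of the graphs in $\mathcal{G}$, with the convention $\omega(\mathcal{G})=2$ if there are no such roots. The double subdivision of an edge $uv$ of a graph $G$ is the graph obtained from $G-uv$ by adding two new vertices and joining each of them to both $u$ and $v$. $H_0$ is the graph obtained from $K_3$ by applying double subdivision to each of its three edges. Let $K_{2,3}$ have bipartition $\{x,y\}$, $\{u,v,w\}$. $H_1$ is obtained from this $K_{2,3}$ by applying double subdivision to each of the edges $xu, xv, xw$; $H_2$ is obtained from it by applying double subdivision to each of the edges $xu, xv, yw$. *)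

(* Defs.v *)
From HB Require Import structures.
From mathcomp Require Import all_boot all_order all_algebra.

Set Implicit Arguments.
Unset Strict Implicit.
Unset Printing Implicit Defensive.

Import Order.TTheory GRing.Theory Num.Theory.

Local Open Scope ring_scope.

Record sgraph := SGraph {
  vertex :> finType;
  adj : rel vertex;
  adj_sym : symmetric adj;
  adj_irr : irreflexive adj }.

Section ChromaticPolynomial.
Variable G : sgraph.

Definition proper_coloring (k : nat) (f : {ffun G -> 'I_k}) : bool :=
  [forall x, forall y, adj x y ==> (f x != f y)].

Definition stable (A : {set G}) : bool :=
  [forall x in A, forall y in A, ~~ adj x y].

Definition stable_partitions : {set {set {set G}}} :=
  [set P | partition P [set: G] & [forall B in P, stable B]].

(* A stable partition with m blocks is the family of colour classes of
   k (k - 1) ... (k - m + 1) proper k-colourings. See chromatic_polyE and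
   chromatic_poly_unique for the characterization by numbers of colourings. *)
Definition chromatic_poly (R : comNzRingType) : {poly R} :=
  \sum_(P in stable_partitions) \prod_(i < #|P|) ('X - (i%:R)%:P).

Lemma card_colorings_partition (k : nat) (P : {set {set G}}) :
  partition P [set: G] ->
  #|[set f : {ffun G -> 'I_k} | preim_partition f [set: G] == P]|
  = (k ^_ #|P|)%N.
Proof.
move=> partP; have [/eqP covP tiP P0] := and3P partP.
have inC x : x \in cover P by rewrite covP inE.
have pbP x : pblock P x \in P by apply: pblock_mem.
pose D : finType := {B : {set G} | B \in P}.
have cD : #|D| = #|P| by rewrite card_sig; apply: eq_card.
pose b x : D := exist _ (pblock P x) (pbP x).
have bsurj (B : D) : exists x, b x = B.
  case: B => B BP; have /set0Pn[x xB] : B != set0.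
    by apply: contraNneq P0 => <-.
  by exists x; apply: val_inj; rewrite /= (def_pblock tiP BP xB).
pose h (g : {ffun D -> 'I_k}) : {ffun G -> 'I_k} := [ffun x => g (b x)].
have hinj : injective h.
  move=> g1 g2 /ffunP e; apply/ffunP => B; have [x <-] := bsurj B.
  by have := e x; rewrite !ffunE.
rewrite -cD -[k in RHS]card_ord -card_inj_ffuns -(card_imset _ hinj).
apply: eq_card => f; rewrite inE; apply/eqP/imsetP => [fP|[g]]; last first.
  rewrite inE => /injectiveP gi ->.
  rewrite -[RHS](preim_partition_pblock partP).
  rewrite /preim_partition /equivalence_partition; apply: eq_imset => x.
  by apply/setP => y; rewrite !inE !ffunE (inj_eq gi) -val_eqE.
have fE x y : (f x == f y) = (b x == b y).
  rewrite -[RHS]val_eqE /= eq_pblock // -fP pblock_equivalence_partition ?inE //.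
  by split=> // /eqP->.
have [w wP] := fin_all_exists bsurj.
exists [ffun B => f (w B)].
  rewrite inE; apply/injectiveP => B C; rewrite !ffunE => /eqP.
  by rewrite fE !wP => /eqP.
by apply/ffunP => x; rewrite !ffunE; apply/eqP; rewrite fE wP.
Qed.

Lemma proper_coloring_partition (k : nat) (f : {ffun G -> 'I_k}) :
  proper_coloring f = (preim_partition f [set: G] \in stable_partitions).
Proof.
rewrite inE preim_partitionP /=; apply/'forall_forallP/'forall_implyP => H.
  move=> B /imsetP[z _ ->]; apply/'forall_implyP => x; rewrite !inE => /eqP zx.
  apply/'forall_implyP => y; rewrite !inE => /eqP zy.
  by have := H x y; rewrite -zx -zy eqxx implybF.
move=> x y; apply/implyP => xy; apply/negP => /eqP fxy.
have /H/'forall_implyP/(_ x) : [set y in [set: G] | f x == f y]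
    \in preim_partition f [set: G] by apply: imset_f; rewrite inE.
rewrite !inE eqxx => /(_ isT)/'forall_implyP/(_ y).
by rewrite !inE fxy eqxx xy => /(_ isT).
Qed.

Lemma card_proper_coloring (k : nat) :
  #|@proper_coloring k| = (\sum_(P in stable_partitions) k ^_ #|P|)%N.
Proof.
rewrite -sum1_card (partition_big
  (fun f : {ffun G -> 'I_k} => preim_partition f [set: G])
  (fun P => P \in stable_partitions)) /=; last first.
  by move=> f; rewrite -topredE /= proper_coloring_partition.
apply: eq_bigr => P sP; rewrite -card_colorings_partition; last first.
  by move: sP; rewrite inE => /andP[].
rewrite -sum1_card; apply: eq_bigl => f; rewrite inE -topredE /=.
by rewrite proper_coloring_partition; case: eqP => [->|]; rewrite ?sP ?andbF.
Qed.

Lemma chromatic_polyE (R : comNzRingType) (k : nat) :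
  (chromatic_poly R).[k%:R] = #|@proper_coloring k|%:R.
Proof.
rewrite card_proper_coloring natr_sum /chromatic_poly horner_sum.
apply: eq_bigr => P _; rewrite horner_prod; elim: #|P| => [|m IH].
  by rewrite big_ord0.
rewrite big_ord_recr /= IH ffactnSr natrM !hornerE.
have [mk|km] := leqP m k; first by rewrite natrB.
by rewrite (ffact_small km) !mul0r.
Qed.

Lemma chromatic_poly_unique (R : numDomainType) (p : {poly R}) :
  (forall k : nat, p.[k%:R] = #|@proper_coloring k|%:R) ->
  p = chromatic_poly R.
Proof.
move=> Hp; apply/eqP; rewrite -subr_eq0; apply/eqP.
set q := _ - _; apply: (@roots_geq_poly_eq0 _ _
  [seq i%:R | i <- iota 0 (size q)]).
- apply/allP => _ /mapP[i _ ->].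
  by rewrite rootE hornerD hornerN Hp chromatic_polyE subrr.
- rewrite map_inj_uniq ?iota_uniq // => i j /eqP.
  by rewrite eqr_nat => /eqP.
- by rewrite size_map size_iota.
Qed.

End ChromaticPolynomial.

Definition connected_set (G : sgraph) (A : {set G}) : Prop :=
  A != set0 /\
  {in A &, forall x y : G,
     connect [rel u v : G | [&& u \in A, v \in A & adj u v]] x y}.

(* H is a minor of G, by branch sets: contracting each of the disjoint connected
   sets phi x to a vertex and then deleting vertices and edges yields H. *)
Definition minor (H G : sgraph) : Prop :=
  exists phi : H -> {set G},
    [/\ forall x, connected_set (phi x),
        forall x y, x != y -> [disjoint phi x & phi y] &
        forall x y, adj x y ->
          exists a b, [/\ a \in phi x, b \in phi y & adj a b]].

Section CompleteGraph.
Variable n : nat.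
Definition K_adj (x y : 'I_n) : bool := x != y.
Lemma K_sym : symmetric K_adj.
Proof. by move=> x y; rewrite /K_adj eq_sym. Qed.
Lemma K_irr : irreflexive K_adj.
Proof. by move=> x; rewrite /K_adj eqxx. Qed.
Definition complete_graph : sgraph := SGraph K_sym K_irr.
End CompleteGraph.

Section CompleteBipartite.
Variables m n : nat.
Definition KB_adj (x y : 'I_m + 'I_n) : bool :=
  match x, y with
  | inl _, inr _ | inr _, inl _ => true
  | _, _ => false
  end.
Lemma KB_sym : symmetric KB_adj. Proof. by move=> [?|?] [?|?]. Qed.
Lemma KB_irr : irreflexive KB_adj. Proof. by move=> [?|?]. Qed.
Definition complete_bipartite : sgraph := SGraph KB_sym KB_irr.
End CompleteBipartite.

Section DoubleSubdivision.
Variables (G : sgraph) (u v : G).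
(* The two new vertices are inr true and inr false. *)
Definition dsub_adj (x y : G + bool) : bool :=
  match x, y with
  | inl a, inl b =>
      adj a b && ~~ ((a == u) && (b == v) || (a == v) && (b == u))
  | inl a, inr _ | inr _, inl a => (a == u) || (a == v)
  | inr _, inr _ => false
  end.
Lemma dsub_sym : symmetric dsub_adj.
Proof.
move=> [a|?] [b|?] //=; rewrite adj_sym; congr (_ && ~~ _).
by rewrite orbC andbC [X in _ || X]andbC.
Qed.
Lemma dsub_irr : irreflexive dsub_adj.
Proof. by move=> [a|?] //=; rewrite adj_irr. Qed.
(* Only meant for u and v adjacent. *)
Definition double_subdivision : sgraph := SGraph dsub_sym dsub_irr.
End DoubleSubdivision.

Definition H0 : sgraph :=
  let i0 : complete_graph 3 := @Ordinal 3 0 isT in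
  let i1 : complete_graph 3 := @Ordinal 3 1 isT in
  let i2 : complete_graph 3 := @Ordinal 3 2 isT in
  let G1 := double_subdivision i0 i1 in
  let G2 := @double_subdivision G1 (inl i1) (inl i2) in
  @double_subdivision G2 (inl (inl i2)) (inl (inl i0)).

Section H1H2.
Let K23 := complete_bipartite 2 3.
Let x : K23 := inl (@Ordinal 2 0 isT).
Let y : K23 := inl (@Ordinal 2 1 isT).
Let u : K23 := inr (@Ordinal 3 0 isT).
Let v : K23 := inr (@Ordinal 3 1 isT).
Let w : K23 := inr (@Ordinal 3 2 isT).
Let G1 := double_subdivision x u.
Let G2 := @double_subdivision G1 (inl x) (inl v).

Definition H1 : sgraph :=
  @double_subdivision G2 (inl (inl x)) (inl (inl w)).

Definition H2 : sgraph :=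
  @double_subdivision G2 (inl (inl y)) (inl (inl w)).

End H1H2.

From mathcomp Require Import boolp classical_sets reals.

Section Omega.
Variables (R : realType) (C : sgraph -> Prop).

Definition nontrivial_roots : set R :=
  [set t | [/\ t != 0, t != 1 &
    exists2 G, C G & root (chromatic_poly G R) t]]%classic.

Definition omega : R :=
  if `[< (nontrivial_roots !=set0)%classic >] then inf nontrivial_roots else 2.

End Omega.

(* Main.v *)
(** Lower bounds.  For 1 < t below the threshold, (-1)^n P(G, t) > 0 for every
    2-connected graph G on n vertices of the class.  In a minimal counterexample
    deletion and contraction of an edge show that there is a 2-vertex cut {x, y}, and
    the multiplicativity of the ratio between colourings with x and y equal and
    colourings with x and y distinct forces exactly three components, none of which
    is 2-connected together with x and y.  So each component splits at a cut vertex,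
    recursively, and excluding H0 (or H1 and H2) means that one of the two sides is
    an edge (or that one of the three components is a single vertex).  The series and
    parallel rules for the ratios then give recursive bounds contradicting the
    vanishing of P(G, t).

    Upper bounds.  Iterated double subdivisions of an edge uv, with uv added back,
    avoid H0 when they are forests after deletion of a vertex, and H1 and H2 when they
    are outerplanar after suppressing vertices of degree two.  Just above the
    threshold the iteration of the ratio has no fixed point, so it must cross the
    value at which the chromatic polynomial vanishes. *)

Require Import Defs.
From HB Require Import structures.
From mathcomp Require Import all_boot all_order all_algebra all_fingroup.
From mathcomp Require Import boolp reals.
From mathcomp Require Import zify ring lra.

Set Implicit Arguments.
Unset Strict Implicit.
Unset Printing Implicit Defensive.

Import Order.TTheory GRing.Theory Num.Theory.
Local Open Scope ring_scope.

(** * Graphs on a fixed vertex type *)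

(** Both halves follow one recursion, which is why the bounds meet. Put [p = t - 1] and [q = 2 - t].
    A component whose two sides have ratios [a] and [b] in [[0, s0)] has ratio
    [- (a b + p) / (q - a - b)], and a side is either an edge, of ratio 0, or has the product of two
    component ratios. A bound [- M] on component ratios therefore reproduces itself as soon as [M]
    satisfies a polynomial inequality; the threshold is the [t] at which its positive solutions
    shrink to a double root, and the iterated double subdivisions follow the same recursion with
    equality. The obstacle in the lower bound is that ratios may be undefined and that the induction
    speaks only of smaller 2-connected graphs of the class. A further component at the cut helps:
    contracted into [y] it supplies the edge [xy] to the rest, and contracted together with [x] and
    [y] it identifies them. So the values with [x] and [y] coloured differently have a known nonzero
    sign, and a single component has a negative ratio. *)

Record graph (V : finType) := Grel {
  gadj :> rel V;
  gadj_sym : symmetric gadj;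
  gadj_irr : irreflexive gadj }.

Definition sg (V : finType) (G : graph V) : sgraph :=
  SGraph (gadj_sym G) (gadj_irr G).

Section Construct.
Variable V : finType.
Implicit Types (e : rel V) (G : graph V).

Definition gr_adj e : rel V := [rel u v | (u != v) && (e u v || e v u)].
Lemma gr_sym e : symmetric (gr_adj e).
Proof. by move=> u v; rewrite /gr_adj /= eq_sym orbC. Qed.
Lemma gr_irr e : irreflexive (gr_adj e).
Proof. by move=> u; rewrite /gr_adj /= eqxx. Qed.
Definition gr e : graph V := Grel (@gr_sym e) (@gr_irr e).

Definition ind G (A : {set V}) : graph V :=
  gr [rel u v | [&& u \in A, v \in A & G u v]].
Definition addE G (x y : V) : graph V :=
  gr [rel u v | G u v || (u == x) && (v == y)].
Definition delE G (x y : V) : graph V :=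
  gr [rel u v | G u v && ~~ ((u == x) && (v == y) || (u == y) && (v == x))].

(* ctr contracts D to z: the other vertices of D remain, as isolated vertices,
   so that all graphs of the induction live on the same vertex type. *)
Definition retr (D : {set V}) (z u : V) : V := if u \in D then z else u.
Definition ctr G (D : {set V}) (z : V) : graph V :=
  gr [rel u v | [exists a, exists b, [&& retr D z a == u, retr D z b == v & G a b]]].

Lemma grC G u v : G u v = G v u. Proof. exact: gadj_sym. Qed.
Lemma grI G u : G u u = false. Proof. exact: gadj_irr. Qed.
Lemma gr_neq G u v : G u v -> u != v.
Proof. by apply: contraTneq => ->; rewrite grI. Qed.

Lemma indE G A u v : ind G A u v = [&& u \in A, v \in A & G u v].
Proof.
rewrite /= /gr_adj /= (grC G v u); case: eqVneq => [->|_] /=.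
  by rewrite grI !andbF.
by case: (u \in A); case: (v \in A); case: (G u v).
Qed.

Lemma addEE G x y u v : x != y ->
  addE G x y u v = [|| G u v, (u == x) && (v == y) | (u == y) && (v == x)].
Proof.
move=> xy; rewrite /= /gr_adj /= (grC G v u); case: eqVneq => [->|_] /=.
  by rewrite grI /= !(andbC (v == y)) orbb; case: eqVneq => [->|] //=; rewrite (negPf xy).
by case: (G u v) => //=; rewrite andbC [(v == x) && _]andbC.
Qed.

Lemma delEE G x y u v :
  delE G x y u v = G u v && ~~ ((u == x) && (v == y) || (u == y) && (v == x)).
Proof.
rewrite /= /gr_adj /= (grC G v u); case: eqVneq => [->|_] /=.
  by rewrite grI /=.
by case: (G u v) => //=; do 4 case: eqP => //=.
Qed.

Lemma ctrP G D z u v :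
  reflect (u != v /\ exists a b, [/\ retr D z a = u, retr D z b = v & G a b])
          (ctr G D z u v).
Proof.
apply: (iffP andP) => -[uv].
  move=> /orP[]/existsP[a /existsP[b /and3P[/eqP e1 /eqP e2 ab]]]; split=> //.
    by exists a, b.
  by exists b, a; rewrite grC.
move=> [a [b [e1 e2 ab]]]; split=> //; apply/orP; left.
by apply/existsP; exists a; apply/existsP; exists b; rewrite e1 e2 !eqxx.
Qed.
End Construct.

(** * Random colourings *)

Section Counting.
Variables (R : realType) (V : finType) (k : nat).
Hypothesis k_gt1 : (1 < k)%N.
Notation col := {ffun V -> 'I_k}.
Implicit Types (phi psi : pred col) (S : {set V}).

Definition freq phi : R := #|phi|%:R / k%:R ^+ #|V|.

Definition depends_on phi S := forall f g : col, {in S, f =1 g} -> phi f = phi g.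
Definition color_inv phi := forall (s : {perm 'I_k}) (f : col),
  phi [ffun v => s (f v)] = phi f.

Lemma k_neq0 : k%:R != 0 :> R. Proof. by rewrite pnatr_eq0; lia. Qed.
Lemma k1_neq0 : k%:R - 1 != 0 :> R. Proof. by rewrite subr_eq0 -[1]/(1%:R) eqr_nat; lia. Qed.

Lemma eq_freq phi psi : phi =1 psi -> freq phi = freq psi.
Proof. by move=> e; rewrite /freq (eq_card e). Qed.

Lemma freqT : freq xpredT = 1.
Proof.
rewrite /freq (_ : #|_| = #|{: col}|); last by apply: eq_card.
by rewrite card_ffun card_ord natrX mulfV // expf_neq0 // k_neq0.
Qed.

Lemma freq_sum (I : finType) phi (h : col -> I) :
  freq phi = \sum_i freq [pred f | phi f && (h f == i)].
Proof.
rewrite /freq -mulr_suml -natr_sum; congr (_%:R / _).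
rewrite -sum1_card (partition_big h xpredT) //=; apply: eq_bigr => i _.
by rewrite -sum1_card; apply: eq_bigl => f.
Qed.

(* Two events depending on S1 and on S2 become independent once the colouring of
   S1 :&: S2 is prescribed: exchange two colourings on S1. *)
Lemma markov (psi1 psi2 : pred col) S1 S2 (tau : col) :
  depends_on psi1 S1 -> depends_on psi2 S2 ->
  (forall f, psi1 f -> {in S1 :&: S2, f =1 tau}) ->
  (forall f, psi2 f -> {in S1 :&: S2, f =1 tau}) ->
  freq psi1 * freq psi2 =
  freq [pred f | psi1 f && psi2 f] *
  freq [pred f : col | [forall v in S1 :&: S2, f v == tau v]].
Proof.
move=> d1 d2 a1 a2; rewrite /freq !mulf_div -!natrM; congr (_%:R / _).
set ag := [pred f | [forall v in _, _]].
pose mix (p : col * col) : col * col :=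
  ([ffun v => if v \in S1 then p.1 v else p.2 v],
   [ffun v => if v \in S1 then p.2 v else p.1 v]).
have mixK : involutive mix.
  by case=> f g; rewrite /mix /=; congr (_, _); apply/ffunP => v; rewrite !ffunE; case: (v \in S1).
rewrite -!cardX -[LHS]cardsE -[LHS](card_preimset _ (inv_inj mixK)); apply: eq_card => -[f g].
rewrite !inE /= !unfold_in /=.
have -> : psi1 [ffun v => if v \in S1 then f v else g v] = psi1 f.
  by apply: d1 => v vS; rewrite ffunE vS.
set g' := [ffun v => _] : col.
have e2 : psi1 f -> {in S1 :&: S2, g =1 tau} -> psi2 g' = psi2 f.
  move=> p1 ga; apply: d2 => v v2; rewrite ffunE; case: ifP => // v1.
  by rewrite ga ?(a1 _ p1) // inE v1.
apply/idP/idP => [/andP[p1 p2]|/andP[/andP[p1 p2] /'forall_implyP ga]]; last first.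
  by rewrite p1 e2 // => v /ga/eqP.
have ga : {in S1 :&: S2, g =1 tau}.
  move=> v vT; rewrite -(a2 _ p2) // ffunE.
  by move: vT; rewrite inE => /andP[-> _].
rewrite p1 -(e2 p1 ga) p2 /=; apply/'forall_implyP => v /ga ->.
by rewrite eqxx.
Qed.

Lemma sym1 phi x i j : color_inv phi ->
  freq [pred f | phi f && (f x == i)] = freq [pred f | phi f && (f x == j)].
Proof.
move=> ph; congr (_%:R / _); set s := tperm i j.
pose h (f : col) : col := [ffun v => s (f v)].
have hi : injective h.
  by move=> f g /ffunP e; apply/ffunP => v; have := e v; rewrite !ffunE => /perm_inj.
rewrite -[RHS]cardsE -[RHS](card_preimset _ hi); apply: eq_card => f.
by rewrite !inE /= ph ffunE -(inj_eq (@perm_inj _ s) (f x)) tpermL.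
Qed.

Lemma sym2 phi x y i j i' j' : color_inv phi -> i != j -> i' != j' ->
  freq [pred f | phi f && ((f x == i) && (f y == j))] =
  freq [pred f | phi f && ((f x == i') && (f y == j'))].
Proof.
move=> ph ij ij'; congr (_%:R / _).
(* The first transposition takes [i] to [i']; the second takes the image of [j] to [j'] and fixes
   [i'], which differs from both. *)
pose s := (tperm i i' * tperm (tperm i i' j) j')%g.
have si : s i = i'.
  rewrite permM tpermL tpermD 1?eq_sym //.
  by rewrite -[X in X != _](tpermL i) (inj_eq perm_inj).
have sj : s j = j' by rewrite permM tpermL.
pose h (f : col) : col := [ffun v => s (f v)].
have hi : injective h.
  by move=> f g /ffunP e; apply/ffunP => v; have := e v; rewrite !ffunE => /perm_inj.
rewrite -[RHS]cardsE -[RHS](card_preimset _ hi); apply: eq_card => f.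
by rewrite !inE /= ph !ffunE -(inj_eq (@perm_inj _ s) (f x)) -(inj_eq (@perm_inj _ s) (f y)) si sj.
Qed.

Lemma freq1 phi x i : color_inv phi ->
  freq [pred f | phi f && (f x == i)] = freq phi / k%:R.
Proof.
move=> ph; rewrite (freq_sum phi (fun f => f x)).
under eq_bigr do rewrite (sym1 x _ i ph).
by rewrite sumr_const card_ord -(mulr_natr (freq _)) mulfK // k_neq0.
Qed.

Lemma freq2_eq phi x y i : color_inv phi ->
  freq [pred f | phi f && ((f x == i) && (f y == i))] =
  freq [pred f | phi f && (f x == f y)] / k%:R.
Proof.
move=> ph; have ph' : color_inv [pred f | phi f && (f x == f y)].
  by move=> s f; rewrite /= ph !ffunE (inj_eq perm_inj).
rewrite -(freq1 x i ph'); apply: eq_freq => f /=; rewrite -andbA.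
by case: (f x =P i) => [->|]; rewrite ?andbF // andbT eq_sym.
Qed.

Lemma freq2_ne phi x y i j : color_inv phi -> i != j ->
  freq [pred f | phi f && ((f x == i) && (f y == j))] =
  freq [pred f | phi f && (f x != f y)] / (k%:R * (k%:R - 1)).
Proof.
move=> ph ij; rewrite (freq_sum [pred f | phi f && (f x != f y)] (fun f => (f x, f y))).
rewrite (bigID (fun p => p.1 == p.2)) /= big1 ?add0r; last first.
  move=> [a b] /= /eqP ->; apply: etrans (_ : freq xpred0 = 0); last first.
    by rewrite /freq card0 mul0r.
  apply: eq_freq => f /=; rewrite xpair_eqE.
  case: (f x =P b) => [->|_]; last by rewrite /= !andbF.
  by rewrite (eq_sym b (f y)); case: (f y == b); rewrite /= ?andbF.
rewrite (eq_bigr (fun=> freq [pred f | phi f && ((f x == i) && (f y == j))])); last first.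
  move=> [a b] /= ab; rewrite -(sym2 x y ph ab ij); apply: eq_freq => f /=.
  rewrite xpair_eqE -andbA; congr (_ && _); case: (f x =P a) => [->|]; rewrite ?andbF //=.
  by case: (f y =P b) => [->|]; rewrite ?andbF ?ab.
rewrite sumr_const (_ : #|_| = (k * (k - 1))%N).
  rewrite -(mulr_natr (freq _)) natrM natrB ?mulfK //; last by lia.
  by rewrite mulf_neq0 ?k_neq0 ?k1_neq0.
have := cardID [pred p : 'I_k * 'I_k | p.1 == p.2] predT.
rewrite [#|predT|]card_prod card_ord.
rewrite (_ : #|[predI _ & _]| = k); last first.
  rewrite -[RHS]card_ord -(card_imset predT (fun (a b : 'I_k) => fun (e : (a, a) = (b, b)) => congr1 fst e)).
  apply: eq_card => -[a b]; rewrite !inE /=; apply/eqP/imsetP => [->|[c _ [-> ->]] //].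
  by exists b.
rewrite (_ : #|[predD _ & _]| = #|[pred p : 'I_k * 'I_k | p.1 != p.2]|); last first.
  by apply: eq_card => -[a b]; rewrite !inE andbT.
by move=> e; rewrite mulnBr muln1 -e addKn.
Qed.

Lemma freq_pt x i : freq [pred f : col | f x == i] = k%:R^-1.
Proof. by have := @freq1 xpredT x i (fun _ _ => erefl); rewrite freqT mul1r. Qed.

Lemma freq_indep phi1 phi2 S1 S2 : depends_on phi1 S1 -> depends_on phi2 S2 -> S1 :&: S2 = set0 ->
  freq [pred f | phi1 f && phi2 f] = freq phi1 * freq phi2.
Proof.
move=> d1 d2 e0; pose c : 'I_k := Ordinal (ltnW k_gt1).
rewrite (@markov _ _ S1 S2 [ffun => c]) ?e0 //.
- rewrite (eq_freq (psi := xpredT) (phi := [pred f : col | [forall v in set0, _]])) ?freqT ?mulr1 //.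
  by move=> f /=; apply/'forall_implyP => v; rewrite inE.
- by move=> f _ v; rewrite inE.
- by move=> f _ v; rewrite inE.
Qed.

Lemma freq_pt2 x y i j : x != y ->
  freq [pred f : col | (f x == i) && (f y == j)] = k%:R^-1 * k%:R^-1.
Proof.
move=> xy; rewrite -{1}(freq_pt x i) -(freq_pt y j).
apply: (@freq_indep _ _ [set x] [set y]).
- by move=> f g /= e; rewrite e ?inE.
- by move=> f g /= e; rewrite e ?inE.
by apply/setP => v; rewrite !inE; case: (v =P x) => [->|] //; rewrite (negPf xy).
Qed.

(** A prescribed colour at [z] makes the two events independent, and the factor [k] is the inverse
    of the probability of that colour. Adding [z] to both supports makes them meet exactly in [z],
    even when [S1] and [S2] are disjoint. *)
Lemma glue1 phi1 phi2 S1 S2 z c : depends_on phi1 S1 -> depends_on phi2 S2 ->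
  S1 :&: S2 \subset [set z] ->
  freq [pred f | phi1 f && phi2 f && (f z == c)] =
  k%:R * (freq [pred f | phi1 f && (f z == c)] * freq [pred f | phi2 f && (f z == c)]).
Proof.
move=> d1 d2 s12.
have eT : (z |: S1) :&: (z |: S2) = [set z].
  rewrite -setUIr; apply/setUidPl.
  by [].
rewrite (@markov _ _ (z |: S1) (z |: S2) [ffun => c]) ?eT.
- rewrite (eq_freq (psi := [pred f : col | f z == c]) (phi := [pred f : col | [forall v in [set z], _]])).
    rewrite freq_pt mulrC mulfVK ?k_neq0 //; apply: eq_freq => f /=.
    by case: (phi1 f); case: (phi2 f); case: (f z == c).
  move=> f /=; apply/'forall_implyP/eqP => [|fz v]; last by rewrite inE ffunE => /eqP ->; apply/eqP.
  by move=> /(_ z); rewrite inE eqxx ffunE => /(_ isT)/eqP.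
- by move=> f g /= e; rewrite e ?inE ?eqxx // (d1 f g) // => v vS; rewrite e // inE vS orbT.
- by move=> f g /= e; rewrite e ?inE ?eqxx // (d2 f g) // => v vS; rewrite e // inE vS orbT.
- by move=> f /andP[_ /eqP fz] v; rewrite inE ffunE => /eqP ->.
- by move=> f /andP[_ /eqP fz] v; rewrite inE ffunE => /eqP ->.
Qed.

Lemma glue2 phi1 phi2 S1 S2 x y i j : x != y -> depends_on phi1 S1 -> depends_on phi2 S2 ->
  S1 :&: S2 \subset [set x; y] ->
  freq [pred f | phi1 f && phi2 f && ((f x == i) && (f y == j))] =
  k%:R * k%:R * (freq [pred f | phi1 f && ((f x == i) && (f y == j))] *
                 freq [pred f | phi2 f && ((f x == i) && (f y == j))]).
Proof.
move=> xy d1 d2 s12.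
have eT : ([set x; y] :|: S1) :&: ([set x; y] :|: S2) = [set x; y].
  by rewrite -setUIr; apply/setUidPl.
have xx : x \in [set x; y] by rewrite !inE eqxx.
have yy : y \in [set x; y] by rewrite !inE eqxx orbT.
pose tau : col := [ffun v => if v == x then i else j].
have tx : tau x = i by rewrite ffunE eqxx.
have ty : tau y = j by rewrite ffunE eq_sym (negPf xy).
rewrite (@markov _ _ ([set x; y] :|: S1) ([set x; y] :|: S2) tau) ?eT.
- rewrite (eq_freq (psi := [pred f : col | (f x == i) && (f y == j)])
    (phi := [pred f : col | [forall v in [set x; y], _]])).
    rewrite freq_pt2 // -invfM mulrC mulfVK ?mulf_neq0 ?k_neq0 //.
    apply: eq_freq => f /=.
    by case: (phi1 f); case: (phi2 f); case: (f x == i); case: (f y == j).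
  move=> f /=; apply/'forall_implyP/andP => [h|[/eqP fx /eqP fy] v].
    by have := h x xx; have := h y yy; rewrite tx ty.
  by rewrite !inE => /orP[]/eqP ->; rewrite ?tx ?ty ?fx ?fy.
- by move=> f g /= e; rewrite !e ?inE ?eqxx ?orbT // (d1 f g) // => v vS; rewrite e // inE vS orbT.
- by move=> f g /= e; rewrite !e ?inE ?eqxx ?orbT // (d2 f g) // => v vS; rewrite e // inE vS orbT.
- by move=> f /and3P[_ /eqP fx /eqP fy] v; rewrite !inE => /orP[]/eqP ->; rewrite ?tx ?ty.
- by move=> f /and3P[_ /eqP fx /eqP fy] v; rewrite !inE => /orP[]/eqP ->; rewrite ?tx ?ty.
Qed.

(** Given the colour of [z] the events are independent, and by colour symmetry the actual colour
    influences neither probability. *)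
Lemma freq_cut phi1 phi2 S1 S2 z : color_inv phi1 -> color_inv phi2 ->
  depends_on phi1 S1 -> depends_on phi2 S2 -> S1 :&: S2 \subset [set z] ->
  freq [pred f | phi1 f && phi2 f] = freq phi1 * freq phi2.
Proof.
move=> p1 p2 d1 d2 s12; rewrite (freq_sum _ (fun f => f z)).
under eq_bigr do rewrite (glue1 _ d1 d2 s12) !freq1 //.
rewrite sumr_const card_ord -(mulr_natr (_ * _)).
have kn := k_neq0; by field.
Qed.

Lemma sum_pairs (F : 'I_k -> 'I_k -> R) a b :
  (forall i, F i i = a) -> (forall i j, i != j -> F i j = b) ->
  \sum_i \sum_j F i j = k%:R * (a + (k%:R - 1) * b).
Proof.
move=> Fa Fb; rewrite (eq_bigr (fun=> a + (k%:R - 1) * b)) => [|i _].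
  by rewrite sumr_const card_ord -(mulr_natr (_ + _)) mulrC.
rewrite (bigD1 i) //= Fa (eq_bigr (fun=> b)) => [|j ji]; last by rewrite Fb // eq_sym.
rewrite sumr_const -(mulr_natr b) (_ : #|_| = k.-1).
  by congr (_ + _); rewrite mulrC -{2}(prednK (ltnW k_gt1)) -addn1 natrD addrK.
by rewrite cardC1 card_ord.
Qed.

Lemma freq_pareq phi1 phi2 S1 S2 x y : x != y -> color_inv phi1 -> color_inv phi2 ->
  depends_on phi1 S1 -> depends_on phi2 S2 -> S1 :&: S2 \subset [set x; y] ->
  freq [pred f | phi1 f && phi2 f && (f x == f y)] =
  k%:R * (freq [pred f | phi1 f && (f x == f y)] * freq [pred f | phi2 f && (f x == f y)]).
Proof.
move=> xy p1 p2 d1 d2 s12; rewrite (freq_sum _ (fun f => f x)).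
rewrite (eq_bigr (fun=> k%:R * k%:R *
   (freq [pred f | phi1 f && (f x == f y)] / k%:R *
   (freq [pred f | phi2 f && (f x == f y)] / k%:R)))) => [|i _].
  rewrite sumr_const card_ord -(mulr_natr (_ * _)).
  have kn := k_neq0; by field.
rewrite -!(freq2_eq _ _ i) // -(glue2 _ _ xy d1 d2 s12).
apply: eq_freq => f /=; rewrite -!andbA; congr [&& _, _ & _].
by case: (f x =P i) => [->|]; rewrite ?andbF // andbT eq_sym.
Qed.

Lemma freq_parne phi1 phi2 S1 S2 x y : x != y -> color_inv phi1 -> color_inv phi2 ->
  depends_on phi1 S1 -> depends_on phi2 S2 -> S1 :&: S2 \subset [set x; y] ->
  freq [pred f | phi1 f && phi2 f && (f x != f y)] =
  k%:R / (k%:R - 1) * (freq [pred f | phi1 f && (f x != f y)] * freq [pred f | phi2 f && (f x != f y)]).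
Proof.
move=> xy p1 p2 d1 d2 s12; rewrite (freq_sum _ (fun f => f x)).
under eq_bigr => i _ do rewrite (freq_sum _ (fun f => f y)).
rewrite (@sum_pairs _ 0 (k%:R * k%:R *
   (freq [pred f | phi1 f && (f x != f y)] / (k%:R * (k%:R - 1)) *
   (freq [pred f | phi2 f && (f x != f y)] / (k%:R * (k%:R - 1)))))) => [|i|i j ij].
- have kn := k_neq0; have k1 := k1_neq0; rewrite add0r; field; exact/andP.
- apply: etrans (_ : freq xpred0 = 0); last by rewrite /freq card0 mul0r.
  apply: eq_freq => f /=; case: (f x =P i) => [->|]; rewrite ?andbF //.
  by rewrite (eq_sym i); case: (f y == i); rewrite /= ?andbF.
rewrite -!(freq2_ne _ _ _ ij) // -(glue2 _ _ xy d1 d2 s12).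
apply: eq_freq => f /=; rewrite -!andbA; congr [&& _, _ & _].
case: (f x =P i) => [->|]; rewrite ?andbF //=.
by case: (f y =P j) => [->|]; rewrite ?andbF // ij.
Qed.

(** Sum over the common colour of [x] and [y] and the colour of the cut vertex [z]: the pairs with
    equal colours give the first term, those with different colours the second. *)
Lemma freq_series phi1 phi2 S1 S2 x y z : x \in S1 -> y \in S2 -> x != z -> y != z ->
  color_inv phi1 -> color_inv phi2 -> depends_on phi1 S1 -> depends_on phi2 S2 -> S1 :&: S2 \subset [set z] ->
  freq [pred f | phi1 f && phi2 f && (f x == f y)] =
  freq [pred f | phi1 f && (f x == f z)] * freq [pred f | phi2 f && (f z == f y)] +
  freq [pred f | phi1 f && (f x != f z)] * freq [pred f | phi2 f && (f z != f y)] / (k%:R - 1).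
Proof.
move=> x1 y2 xz yz p1 p2 d1 d2 s12; rewrite (freq_sum _ (fun f => f x)).
under eq_bigr => i _ do rewrite (freq_sum _ (fun f => f z)).
rewrite (@sum_pairs _ (k%:R *
   (freq [pred f | phi1 f && (f x == f z)] / k%:R *
   (freq [pred f | phi2 f && (f z == f y)] / k%:R))) (k%:R *
   (freq [pred f | phi1 f && (f x != f z)] / (k%:R * (k%:R - 1)) *
   (freq [pred f | phi2 f && (f z != f y)] / (k%:R * (k%:R - 1)))))) => [|i|i j ij].
- have kn := k_neq0; have k1 := k1_neq0; field; exact/andP.
- rewrite -!(freq2_eq _ _ i) //.
  have := @glue1 [pred f | phi1 f && (f x == i)] [pred f | phi2 f && (f y == i)] S1 S2 z i.
  rewrite (eq_freq (psi := [pred f | [pred f | phi1 f && phi2 f && (f x == f y) & f x == i] f & f z == i])).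
    move=> ->.
    + congr (_ * (_ * _)); apply: eq_freq => f /=.
        by rewrite -andbA; congr (_ && _).
      by rewrite -andbA; congr (_ && _); rewrite andbC.
    + by move=> f g /= e; rewrite e // (d1 f g).
    + by move=> f g /= e; rewrite e // (d2 f g).
    + by [].
  move=> f /=; case: (phi1 f) => //=; case: (phi2 f); rewrite /= ?andbF //=.
  by case: (f x =P i) => [->|]; rewrite ?andbF //= andbT eq_sym.
have ji : j != i by rewrite eq_sym.
rewrite -(freq2_ne x z p1 ij) // -(freq2_ne z y p2 ji) //.
have := @glue1 [pred f | phi1 f && (f x == i)] [pred f | phi2 f && (f y == i)] S1 S2 z j.
rewrite (eq_freq (psi := [pred f | [pred f | phi1 f && phi2 f && (f x == f y) & f x == i] f & f z == j])).
  move=> ->.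
  + congr (_ * (_ * _)); apply: eq_freq => f /=.
      by rewrite -andbA; congr (_ && _).
    by rewrite -andbA; congr (_ && _); rewrite andbC.
  + by move=> f g /= e; rewrite e // (d1 f g).
  + by move=> f g /= e; rewrite e // (d2 f g).
  + by [].
move=> f /=; case: (phi1 f) => //=; case: (phi2 f); rewrite /= ?andbF //=.
by case: (f x =P i) => [->|]; rewrite ?andbF //= andbT eq_sym.
Qed.
End Counting.

(** Restricting to [k > 1] keeps both [k] and [k - 1] invertible in the counting formulas to which
    this is applied. *)
Lemma poly_eq_nat (R : numDomainType) (p q : {poly R}) :
  (forall k : nat, (1 < k)%N -> p.[k%:R] = q.[k%:R]) -> p = q.
Proof.
move=> H; apply/eqP; rewrite -subr_eq0; apply/eqP.
set r := _ - _; apply: (@roots_geq_poly_eq0 _ _ [seq i%:R | i <- iota 2 (size r)]).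
- apply/allP => z /mapP[i + ->]; rewrite mem_iota => /andP[i2 _].
  by rewrite rootE hornerD hornerN H // subrr.
- rewrite map_inj_uniq ?iota_uniq // => i j /eqP.
  by rewrite eqr_nat => /eqP.
- by rewrite size_map size_iota.
Qed.

(** * Chromatic polynomials at real arguments, read as probabilities *)

Section Probability.
Variables (R : realType) (V : finType).
Implicit Types (G : graph V) (S : {set V}).

Definition ok k (G : graph V) : pred {ffun V -> 'I_k} :=
  [pred f : {ffun V -> 'I_k} | [forall x, forall y, G x y ==> (f x != f y)]].

Lemma okP k G (f : {ffun V -> 'I_k}) :
  reflect (forall x y, G x y -> f x != f y) (ok G f).
Proof.
apply: (iffP forallP) => [h x y xy|h x].
  by have /forallP/(_ y)/implyP := h x; exact.
by apply/forallP => y; apply/implyP; exact: h.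
Qed.

Definition pol G : {poly R} := chromatic_poly (sg G) R.

Lemma polE k G : (1 < k)%N -> (pol G).[k%:R] = freq R (@ok k G) * k%:R ^+ #|V|.
Proof.
move=> k1; rewrite /pol chromatic_polyE /freq mulfVK ?expf_neq0 ?(k_neq0 _ k1) //.
Qed.

Definition supp G S := forall u v, G u v -> u \in S.
Definition edge_union G G1 G2 := forall u v, G u v = G1 u v || G2 u v.

Lemma ok_color_inv k G : color_inv (@ok k G).
Proof.
move=> s f; apply/okP/okP => h x y xy; have := h x y xy; rewrite !ffunE (inj_eq perm_inj) //.
Qed.

Lemma ok_depends_on k G S : supp G S -> depends_on (@ok k G) S.
Proof.
move=> sG f g e; apply/okP/okP => h x y xy; have := h x y xy; rewrite !e //;
  by [apply: sG xy|apply: (sG y x); rewrite grC].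
Qed.

Lemma ok_union k G G1 G2 : edge_union G G1 G2 -> @ok k G =1 [pred f | ok G1 f && ok G2 f].
Proof.
move=> U f /=; apply/okP/andP => [h|[/okP h1 /okP h2] x y].
  by split; apply/okP => x y xy; apply: h; rewrite U xy ?orbT.
by rewrite U => /orP[/h1|/h2].
Qed.

Lemma ok_add k G x y : x != y ->
  @ok k (addE G x y) =1 [pred f | ok G f && (f x != f y)].
Proof.
move=> xy f /=; apply/okP/andP => [h|[/okP h1 h2] u v].
  split; last by apply: h; rewrite addEE // !eqxx orbT.
  by apply/okP => u v uv; apply: h; rewrite addEE // uv.
rewrite addEE // => /or3P[/h1 //|/andP[/eqP -> /eqP ->] //|/andP[/eqP -> /eqP ->]].
by rewrite eq_sym.
Qed.

(* At t = k these are the probabilities that a uniform k-colouring is proper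
   (and gives x and y distinct, respectively equal, colours).  Dividing by t ^ #|V|
   makes isolated vertices harmless.  The gluing rules below are checked at
   integers t = k > 1 and extended by polynomial identity. *)
Definition pr t G : R := (pol G).[t] / t ^+ #|V|.
Definition pne t G x y := pr t (addE G x y).
Definition peq t G x y := pr t G - pne t G x y.

Lemma prE t G : pr t G = (chromatic_poly (sg G) R).[t] / t ^+ #|V|.
Proof. by []. Qed.

Lemma eq_pol G G' : G =2 G' -> pol G = pol G'.
Proof.
move=> e; apply: poly_eq_nat => k k1; rewrite !polE //; congr (_ * _).
apply: eq_freq => f; apply/okP/okP => h x y xy; apply: h; first by rewrite e.
by rewrite -e.
Qed.

Lemma eq_pr t G G' : G =2 G' -> pr t G = pr t G'.
Proof. by move=> /eq_pol e; rewrite /pr e. Qed.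

Lemma eq_pne t G G' x y : G =2 G' -> pne t G x y = pne t G' x y.
Proof. by move=> e; apply: eq_pr => u v; rewrite /= /gr_adj /= !e. Qed.

Lemma eq_peq t G G' x y : G =2 G' -> peq t G x y = peq t G' x y.
Proof. by move=> e; rewrite /peq (eq_pr t e) (eq_pne t x y e). Qed.

Lemma polE_ne k G x y : (1 < k)%N -> x != y -> (pol (addE G x y)).[k%:R] =
  freq R [pred f : {ffun V -> 'I_k} | ok G f && (f x != f y)] * k%:R ^+ #|V|.
Proof. by move=> k1 xy; rewrite polE //; congr (_ * _); apply/eq_freq/ok_add. Qed.

Lemma polE_eq k G x y : (1 < k)%N -> x != y ->
  (pol G).[k%:R] - (pol (addE G x y)).[k%:R] =
  freq R [pred f : {ffun V -> 'I_k} | ok G f && (f x == f y)] * k%:R ^+ #|V|.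
Proof.
move=> k1 xy; rewrite polE_ne // polE // -mulrBl; congr (_ * _).
rewrite (freq_sum _ (@ok k G) (fun f => f x == f y)) big_bool /=.
set a := freq _ _; set b := freq _ _; set c := freq _ _; set d := freq _ _.
have -> : b = c by apply: eq_freq => f /=; rewrite eqbF_neg.
by rewrite addrK; apply: eq_freq => f /=; rewrite eqb_id.
Qed.

Section Formulas.
Variables (t : R) (t0 : t != 0).

Lemma pr_edgeless G : (forall u v, G u v = false) -> pr t G = 1.
Proof.
move=> h; suff e : pol G = 'X ^+ #|V|.
  by rewrite /pr e hornerXn mulfV // expf_neq0.
apply: poly_eq_nat => k k1; rewrite polE // hornerXn -[RHS]mul1r -(freqT R V k1).
by congr (_ * _); apply: eq_freq => f; apply/okP => x y; rewrite h.
Qed.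

Lemma pr_cut G G1 G2 S1 S2 z : edge_union G G1 G2 -> supp G1 S1 -> supp G2 S2 ->
  S1 :&: S2 \subset [set z] -> pr t G = pr t G1 * pr t G2.
Proof.
move=> U s1 s2 s12; have e : pol G * 'X ^+ #|V| = pol G1 * pol G2.
  apply: poly_eq_nat => k k1; rewrite !hornerE !polE //.
  rewrite (eq_freq R (ok_union U)) (freq_cut R k1 (ok_color_inv _) (ok_color_inv _) (ok_depends_on s1) (ok_depends_on s2) s12).
  by ring.
rewrite /pr mulf_div -hornerM -e !hornerE.
by move: (expf_neq0 #|V| t0); move: (t ^+ _) => T h; field.
Qed.

(** In the contraction [y] survives as an isolated vertex. Its colour is free, and agreement with
    the colour of [x] costs the factor [1 / t]. *)
Lemma peq_ctr G x y : x != y -> ~~ G x y -> peq t G x y = pr t (ctr G [set x; y] x) / t.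
Proof.
move=> xy nxy; set C := ctr _ _ _.
have cP u v : reflect (u != v /\ exists a b,
    [/\ retr [set x; y] x a = u, retr [set x; y] x b = v & G a b]) (C u v) by exact: ctrP.
have ry (a : V) : retr [set x; y] x a != y.
  by rewrite /retr; case: ifP => [//|]; rewrite !inE => /norP[].
have sC : supp C [set~ y] by move=> u v /cP[_ [a [b [<- _ _]]]]; rewrite !inE ry.
have e : (pol G - pol (addE G x y)) * 'X = pol C.
  apply: poly_eq_nat => k k1; rewrite !hornerE polE_eq // polE // mulrAC; congr (_ * _).
  pose E i := [pred f : {ffun V -> 'I_k} | ok C f && (f x == i) && (f y == i)].
  have eE i : freq R (E i) = freq R (@ok k C) / k%:R / k%:R.
    rewrite (@freq_indep _ _ _ k1 [pred f : {ffun V -> 'I_k} | ok C f && (f x == i)] [pred f : {ffun V -> 'I_k} | f y == i] [set~ y] [set y]).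
    - by rewrite (freq_pt _ k1) (freq1 _ k1) //; exact: ok_color_inv.
    - by move=> f g eg /=; rewrite (ok_depends_on sC eg) eg // !inE.
    - by move=> f g eg /=; rewrite eg // !inE.
    - by apply/setP => v; rewrite !inE; case: eqP.
  have -> : freq R (@ok k C) = k%:R * \sum_i freq R (E i).
    rewrite (eq_bigr (fun=> freq R (@ok k C) / k%:R / k%:R)) // sumr_const card_ord -(mulr_natr (_ / _)).
    by have kn := k_neq0 R k1; field.
  rewrite mulrC; congr (_ * _).
  rewrite (freq_sum _ _ (fun f => f x)); apply: eq_bigr => i _; apply: eq_freq => f /=.
  case: (f x =P i) => [fx|]; rewrite ?andbF ?andbT //; rewrite -fx [f x == f y]eq_sym.
  case: (f y =P f x) => [fy|]; rewrite ?andbF ?andbT //.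
  have fr a : f (retr [set x; y] x a) = f a.
    by rewrite /retr; case: ifP => //; rewrite !inE => /orP[]/eqP ->.
  apply/okP/okP => h u v.
    by move=> /cP[_ [a [b [<- <- ab]]]]; rewrite !fr; apply: h.
  move=> uv; rewrite -(fr u) -(fr v); apply: h; apply/cP; split; last by exists u, v.
  rewrite /retr !inE; have uv' := gr_neq uv; case: ifP; case: ifP => //.
  - move=> /orP[]/eqP ev /orP[]/eqP eu; move: uv uv'; rewrite ev eu ?eqxx ?(negPf nxy) //.
    by rewrite grC (negPf nxy).
  - by move=> /norP[vx vy] _; rewrite eq_sym.
  - by move=> _ /norP[].
rewrite /peq /pne /pr -mulrBl -e !hornerE.
by move: (expf_neq0 #|V| t0); move: (t ^+ _) => T h; field; exact/andP.
Qed.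

Lemma peq_par G G1 G2 S1 S2 x y : x != y -> edge_union G G1 G2 -> supp G1 S1 -> supp G2 S2 ->
  S1 :&: S2 \subset [set x; y] -> peq t G x y = t * (peq t G1 x y * peq t G2 x y).
Proof.
move=> xy U s1 s2 s12.
have e : (pol G - pol (addE G x y)) * 'X ^+ #|V| =
    'X * ((pol G1 - pol (addE G1 x y)) * (pol G2 - pol (addE G2 x y))).
  apply: poly_eq_nat => k k1; rewrite !hornerE !polE_eq //.
  rewrite (@eq_freq _ _ _ _ [pred f : {ffun V -> 'I_k} | ok G1 f && ok G2 f && (f x == f y)]); last first.
    by move=> f /=; rewrite (ok_union U).
  rewrite (freq_pareq R k1 xy (ok_color_inv _) (ok_color_inv _) (ok_depends_on s1) (ok_depends_on s2) s12).
  by rewrite /=; ring.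
have := expf_neq0 #|V| t0.
rewrite /peq /pne /pr -!mulrBl mulf_div mulrA; have := congr1 (horner^~ t) e; rewrite !hornerE /= => <-.
by move: (t ^+ _) => T h; field.
Qed.

Lemma pne_par G G1 G2 S1 S2 x y : t != 1 -> x != y -> edge_union G G1 G2 -> supp G1 S1 -> supp G2 S2 ->
  S1 :&: S2 \subset [set x; y] -> pne t G x y = t / (t - 1) * (pne t G1 x y * pne t G2 x y).
Proof.
move=> t1 xy U s1 s2 s12.
have e : pol (addE G x y) * ('X - 1) * 'X ^+ #|V| =
    'X * (pol (addE G1 x y) * pol (addE G2 x y)).
  apply: poly_eq_nat => k k1; rewrite !hornerE !polE_ne //.
  rewrite (@eq_freq _ _ _ _ [pred f : {ffun V -> 'I_k} | ok G1 f && ok G2 f && (f x != f y)]); last first.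
    by move=> f /=; rewrite (ok_union U).
  rewrite (freq_parne R k1 xy (ok_color_inv _) (ok_color_inv _) (ok_depends_on s1) (ok_depends_on s2) s12).
  by rewrite /=; have kn := k1_neq0 R k1; field.
have := expf_neq0 #|V| t0.
have h1 : t - 1 != 0 by rewrite subr_eq0.
have := congr1 (horner^~ t) e; rewrite !hornerE /= /pne /peq /pr /pne /pr.
move: (t ^+ _) => T e' h.
have e2 : (pol (addE G1 x y)).[t] * (pol (addE G2 x y)).[t] =
    (pol (addE G x y)).[t] * (t - 1) * T / t by rewrite e'; field.
have e3 a b : t / (t - 1) * a / T * b / T = t / (t - 1) * (a * b / (T * T)).
  by field; exact/andP.
by rewrite e3 e2; field; exact/and3P.
Qed.

Lemma peq_series G G1 G2 S1 S2 x y z : t != 1 -> x != z -> y != z -> x \in S1 -> y \in S2 ->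
  edge_union G G1 G2 -> supp G1 S1 -> supp G2 S2 -> S1 :&: S2 \subset [set z] ->
  peq t G x y = peq t G1 x z * peq t G2 z y + pne t G1 x z * pne t G2 z y / (t - 1).
Proof.
move=> t1 xz yz x1 y2 U s1 s2 s12.
have zy : z != y by rewrite eq_sym.
have xy : x != y.
  apply: contraNneq xz => xy; have := subsetP s12 x.
  by rewrite !inE x1 xy y2 => /(_ isT).
have e : (pol G - pol (addE G x y)) * ('X - 1) * 'X ^+ #|V| =
    ('X - 1) * ((pol G1 - pol (addE G1 x z)) * (pol G2 - pol (addE G2 z y))) +
    pol (addE G1 x z) * pol (addE G2 z y).
  apply: poly_eq_nat => k k1; rewrite !hornerE !polE_eq // !polE_ne //.
  rewrite (@eq_freq _ _ _ _ [pred f : {ffun V -> 'I_k} | ok G1 f && ok G2 f && (f x == f y)]); last first.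
    by move=> f /=; rewrite (ok_union U).
  rewrite (freq_series R k1 x1 y2 xz yz (ok_color_inv _) (ok_color_inv _) (ok_depends_on s1) (ok_depends_on s2) s12).
  by rewrite /=; have kn := k1_neq0 R k1; field.
have := expf_neq0 #|V| t0.
have h1 : t - 1 != 0 by rewrite subr_eq0.
have := congr1 (horner^~ t) e; rewrite !hornerE /= /pne /peq /pr /pne /pr.
move: (t ^+ _) => T e' h.
rewrite -!mulrBl !mulf_div; apply: (mulIf h1); apply: (mulIf h); apply: (mulIf h).
have -> : forall a, a / T * (t - 1) * T * T = a * (t - 1) * T by move=> a; field.
by rewrite e'; field; exact/andP.
Qed.
End Formulas.
End Probability.

Global Opaque pol pr.

(** * Connectivity *)

Section Connectivity.
Variable V : finType.
Implicit Types (G : graph V) (A B C D S U W Z : {set V}) (u v x y z : V).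

(** Such a [C] is a union of components of the graph induced on [A]. Connectivity and separations
    are expressed by these sets, which restrict and complement easily, instead of by paths. *)
Definition cl G A C : bool :=
  (C \subset A) && [forall u in C, forall v in A, G u v ==> (v \in C)].

Lemma clP G A C :
  reflect (C \subset A /\ forall u v, u \in C -> v \in A -> G u v -> v \in C) (cl G A C).
Proof.
apply: (iffP andP) => -[CA h]; split=> //.
  by move=> u v uC vA uv; have /'forall_implyP/(_ u uC)/'forall_implyP/(_ v vA)/implyP := h; exact.
apply/'forall_implyP => u uC; apply/'forall_implyP => v vA; apply/implyP; exact: h.
Qed.

Definition conn G A : Prop :=
  A != set0 /\ forall C, C != set0 -> cl G A C -> C = A.

Lemma cl_compl G A C : cl G A C -> cl G A (A :\: C).
Proof.
move=> /clP[CA h]; apply/clP; split; first exact: subsetDl.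
move=> u v; rewrite !inE => /andP[uC uA] vA uv; rewrite vA andbT.
by apply: contra uC => vC; apply: (h v u) => //; rewrite grC.
Qed.

Lemma cl_mono G G' A C : (forall u v, u \in A -> v \in A -> G u v -> G' u v) ->
  cl G' A C -> cl G A C.
Proof.
move=> e /clP[CA h]; apply/clP; split=> // u v uC vA uv.
by apply: (h u v) => //; apply: e => //; apply: (subsetP CA).
Qed.

Lemma conn_mono G G' A : (forall u v, u \in A -> v \in A -> G u v -> G' u v) ->
  conn G A -> conn G' A.
Proof. by move=> e [A0 h]; split=> // C C0 cC; apply: h => //; apply: cl_mono cC. Qed.

Lemma conn_cl G A B C : conn G A -> A \subset B -> cl G B C ->
  forall a, a \in A -> a \in C -> A \subset C.
Proof.
move=> [A0 h] AB /clP[CB k] a aA aC.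
rewrite -(h (A :&: C)); first exact: subsetIr.
  by apply/set0Pn; exists a; rewrite inE aA.
apply/clP; split; first exact: subsetIl.
move=> u v; rewrite !inE => /andP[uA uC] vA uv; rewrite vA /=.
by apply: (k u) => //; apply: (subsetP AB).
Qed.

Lemma conn1 G x : conn G [set x].
Proof.
split=> [|C C0 /clP[Cx _]]; first by apply/set0Pn; exists x; rewrite inE.
by apply/eqP; rewrite eqEsubset Cx; case/set0Pn: C0 => y yC; have := subsetP Cx y yC; rewrite inE => /eqP <-; rewrite sub1set.
Qed.

Lemma connU G A B a b : conn G A -> conn G B -> a \in A -> b \in B -> G a b ->
  conn G (A :|: B).
Proof.
move=> cA cB aA bB ab; split.
  by apply/set0Pn; exists a; rewrite inE aA.
move=> C /set0Pn[c cC] cl'; have [CAB h] := clP _ _ _ cl'.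
have sA := conn_cl cA (subsetUl A B) cl'; have sB := conn_cl cB (subsetUr A B) cl'.
suff /andP[aC bC] : (a \in C) && (b \in C).
  by apply/eqP; rewrite eqEsubset CAB subUset (sA a) ?(sB b).
have := subsetP CAB c cC; rewrite inE => /orP[cA'|cB'].
  have aC := subsetP (sA c cA' cC) a aA; rewrite aC.
  by apply: (h a b) => //; rewrite inE bB orbT.
have bC := subsetP (sB c cB' cC) b bB; rewrite bC andbT.
by apply: (h b a) => //; rewrite ?inE ?aA // grC.
Qed.

(** A minimal nonempty closed set is a component. *)
Lemma comp_exists G B : B != set0 -> exists U, conn G U /\ cl G B U.
Proof.
move=> B0; pose P (C : {set V}) := (C != set0) && cl G B C.
have PB : P B by rewrite /P B0; apply/clP.
have [U /minsetP[/andP[U0 clU] minU] _] := minset_exists PB.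
exists U; split=> //; split=> // C C0 cC; have [CU h] := clP _ _ _ cC.
have [UB k] := clP _ _ _ clU.
apply: minU => //; rewrite /P C0; apply/clP; split; first exact: subset_trans UB.
move=> u v uC vB uv; apply: (h u v) => //; apply: (k u v) => //.
exact: (subsetP CU).
Qed.

Lemma conn_connected G A : conn G A <-> connected_set (G := sg G) A.
Proof.
split=> -[A0 h]; split=> //.
  move=> x y xA yA; pose e := [rel u v | [&& u \in A, v \in A & G u v]].
  have : [set v in A | connect e x v] = A.
    apply: h; first by apply/set0Pn; exists x; rewrite inE xA connect0.
    apply/clP; split; first by apply/subsetP => v; rewrite inE => /andP[].
    move=> u v; rewrite !inE => /andP[uA xu] vA uv; rewrite vA.
    by apply: connect_trans xu (connect1 _); rewrite /= uA vA.
  by move=> /setP/(_ y); rewrite inE yA => /idP.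
move=> C /set0Pn[x xC] /clP[CA k]; apply/eqP; rewrite eqEsubset CA /=.
apply/subsetP => y yA; have xA := subsetP CA x xC.
have /connectP[p pp ->] := h x y xA yA.
elim: p x xC {xA} pp => //= z p IH x xC /andP[/and3P[_ zA xz]] /IH; apply.
exact: (k x z).
Qed.

(* K2 counts as biconnected. *)
Definition biconn G A : Prop :=
  (1 < #|A|)%N /\ forall Z, (#|Z| <= 1)%N -> conn G (A :\: Z).

Lemma biconn_mono G G' A : (forall u v, u \in A -> v \in A -> G u v -> G' u v) ->
  biconn G A -> biconn G' A.
Proof.
move=> e [A1 h]; split=> // Z /h; apply: conn_mono => u v.
by rewrite !inE => /andP[_ uA] /andP[_ vA]; apply: e.
Qed.

Lemma small_set Z x y : x != y -> (#|Z| <= 1)%N -> x \in Z -> y \in Z -> False.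
Proof.
move=> xy Z1 xZ yZ; have : [set x; y] \subset Z by rewrite subUset !sub1set xZ.
by move=> /subset_leq_card; rewrite cards2 xy; lia.
Qed.

Definition att G S x : Prop := exists2 s, s \in S & G x s.

Lemma retr_in D z u : u \in D -> retr D z u = z.
Proof. by rewrite /retr => ->. Qed.
Lemma retr_out D z u : u \notin D -> retr D z u = u.
Proof. by rewrite /retr => /negPf ->. Qed.

(** A single deleted vertex cannot remove both attachments [x] and [y] of the new vertex. *)
Lemma biconn_ear G B x y z : biconn G B -> z \notin B -> x != y -> x \in B -> y \in B ->
  G z x -> G z y -> biconn G (z |: B).
Proof.
move=> [B1 h] zB xy xB yB zx zy; split; first by rewrite cardsU1 zB; lia.
move=> Z Z1; case: (boolP (z \in Z)) => zZ.
  have -> : (z |: B) :\: Z = B :\: Z; last exact: h.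
  by apply/setP => u; rewrite !inE; case: (u =P z) => [->|] //; rewrite zZ.
have -> : (z |: B) :\: Z = [set z] :|: (B :\: Z).
  by apply/setP => u; rewrite !inE; case: (u =P z) => [->|] //; rewrite (negPf zZ).
have zz : z \in [set z] by rewrite inE.
case: (boolP (x \in Z)) => xZ; last first.
  by apply: (connU (conn1 G z) (h Z Z1) zz _ zx); rewrite inE xZ.
case: (boolP (y \in Z)) => yZ; first by case: (small_set xy Z1 xZ yZ).
by apply: (connU (conn1 G z) (h Z Z1) zz _ zy); rewrite inE yZ.
Qed.

Section Piece.
Variables (G : graph V) (A : {set V}) (x y : V).
Hypotheses (tcA : biconn G A) (xy : x != y) (xA : x \in A) (yA : y \in A).
Notation A' := (A :\: [set x; y]).

Section Closed.
Variable W : {set V}.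
Hypothesis clW : cl G A' W.

Lemma piece_notin : (x \notin W) * (y \notin W) * (W \subset A).
Proof.
have /clP[WA _] := clW; split; first split.
- by apply/negP => /(subsetP WA); rewrite !inE eqxx.
- by apply/negP => /(subsetP WA); rewrite !inE eqxx orbT.
- by apply: subset_trans WA (subsetDl _ _).
Qed.

(** A closed set avoiding both [x] and [y] would also be closed in [A :\: Z], hence be all of it;
    but [Z] cannot contain both [x] and [y]. *)
Lemma piece_meet Z C : (#|Z| <= 1)%N -> C != set0 ->
  cl G ((W :|: [set x; y]) :\: Z) C -> (x \in C) || (y \in C).
Proof.
move=> Z1 C0 /clP[CW h]; apply: contraT => /norP[xC yC].
have [WA k] := clP _ _ _ clW; have [_ /(_ Z Z1)[_ cA]] := tcA.
have CWW u : u \in C -> (u \in W) && (u \notin Z).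
  move=> uC; have := subsetP CW u uC; rewrite !inE => /andP[-> /orP[->|/orP[]/eqP e]] //.
    by rewrite -e uC in xC.
  by rewrite -e uC in yC.
have cl1 : cl G (A :\: Z) C.
  apply/clP; split.
    apply/subsetP => u /CWW/andP[uW uZ]; rewrite inE uZ /=.
    by have := subsetP WA u uW; rewrite inE => /andP[].
  move=> u v uC; rewrite inE => /andP[vZ vA] uv; have /andP[uW _] := CWW u uC.
  apply: (h u v) => //; rewrite in_setD vZ /= in_setU orbC.
  case: (boolP (v \in [set x; y])) => //= vxy.
  by apply: (k u v) => //; rewrite in_setD vxy.
have eC := cA C C0 cl1.
case: (boolP (x \in Z)) => xZ; last by rewrite eC inE xZ xA in xC.
case: (boolP (y \in Z)) => yZ; last by rewrite eC inE yZ yA in yC.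
by case: (small_set xy Z1 xZ yZ).
Qed.

(** If only one of [x] and [y] had a neighbour in [W], it would be a cut vertex of [A]; if neither
    had, [A] would be disconnected. *)
Lemma piece_att : W != set0 -> att G W x /\ att G W y.
Proof.
move=> W0; have [[xW yW] WA] := piece_notin; have [_ k] := clP _ _ _ clW.
have key (a b : V) : [set a; b] = [set x; y] -> a != b -> a \in A -> a \notin W -> b \notin W -> att G W a.
  move=> e ab aA aW bW; have [_ /(_ [set b])[|_ cA]] := tcA; first by rewrite cards1.
  case: (boolP [exists s in W, G a s]) => [/existsP[s /andP[sW as_]]|]; first by exists s.
  move=> /existsPn n; have : W = A :\: [set b].
    apply: cA => //; apply/clP; split.
      apply/subsetP => u uW; rewrite !inE (subsetP WA u uW) andbT.
      by apply: contra bW => /eqP <-.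
    move=> u v uW; rewrite !inE => /andP[vb vA] uv.
    have va : v != a by apply: contra (n u) => /eqP <-; rewrite uW grC.
    by apply: (k u v) => //; rewrite -e !inE negb_or va vb.
  by move=> /setP/(_ a); rewrite !inE (negPf aW) ab aA.
split; first exact: (key x y).
by apply: (key y x); rewrite // ?(eq_sym y) // setUC.
Qed.

(** In a separation of the piece both sides meet [[set x; y]], so the added edge [xy] crosses it. *)
Lemma biconn_add : biconn (addE G x y) (W :|: [set x; y]).
Proof.
split.
  have : (#|[set x; y]| <= #|W :|: [set x; y]|)%N by apply/subset_leq_card/subsetUr.
  by rewrite cards2 xy; lia.
move=> Z Z1; split.
  case: (boolP (x \in Z)) => xZ; last by apply/set0Pn; exists x; rewrite !inE xZ eqxx orbT.
  case: (boolP (y \in Z)) => yZ; last by apply/set0Pn; exists y; rewrite !inE yZ eqxx !orbT.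
  by case: (small_set xy Z1 xZ yZ).
move=> C C0 cC; apply/eqP; apply: contraT => nC; set B := _ :\: Z in cC nC.
have cC' := cl_compl cC; have [CB hC] := clP _ _ _ cC.
have D0 : B :\: C != set0 by apply: contra nC; rewrite setD_eq0 eqEsubset CB.
have le u v : u \in B -> v \in B -> G u v -> addE G x y u v by rewrite addEE // => _ _ ->.
have := piece_meet Z1 C0 (cl_mono le cC); have := piece_meet Z1 D0 (cl_mono le cC').
have exy : addE G x y x y by rewrite addEE // !eqxx orbT.
rewrite !(in_setD B) => /orP[/andP[n1 x1]|/andP[n1 y1]] /orP[] c.
- by rewrite c in n1.
- by rewrite (hC y x) // grC in n1.
- by rewrite (hC x y) in n1.
- by rewrite c in n1.
Qed.

(** Two disjoint connected sets attached to both [x] and [y] replace the edge [xy]: one of them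
    survives the deletion of a vertex and joins the two sides of any separation. *)
Lemma biconn_union U1 U2 : U1 \subset W -> U2 \subset W -> [disjoint U1 & U2] ->
  conn G U1 -> conn G U2 -> att G U1 x -> att G U1 y -> att G U2 x -> att G U2 y ->
  biconn G (W :|: [set x; y]).
Proof.
move=> s1 s2 dis c1 c2 a1x a1y a2x a2y; split.
  by have [] := biconn_add.
move=> Z Z1; split.
  by have [_ /(_ Z Z1)[]] := biconn_add.
move=> C C0 cC; apply/eqP; apply: contraT => nC; set B := _ :\: Z in cC nC.
have cC' := cl_compl cC; have [CB hC] := clP _ _ _ cC.
have D0 : B :\: C != set0 by apply: contra nC; rewrite setD_eq0 eqEsubset CB.
have := piece_meet Z1 C0 cC; have := piece_meet Z1 D0 cC'; rewrite !(in_setD B) => m1 m2.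
have [xB yB e] : [/\ x \in B, y \in B & (x \in C) (+) (y \in C)].
  case/orP: m1 => /andP[n1 b1]; case/orP: m2 => c; split; rewrite ?(negPf n1) ?c //.
  - by rewrite c in n1.
  - by rewrite c in n1.
  - exact: (subsetP CB).
  - exact: (subsetP CB).
  - by rewrite c in n1.
  - by rewrite c in n1.
have [U [sU cU [ux ux1 ux2] [uy uy1 uy2] dZ]] : exists U, [/\ U \subset W, conn G U, att G U x, att G U y & [disjoint U & Z]].
  case: (boolP [disjoint U1 & Z]) => [d|]; first by exists U1.
  move=> /pred0Pn[a /andP[/= aU aZ]]; exists U2; split=> //.
  rewrite disjoint_subset; apply/subsetP => b bU; rewrite inE; apply/negP => bZ.
  apply: (@small_set Z a b) => //; apply/eqP => ab; have := disjointFr dis aU.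
  by rewrite ab bU.
have UB : U \subset B.
  apply/subsetP => u uU; rewrite !inE (subsetP sU) //= andbT.
  by rewrite (disjointFr dZ uU).
have UC := conn_cl cU UB cC; have UC' := conn_cl cU UB cC'.
have BU := subsetP UB.
have xc : (x \in C) = (ux \in C).
  by apply/idP/idP => h; [apply: (hC x) => //; exact: BU|apply: (hC ux) => //; rewrite grC].
have yc : (y \in C) = (uy \in C).
  by apply/idP/idP => h; [apply: (hC y) => //; exact: BU|apply: (hC uy) => //; rewrite grC].
suff : (ux \in C) = (uy \in C) by move=> e'; rewrite xc yc e' addbb in e.
by apply/idP/idP => h; [apply: (subsetP (UC ux ux1 h))|apply: (subsetP (UC uy uy1 h))].
Qed.

(** Deleting the merged vertex leaves the connected set [W]. After any other deletion, every closed
    set still reaches [x] or [y], that is, the merged vertex. *)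
Lemma biconn_ctr : conn G W -> biconn (ctr (ind G (W :|: [set x; y])) [set x; y] x) (x |: W).
Proof.
move=> cW; have [[xW yW] WA] := piece_notin; set H := ctr _ _ _.
have [W0 _] := cW.
have Hp u v : G u v -> u \in W -> v \in W :|: [set x; y] -> H u (retr [set x; y] x v).
  move=> uv uW vW; have uxy : u \notin [set x; y].
    by rewrite !inE; apply/norP; split; [apply: contra xW|apply: contra yW] => /eqP <-.
  apply/ctrP; split.
    rewrite /retr; case: ifP => _; first by apply: contra xW => /eqP <-.
    exact: gr_neq uv.
  by exists u, v; rewrite (retr_out _ uxy) indE in_setU uW vW uv.
have xxy : x \in [set x; y] by rewrite !inE eqxx.
split; first by rewrite cardsU1 xW add1n ltnS card_gt0.
move=> Z Z1; split.
  case: (boolP (x \in Z)) => xZ; last by apply/set0Pn; exists x; rewrite !inE xZ eqxx.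
  case/set0Pn: W0 => w wW; apply/set0Pn; exists w; rewrite !inE wW orbT andbT.
  apply/negP => wZ; apply: (small_set _ Z1 xZ wZ).
  by apply: contra xW => /eqP ->.
move=> C C0 cC; apply/eqP; apply: contraT => nC; set B := _ :\: Z in cC nC.
have cC' := cl_compl cC; have [CB hC] := clP _ _ _ cC.
have D0 : B :\: C != set0 by apply: contra nC; rewrite setD_eq0 eqEsubset CB.
have [D [D1 D2 D3 clD D4]] : exists D, [/\ D != set0, x \notin D, D \subset B, cl H B D & D != B].
  case: (boolP (x \in C)) => xC; last by exists C.
  exists (B :\: C); split=> //; rewrite ?in_setD ?xC ?subsetDl //.
  apply: contra C0 => /eqP/setP e; apply/set0Pn => -[c cC0].
  by have := e c; rewrite inE cC0 (subsetP CB).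
have {}hC := (clP _ _ _ clD).2.
have DW : D \subset W.
  apply/subsetP => u uD; have := subsetP D3 u uD; rewrite !inE.
  by case/andP => _ /orP[/eqP e|//]; rewrite -e uD in D2.
case: (boolP (x \in Z)) => xZ.
  have eB : B = W.
    apply/setP => u; rewrite !inE; case: eqVneq => [->|ux] /=.
      by rewrite xZ (negPf xW).
    case: (boolP (u \in Z)) => //= uZ; rewrite eq_sym in ux.
    by case: (small_set ux Z1 xZ uZ).
  case/eqP: D4; rewrite eB; apply: cW.2 => //; apply/clP; split=> // u v uD vW uv.
  have vxy : v \notin [set x; y].
    by rewrite !inE; apply/norP; split; [apply: contra xW|apply: contra yW] => /eqP <-.
  apply: (hC u v) => //; first by rewrite eB.
  rewrite -(retr_out x vxy); apply: Hp => //; first exact: (subsetP DW).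
  by rewrite in_setU vW.
have xB : x \in B by rewrite !inE xZ eqxx.
have : (x \in D) || (y \in D).
  apply: (@piece_meet Z) => //; apply/clP; split.
    apply/subsetP => u uD; rewrite in_setD in_setU (subsetP DW) // andbT.
    by have := subsetP D3 u uD; rewrite in_setD => /andP[].
  move=> u v uD; rewrite in_setD => /andP[vZ vW] uv.
  have := Hp u v uv (subsetP DW u uD) vW; rewrite /retr; case: ifP => vxy huv.
    by rewrite (hC u x) in D2.
  apply: (hC u v) => //; rewrite in_setD vZ /= in_setU1; apply/orP; right.
  by move: vW; rewrite in_setU vxy orbF.
rewrite (negPf D2) /= => /(subsetP DW); by rewrite (negPf yW).
Qed.
End Closed.
End Piece.
End Connectivity.

(** * Minors of subgraphs and of contractions *)

Section MinorOps.
Variables (V : finType) (H : sgraph).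
Implicit Types (G : graph V).

Lemma minor_sub G G' : (forall u v, G' u v -> G u v) ->
  minor H (sg G') -> minor H (sg G).
Proof.
move=> le [phi [h1 h2 h3]]; exists phi; split=> // [x|x y xy].
  by apply/conn_connected; apply: conn_mono (_ : conn G' _) => [u v _ _|]; [exact: le|apply/conn_connected].
by have [a [b [aa bb ab]]] := h3 x y xy; exists a, b; split=> //; apply: le.
Qed.

(** Branch sets are pulled back along the contraction. The leftover isolated vertices of [D] have
    empty preimages, and the absence of isolated vertices in [H] keeps a branch set from consisting
    of one of them. *)
Lemma minor_ctr G D z : (forall h : H, exists h', adj h h') -> conn G D -> z \in D ->
  minor H (sg (ctr G D z)) -> minor H (sg G).
Proof.
move=> iso cD zD [phi [h1 h2 h3]]; pose rho := retr D z.
have rz d : d \in D -> rho d = z by exact: retr_in.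
have rout d : d \notin D -> rho d = d by exact: retr_out.
exists (fun h => [set u | rho u \in phi h]); split.
- move=> h; apply/conn_connected; set X := [set u | _]; split.
    have [h' hh'] := iso h; have [a [b [aP _ /ctrP[_ [a0 [b0 [e _ _]]]]]]] := h3 h h' hh'.
    by apply/set0Pn; exists a0; rewrite inE /rho e.
  move=> C C0 cC; have [CX k] := clP _ _ _ cC.
  (* As [D] is connected, a closed set contains all of it or none, so it is the preimage of its
     image. *)
  have sat u v : u \in C -> v \in X -> rho u = rho v -> v \in C.
    move=> uC vX e; case: (boolP (u \in D)) => uD.
      case: (boolP (v \in D)) => vD; last by move: (zD); rewrite -(rz u uD) e rout // (negPf vD).
      have DX : D \subset X.
        apply/subsetP => d dD; rewrite inE rz // -(rz u uD).
        by have := subsetP CX u uC; rewrite inE.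
      exact: (subsetP (conn_cl cD DX cC uD uC)).
    case: (boolP (v \in D)) => vD.
      by move: (zD); rewrite -(rz v vD) -e rout // (negPf uD).
    by rewrite -(rout v vD) -e rout.
  have e : rho @: C = phi h.
    have [] := (conn_connected (ctr G D z) (phi h)).2 (h1 h) => _; apply.
      by case/set0Pn: C0 => c cC'; apply/set0Pn; exists (rho c); apply: imset_f.
    apply/clP; split.
      by apply/subsetP => _ /imsetP[c cC' ->]; have := subsetP CX c cC'; rewrite inE.
    move=> _ v' /imsetP[u uC ->] v'P /ctrP[_ [a [b [ea eb ab]]]].
    have aX : a \in X by rewrite inE /rho ea; have := subsetP CX u uC; rewrite inE.
    have aC : a \in C by apply: (sat u) => //; rewrite -/rho in ea.
    rewrite -eb; apply: imset_f; apply: (k a b) => //.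
    by rewrite inE /rho eb.
  apply/eqP; rewrite eqEsubset CX; apply/subsetP => v vX.
  have : rho v \in phi h by have := vX; rewrite inE.
  by rewrite -e => /imsetP[u uC e']; apply: (sat u).
- move=> x y /h2 d; rewrite disjoint_subset; apply/subsetP => u; rewrite !inE.
  by move=> ux; apply/negP => uy; have := disjointFr d ux; rewrite uy.
- move=> x y /h3[a [b [aP bP /ctrP[_ [a0 [b0 [ea eb ab]]]]]]].
  by exists a0, b0; rewrite !inE /rho ea eb.
Qed.
End MinorOps.

Definition minor_closed (V : finType) (K : graph V -> Prop) : Prop :=
  (forall G G' : graph V, (forall u v, G' u v -> G u v) -> K G -> K G') /\
  (forall (G : graph V) D z, conn G D -> z \in D -> K G -> K (ctr G D z)).

(** * The ratio of a graph with two terminals; parallel and series rules *)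

Section Ratio.
Variables (R : realType) (t : R) (V : finType).
Hypotheses (t1 : 1 < t) (t2 : t < 2).
Implicit Types (G : graph V) (A B C D S U W Z : {set V}) (u v x y z : V).

Let t0 : t != 0. Proof. by rewrite gt_eqF // (lt_trans _ t1). Qed.
Let tn1 : t != 1. Proof. by rewrite gt_eqF. Qed.
Let tm1 : t - 1 != 0. Proof. by rewrite subr_eq0. Qed.

(* For a biconnected A and 1 < t this is the expected sign (-1) ^ #|A| of P(G[A], t). *)
Definition pos G A : Prop := 0 < (-1) ^+ #|A| * pr t (ind G A).

(* eratio is normalised so as to be multiplicative under parallel composition; in
   series, (s1, s2) becomes (s1 s2 + t - 1) / (s1 + s2 - (2 - t)), and the whole
   graph vanishes exactly when eratio = - (t - 1). *)
Definition apart G S x y : R := pne t (ind G S) x y.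
Definition merged G S x y : R := peq t (ind G S) x y.
Definition eratio G S x y : R := (t - 1) * merged G S x y / apart G S x y.

Lemma ind_supp G S : supp (ind G S) S.
Proof. by move=> u v; rewrite indE => /andP[]. Qed.

Lemma ind_ext G G' S : {in S &, G =2 G'} -> ind G S =2 ind G' S.
Proof.
move=> e u v; rewrite !indE; case: (boolP (u \in S)) => //= uS.
by case: (boolP (v \in S)) => //= vS; rewrite e.
Qed.

Lemma eq_val G G' S x y : {in S &, G =2 G'} ->
  (apart G S x y = apart G' S x y) * (merged G S x y = merged G' S x y) * (eratio G S x y = eratio G' S x y).
Proof.
move=> /ind_ext e; have a : apart G S x y = apart G' S x y by exact: eq_pne.
have g : merged G S x y = merged G' S x y by exact: eq_peq.
by split; [split|rewrite /eratio a g].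
Qed.

Lemma addC G x y : x != y -> addE G x y =2 addE G y x.
Proof. by move=> xy u v; rewrite !addEE // 1?eq_sym // [X in _ || X]orbC. Qed.

Lemma valC G S x y : x != y -> (apart G S y x = apart G S x y) * (eratio G S y x = eratio G S x y).
Proof.
move=> xy; have a : apart G S y x = apart G S x y by rewrite /apart /pne (eq_pr t (addC (ind G S) xy)).
have g : merged G S y x = merged G S x y by rewrite /merged /peq; congr (_ - _); exact: a.
by split; [|rewrite /eratio a g].
Qed.

Lemma ind_union G S1 S2 :
  (forall u v, u \in S1 -> v \in S2 -> G u v -> (u \in S2) || (v \in S1)) ->
  edge_union (ind G (S1 :|: S2)) (ind G S1) (ind G S2).
Proof.
move=> h u v; rewrite !indE !in_setU; apply/idP/idP; last first.
  by case/orP => /and3P[-> -> ->]; rewrite ?orbT.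
case/and3P => /orP[]uS /orP[]vS uv; rewrite uS vS uv ?orbT //= ?andbT ?orbF.
  by rewrite orbC; exact: h uS vS uv.
by rewrite orbC; move: (h v u vS uS); rewrite grC uv orbC => /(_ isT).
Qed.

Section Par.
Variables (G : graph V) (W1 W2 : {set V}) (x y : V).
Hypotheses (xy : x != y) (dis : [disjoint W1 & W2])
  (noe : forall u v, u \in W1 -> v \in W2 -> ~~ G u v).
Let S1 := W1 :|: [set x; y].
Let S2 := W2 :|: [set x; y].
Let S := W1 :|: W2 :|: [set x; y].

Let parU : edge_union (ind G S) (ind G S1) (ind G S2).
Proof.
have -> : S = S1 :|: S2.
  by rewrite /S1 /S2 [RHS]setUACA setUid.
apply: ind_union => u v; rewrite !(in_setU _ W1, in_setU _ W2); case: (boolP (u \in [set x; y])); rewrite ?orbT //.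
case: (boolP (v \in [set x; y])); rewrite ?orbT // !orbF => _ _ uW vW uv.
by have := noe uW vW; rewrite uv.
Qed.

Let parI : S1 :&: S2 \subset [set x; y].
Proof.
apply/subsetP => u; rewrite in_setI !(in_setU _ W1, in_setU _ W2).
case: (boolP (u \in [set x; y])) => // _; rewrite !orbF => /andP[u1 u2].
by rewrite (disjointFr dis u1) in u2.
Qed.

Lemma apart_par : apart G S x y = t / (t - 1) * (apart G S1 x y * apart G S2 x y).
Proof. exact: (pne_par t0 tn1 xy parU (@ind_supp _ _) (@ind_supp _ _) parI). Qed.

Lemma merged_par : merged G S x y = t * (merged G S1 x y * merged G S2 x y).
Proof. exact: (peq_par t0 xy parU (@ind_supp _ _) (@ind_supp _ _) parI). Qed.

Lemma eratio_par : eratio G S x y = eratio G S1 x y * eratio G S2 x y.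
Proof.
rewrite /eratio apart_par merged_par.
move: (apart G S1 x y) (apart G S2 x y) (merged G S1 x y) (merged G S2 x y) => a1 a2 g1 g2.
(* Division by zero gives 0, so the rule persists when [apart] vanishes on one side: both members
   are then 0. *)
have [->|n1] := eqVneq a1 0; first by rewrite !(mulr0, mul0r, invr0).
have [->|n2] := eqVneq a2 0; first by rewrite !(mulr0, mul0r, invr0).
by field; rewrite n1 n2 tm1 t0.
Qed.
End Par.

Lemma pr_val G S x y : pr t (ind G S) = merged G S x y + apart G S x y.
Proof. by rewrite /merged /peq subrK. Qed.

Lemma val_adj G S x y : x \in S -> y \in S -> G x y ->
  (apart G S x y = pr t (ind G S)) * (merged G S x y = 0).
Proof.
move=> xS yS xy; have nxy := gr_neq xy; suff a : apart G S x y = pr t (ind G S).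
  by split=> //; rewrite /merged /peq [pne _ _ _ _]a subrr.
apply: eq_pr => u v; rewrite addEE // indE.
case: (boolP ((u == x) && (v == y))) => [/andP[/eqP -> /eqP ->]|_]; first by rewrite xS yS xy.
case: (boolP ((u == y) && (v == x))) => [/andP[/eqP -> /eqP ->]|_]; first by rewrite xS yS grC xy.
by rewrite !orbF.
Qed.

Lemma edge_val G x z : G x z ->
  (apart G [set x; z] x z = (t - 1) / t) * (eratio G [set x; z] x z = 0).
Proof.
move=> xz; have xz' := gr_neq xz.
have [xS zS] : x \in [set x; z] /\ z \in [set x; z] by rewrite !inE !eqxx orbT.
have [a g] := val_adj xS zS xz; rewrite /eratio g mulr0 mul0r; split=> //; rewrite a.
pose E : graph V := gr (fun _ _ => false).
have e0 u v : E u v = false by rewrite /= /gr_adj /= andbF.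
have -> : pr t (ind G [set x; z]) = pne t E x z.
  apply: eq_pr => u v; rewrite addEE // indE e0 !inE /=; apply/idP/idP.
    by case/and3P => /orP[]/eqP -> /orP[]/eqP ->; rewrite ?grI // !eqxx ?orbT.
  by case/orP => /andP[/eqP -> /eqP ->]; rewrite !eqxx ?orbT //= grC.
have : pr t E = 1 by apply: pr_edgeless.
have := peq_ctr t0 xz' (_ : ~~ E x z); rewrite e0 => /(_ isT).
rewrite [pr t (ctr _ _ _)]pr_edgeless //; last first.
  by move=> u v; apply/ctrP => -[_ [a' [b' [_ _]]]]; rewrite e0.
rewrite /peq => e1 e2; have -> : pne t E x z = pr t E - 1 / t by rewrite -e1; ring.
by rewrite e2; field.
Qed.

(** The series rule gives [merged] of the whole, and multiplicativity at the cut vertex [z] gives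
    its total value; the difference is [apart], which produces the denominator. *)
Lemma series_val G S1 S2 x y z : x != z -> y != z -> x \in S1 -> y \in S2 ->
  S1 :&: S2 \subset [set z] ->
  (forall u v, u \in S1 -> v \in S2 -> G u v -> (u \in S2) || (v \in S1)) ->
  apart G S1 x z != 0 -> apart G S2 z y != 0 ->
  let s1 := eratio G S1 x z in let s2 := eratio G S2 z y in
  eratio G (S1 :|: S2) x y = (s1 * s2 + (t - 1)) / (s1 + s2 - (2 - t)).
Proof.
move=> xz yz xS yS s12 h a1 a2 s1 s2.
have U := ind_union h.
have gE := peq_series t0 tn1 xz yz xS yS U (@ind_supp _ _) (@ind_supp _ _) s12.
have pE := pr_cut t0 U (@ind_supp _ _) (@ind_supp _ _) s12.
rewrite (pr_val G (S1 :|: S2) x y) (pr_val G S1 x z) (pr_val G S2 z y) in pE.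
rewrite -/(merged _ _ _ _) -/(merged _ _ _ _) -/(merged _ _ _ _) -/(apart _ _ _ _) -/(apart _ _ _ _) in gE.
have g1 : merged G S1 x z = s1 * apart G S1 x z / (t - 1) by rewrite /s1 /eratio; field; apply/andP.
have g2 : merged G S2 z y = s2 * apart G S2 z y / (t - 1) by rewrite /s2 /eratio; field; apply/andP.
move: pE gE; rewrite g1 g2 /eratio.
move: (apart G S1 x z) (apart G S2 z y) (merged G (S1 :|: S2) x y) (apart G (S1 :|: S2) x y) a1 a2.
move=> a1 a2 g a n1 n2 e1 e2.
have {e1} -> : a = a1 * a2 / (t - 1) * (s1 + s2 - (2 - t)).
  have -> : a = (g + a) - g by ring.
  by rewrite e1 e2; field.
rewrite e2; have [->|n] := eqVneq (s1 + s2 - (2 - t)) 0; first by rewrite mulr0 !invr0 !mulr0.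
by field; rewrite n n1 n2 tm1.
Qed.
End Ratio.

Lemma disjoint_setU (T : finType) (A B C : {set T}) :
  [disjoint A :|: B & C] = [disjoint A & C] && [disjoint B & C].
Proof. by rewrite -!setI_eq0 setIUl setU_eq0. Qed.

(** * Two-vertex cuts of a minimal counterexample *)

Section TwoCuts.
Variables (R : realType) (t : R) (V : finType) (K : graph V -> Prop).
Hypotheses (t1 : 1 < t) (t2 : t < 2) (clK : minor_closed K).
Implicit Types (U W C S D B : {set V}) (u v x y z : V).
Variables (G : graph V) (A : {set V}).
Hypotheses (KG : K G) (tcA : biconn G A)
  (IH : forall (A' : {set V}) (G' : graph V), (#|A'| < #|A|)%N -> K G' -> biconn G' A' -> pos t G' A').

Let t0 : 0 < t. Proof. by rewrite (lt_trans _ t1). Qed.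

Lemma cl_noe B W W' : cl G B W -> W' \subset B -> [disjoint W & W'] ->
  forall u v, u \in W -> v \in W' -> ~~ G u v.
Proof.
move=> /clP[_ h] WB d u v uW vW'; apply/negP => uv.
have vW : v \in W by apply: (h u v) => //; apply: (subsetP WB).
by rewrite (disjointFr d vW) in vW'.
Qed.

Lemma cl_trans B W U : cl G B W -> cl G W U -> cl G B U.
Proof.
move=> /clP[WB h] /clP[UW k]; apply/clP; split; first exact: subset_trans WB.
move=> u v uU vB uv; apply: (k u v) => //; apply: (h u v) => //.
exact: (subsetP UW).
Qed.

Lemma clU B W1 W2 : cl G B W1 -> cl G B W2 -> cl G B (W1 :|: W2).
Proof.
move=> /clP[WB h] /clP[UW k]; apply/clP; split; first by rewrite subUset WB.
move=> u v; rewrite !in_setU => /orP[uW|uW] vB uv.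
  by rewrite (h u v).
by rewrite (k u v) // orbT.
Qed.

Definition component x y U : Prop := conn G U /\ cl G (A :\: [set x; y]) U.

Lemma comp_att x y U : x != y -> x \in A -> y \in A -> component x y U -> att G U x /\ att G U y.
Proof. by move=> xy xA yA [[U0 _] cU]; apply: (piece_att tcA xy xA yA cU). Qed.

Section Cut.
Variables (x y : V).
Hypotheses (xy : x != y) (xA : x \in A) (yA : y \in A).
Notation A' := (A :\: [set x; y]).
Notation "W +xy" := (W :|: [set x; y]) (at level 50).

Lemma card_piece W : cl G A' W -> #|W +xy| = #|W|.+2.
Proof.
move=> cW; have [[xW yW] _] := piece_notin cW.
rewrite cardsU cards2 xy (_ : _ :&: _ = set0) ?cards0 ?subn0 ?addn2 //.
apply/setP => u; rewrite !inE; apply/negP => /andP[uW] /orP[]/eqP e.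
  by rewrite -e uW in xW.
by rewrite -e uW in yW.
Qed.

Lemma piece_sub W : cl G A' W -> W +xy \subset A.
Proof.
move=> cW; have [_ WA] := piece_notin cW.
by rewrite subUset WA subUset !sub1set xA.
Qed.

Lemma piece_small W S : cl G A' W -> component x y S -> [disjoint W & S] ->
  (#|W +xy| < #|A|)%N.
Proof.
move=> cW [[/set0Pn[s sS] _] cS] d; apply: proper_card; apply/properP; split; first exact: piece_sub.
have [[xS yS] SA] := piece_notin cS.
exists s; first exact: (subsetP SA).
rewrite !inE (disjointFl d sS) /=; apply/norP; split; [apply: contra xS|apply: contra yS] => /eqP <-; done.
Qed.

Lemma ctr_edge D z a b : retr D z a != retr D z b -> G a b ->
  ctr G D z (retr D z a) (retr D z b).
Proof. by move=> ab Gab; apply/ctrP; split=> //; exists a, b. Qed.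

(** The other component [S], contracted into [y], becomes the edge [xy]. *)
Lemma K_add W S : cl G A' W -> component x y S -> [disjoint W & S] ->
  K (addE (ind G (W +xy)) x y).
Proof.
move=> cW cS d; have [[s1 s1S xs1] [s2 s2S ys2]] := comp_att xy xA yA cS.
have [[xS yS] _] := piece_notin cS.2; have [[xW yW] _] := piece_notin cW.
have cD : conn G ([set y] :|: S) by apply: (connU (conn1 G y) cS.1 _ s2S ys2); rewrite inE.
set D := _ :|: _ in cD; have yD : y \in D by rewrite !inE eqxx.
have xD : x \notin D by rewrite in_setU1 negb_or xy xS.
have rW u : u \in W +xy -> retr D y u = u.
  rewrite !inE => /orP[uW|/orP[/eqP ->|/eqP ->]]; [|exact: retr_out|exact: retr_in].
  by apply: retr_out; rewrite in_setU1 (disjointFr d uW) orbF; apply: contra yW => /eqP <-.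
apply: (clK.1) (clK.2 G D y cD yD KG) => u v; rewrite addEE // indE.
have exy : ctr G D y x y.
  have s1D : s1 \in D by rewrite in_setU s1S orbT.
  by apply/ctrP; split=> //; exists x, s1; rewrite (retr_out y xD) (retr_in y s1D).
case/orP => [/and3P[uW vW uv]|].
  by rewrite -(rW u uW) -(rW v vW); apply: ctr_edge; rewrite // !rW // (gr_neq uv).
by case/orP => /andP[/eqP -> /eqP ->]; rewrite // grC.
Qed.

(** Contracting the other component [S] together with [x] and [y] identifies these two vertices in
    the piece. *)
Lemma K_ctr W S : cl G A' W -> component x y S -> [disjoint W & S] ->
  K (ctr (ind G (W +xy)) [set x; y] x).
Proof.
move=> cW cS d; have [[s1 s1S xs1] [s2 s2S ys2]] := comp_att xy xA yA cS.
have [[xS yS] _] := piece_notin cS.2; have [[xW yW] _] := piece_notin cW.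
have cD : conn G ([set x] :|: ([set y] :|: S)).
  apply: (connU (conn1 G x) _ _ _ xs1); rewrite ?inE ?s1S ?orbT //.
  by apply: (connU (conn1 G y) cS.1 _ s2S ys2); rewrite inE.
set D := _ :|: _ in cD; have xD : x \in D by rewrite !inE eqxx.
have rW u : u \in W +xy -> retr D x u = retr [set x; y] x u.
  rewrite (in_setU u W) /retr /D setUA (in_setU u [set x; y]).
  by case: (boolP (u \in [set x; y])) => //= _; rewrite orbF => uW; rewrite (disjointFr d uW).
apply: (clK.1) (clK.2 G D x cD xD KG) => u v /ctrP[uv [a [b [ea eb]]]].
rewrite indE => /and3P[aW bW ab]; apply/ctrP; split=> //.
by exists a, b; rewrite !rW.
Qed.

(** [apart] is the value of the piece with the edge [xy] added, a smaller 2-connected graph of the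
    class, to which the induction hypothesis applies. *)
Lemma apart_pos W S : cl G A' W -> component x y S -> [disjoint W & S] ->
  0 < (-1) ^+ #|W| * apart t G (W +xy) x y.
Proof.
move=> cW cS d.
have := IH (piece_small cW cS d) (K_add cW cS d) _.
have T : biconn (addE (ind G (W +xy)) x y) (W +xy).
  apply: biconn_mono (biconn_add tcA xy xA yA cW) => u v uW vW.
  by rewrite !addEE // indE uW vW.
move=> /(_ T); rewrite /pos card_piece // -addn2 exprD sqrrN expr1n mulr1.
rewrite /apart /pne (eq_pr t (G' := addE (ind G (W +xy)) x y)) // => u v.
rewrite !indE !addEE // !indE.
case: (boolP (u \in W +xy)) => //= uW; last first.
  have -> : (u == x) = false by apply: contraNF uW => /eqP ->; rewrite !inE eqxx orbT.
  by have -> : (u == y) = false by apply: contraNF uW => /eqP ->; rewrite !inE eqxx !orbT.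
case: (boolP (v \in W +xy)) => //= vW.
have -> : (v == x) = false by apply: contraNF vW => /eqP ->; rewrite !inE eqxx orbT.
have -> : (v == y) = false by apply: contraNF vW => /eqP ->; rewrite !inE eqxx !orbT.
by rewrite !andbF.
Qed.

(** Up to the factor [t], [merged] is the value of the piece with [x] and [y] identified. This is a
    smaller 2-connected graph of the class with [#|W| + 1] vertices, and the odd shift reverses the
    sign. *)
Lemma merged_neg W S : ~~ G x y -> component x y W -> component x y S -> [disjoint W & S] ->
  (-1) ^+ #|W| * merged t G (W +xy) x y < 0.
Proof.
move=> nxy [kW cW] cS d; have [[xW yW] _] := piece_notin cW.
have sm : (#|x |: W| < #|A|)%N.
  by apply: ltn_trans (piece_small cW cS d); rewrite card_piece // cardsU1 xW.
have := IH sm (K_ctr cW cS d) (biconn_ctr tcA xy xA yA cW kW).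
rewrite /pos /merged peq_ctr ?gt_eqF //; last by rewrite indE (negPf nxy) !andbF.
rewrite cardsU1 xW exprD expr1 mulN1r.
rewrite (eq_pr t (G' := ctr (ind G (W +xy)) [set x; y] x)); last first.
  move=> u v; rewrite indE; case: (boolP (ctr _ _ _ _ _)); rewrite ?andbF //.
  move=> /ctrP[uv [a [b [<- <-]]]]; rewrite indE => /and3P[aW bW _].
  have r c : c \in W +xy -> retr [set x; y] x c \in x |: W.
    rewrite (in_setU c W) /retr; case: (c \in [set x; y]); first by rewrite !inE eqxx.
    by rewrite orbF => cW'; rewrite in_setU1 cW' orbT.
  by rewrite !r.
by rewrite mulNr oppr_gt0 => h; rewrite mulrA pmulr_llt0 ?invr_gt0.
Qed.

Lemma eratio_neg W S : ~~ G x y -> component x y W -> component x y S -> [disjoint W & S] ->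
  eratio t G (W +xy) x y < 0.
Proof.
move=> nxy cW cS d; move: (merged_neg nxy cW cS d) (apart_pos cW.2 cS d).
rewrite /eratio; move: (merged _ _ _ _ _) (apart _ _ _ _ _) => g a hg ha.
rewrite -mulrA pmulr_rlt0 ?subr_gt0 //; move: hg ha.
have [-> | ->] : (-1) ^+ #|W| = 1 :> R \/ (-1) ^+ #|W| = -1 :> R.
  by rewrite -signr_odd; case: odd; [right|left].
- by rewrite !mul1r => hg ha; rewrite pmulr_llt0 ?invr_gt0.
- by rewrite !mulN1r oppr_gt0 oppr_lt0 => hg ha; rewrite nmulr_llt0 ?invr_lt0.
Qed.

(** The total value is [merged + apart]; divided by [apart], whose sign is the expected one, it
    becomes [1 + eratio / (t - 1)]. *)
Lemma pos_eratio B W : #|B| = #|W|.+2 -> 0 < (-1) ^+ #|W| * apart t G B x y ->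
  pos t G B <-> - (t - 1) < eratio t G B x y.
Proof.
move=> cB a; rewrite /pos cB -addn2 exprD sqrrN expr1n mulr1 (pr_val _ _ _ x y).
have -> : (-1) ^+ #|W| * (merged t G B x y + apart t G B x y) =
   (-1) ^+ #|W| * apart t G B x y * (eratio t G B x y + (t - 1)) / (t - 1).
  have an : apart t G B x y != 0 by apply: contraTneq a => ->; rewrite mulr0 ltxx.
  have tn : t - 1 != 0 by rewrite subr_eq0 gt_eqF.
  rewrite /eratio; move: (apart _ _ _ _ _) (merged _ _ _ _ _) an => b g bn; field.
  by rewrite bn tn.
by rewrite pmulr_lgt0 ?invr_gt0 ?subr_gt0 // pmulr_rgt0 // -ltrBlDr sub0r; split.
Qed.

(** Two components make the piece 2-connected without the edge [xy], and a component outside [W]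
    makes it smaller than [A]; so the induction hypothesis applies to the piece itself. *)
Lemma eratio_two W U1 U2 : cl G A' W -> W != A' -> component x y U1 -> component x y U2 ->
  U1 \subset W -> U2 \subset W -> [disjoint U1 & U2] ->
  - (t - 1) < eratio t G (W +xy) x y.
Proof.
move=> cW nW c1 c2 s1 s2 d.
have [WA _] := clP _ _ _ cW.
have D0 : A' :\: W != set0 by apply: contra nW; rewrite setD_eq0 eqEsubset WA.
have [S [cS clS]] := comp_exists G D0.
have cS' : component x y S by split=> //; apply: cl_trans (cl_compl cW) clS.
have dS : [disjoint W & S].
  rewrite disjoint_sym disjoint_subset; apply: subset_trans (clP _ _ _ clS).1 _.
  by apply/subsetP => u; rewrite !inE => /andP[].
apply/(pos_eratio (card_piece cW) (apart_pos cW cS' dS)).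
apply: IH => //; first exact: piece_small cS' dS.
have [a1 b1] := comp_att xy xA yA c1; have [a2 b2] := comp_att xy xA yA c2.
exact: (biconn_union tcA xy xA yA cW s1 s2 d c1.1 c2.1).
Qed.

Lemma apart_total W1 W2 : cl G A' W1 -> cl G A' W2 -> [disjoint W1 & W2] ->
  W1 != set0 -> W2 != set0 ->
  0 < (-1) ^+ #|W1 :|: W2| * apart t G ((W1 :|: W2) +xy) x y.
Proof.
move=> c1 c2 d n1 n2.
have [S1 [k1 l1]] := comp_exists G n1; have [S2 [k2 l2]] := comp_exists G n2.
have C1 : component x y S1 by split=> //; exact: cl_trans l1.
have C2 : component x y S2 by split=> //; exact: cl_trans l2.
have d1 : [disjoint W1 & S2] by rewrite disjoint_sym; apply: disjointWl (clP _ _ _ l2).1 _; rewrite disjoint_sym.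
have d2 : [disjoint W2 & S1] by rewrite disjoint_sym; apply: disjointWl (clP _ _ _ l1).1 _.
have a1 := apart_pos c1 C2 d1; have a2 := apart_pos c2 C1 d2.
rewrite (apart_par t1 xy d (cl_noe c1 (clP _ _ _ c2).1 d)) cardsU.
rewrite (disjoint_setI0 d) cards0 subn0 exprD mulrCA pmulr_rgt0 ?divr_gt0 ?subr_gt0 //.
by rewrite mulrACA; exact: (mulr_gt0 a1 a2).
Qed.

(** For an edge [xy] the whole value equals [apart], and the parallel rule writes that as a product
    over the two sides of the cut, each factor having its expected sign. *)
Lemma adj_cut_pos C : C != set0 -> C != A' -> cl G A' C -> G x y -> pos t G A.
Proof.
move=> C0 nC cC Gxy.
have [CA _] := clP _ _ _ cC.
have D0 : A' :\: C != set0 by apply: contra nC; rewrite setD_eq0 eqEsubset CA.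
have d : [disjoint C & A' :\: C].
  by rewrite disjoint_sym disjoint_subset; apply/subsetP => u; rewrite !inE => /andP[].
have := apart_total cC (cl_compl cC) d C0 D0.
have e : C :|: A' :\: C = A' by rewrite -[RHS](setID _ C) setIC (setIidPl CA).
have eA : A' +xy = A.
  apply/setP => u; rewrite !inE; case: (u =P x) => [->|_]; rewrite ?xA ?orbT //.
  by case: (u =P y) => [->|_]; rewrite ?yA ?orbT ?orbF.
rewrite e eA (val_adj t xA yA Gxy) /pos.
have -> : #|A| = #|A'|.+2 by rewrite -{1}eA card_piece //; apply/clP.
by rewrite -addn2 exprD sqrrN expr1n mulr1.
Qed.

Lemma cut_pos W1 W2 : W1 != set0 -> W2 != set0 -> cl G A' W1 -> cl G A' W2 ->
  [disjoint W1 & W2] -> W1 :|: W2 = A' ->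
  pos t G A <-> - (t - 1) < eratio t G (W1 +xy) x y * eratio t G (W2 +xy) x y.
Proof.
move=> n1 n2 c1 c2 d e; have := apart_total c1 c2 d n1 n2.
rewrite -(eratio_par t1 xy d (cl_noe c1 (clP _ _ _ c2).1 d)) e.
have eA : A' +xy = A.
  apply/setP => u; rewrite !inE; case: (u =P x) => [->|_]; rewrite ?xA ?orbT //.
  by case: (u =P y) => [->|_]; rewrite ?yA ?orbT ?orbF.
rewrite eA => h; apply: pos_eratio h; rewrite -{1}eA card_piece //; exact/clP.
Qed.

Definition cut3 U1 U2 U3 : Prop :=
  [/\ [/\ x != y, x \in A, y \in A & ~~ G x y],
      [/\ component x y U1, component x y U2 & component x y U3],
      [/\ [disjoint U1 & U2], [disjoint U1 & U3] & [disjoint U2 & U3]] &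
      U1 :|: U2 :|: U3 = A'].

Lemma disjoint_setD B U W : U \subset B :\: W -> [disjoint W & U].
Proof.
move=> h; rewrite disjoint_sym disjoint_subset; apply: subset_trans h _.
by apply/subsetP => u; rewrite !inE => /andP[].
Qed.

Lemma rest_nonempty C W : cl G C W -> W != C -> C :\: W != set0.
Proof.
by move=> /clP[WC _] nW; apply: contra nW; rewrite setD_eq0 eqEsubset WC.
Qed.

Lemma comps4 U1 U2 U3 U4 : component x y U1 -> component x y U2 -> component x y U3 -> component x y U4 ->
  [/\ [disjoint U1 & U2], [disjoint U1 & U3] & [disjoint U2 & U3]] ->
  [/\ [disjoint U1 & U4], [disjoint U2 & U4] & [disjoint U3 & U4]] -> ~~ G x y -> pos t G A.
Proof.
move=> c1 c2 c3 c4 [d12 d13 d23] [d14 d24 d34] nxy; apply: contrapT => np.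
pose s U := eratio t G (U +xy) x y.
(* The components [Uk] and [Ul] put the ratio [c] of the rest above [- (t - 1)], while the total
   [a * b * c] is at most [- (t - 1)] in a counterexample. Since [a * b] is positive, [c] is
   negative and [a * b] exceeds 1. *)
have pair Ui Uj Uk Ul : component x y Ui -> component x y Uj -> component x y Uk -> component x y Ul ->
    [/\ [disjoint Ui & Uj], [disjoint Ui & Uk] & [disjoint Uj & Uk]] ->
    [/\ [disjoint Ui & Ul], [disjoint Uj & Ul] & [disjoint Uk & Ul]] ->
    1 < s Ui * s Uj.
  move=> ci cj ck ck' [dij dik djk] [dil djl dkl].
  have si := eratio_neg nxy ci cj dij; have sj := eratio_neg nxy cj ck djk.
  have cW := clU ci.2 cj.2; set W := Ui :|: Uj in cW.
  have sub Um : component x y Um -> [disjoint Ui & Um] -> [disjoint Uj & Um] -> Um \subset A' :\: W.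
    move=> cm dim djm; rewrite subsetD (clP _ _ _ cm.2).1 /=.
    by rewrite disjoint_sym disjoint_setU dim djm.
  have sk := sub Uk ck dik djk; have sl := sub Ul ck' dil djl.
  have nY : A' :\: W != A'.
    apply/eqP => e; case: ci => -[/set0Pn[u ui] _] /clP[uA _].
    by have := subsetP uA u ui; rewrite -e !inE ui.
  have sY := eratio_two (cl_compl cW) nY ck ck' sk sl dkl.
  have W0 : W != set0 by case: ci => -[/set0Pn[u ui] _] _; apply/set0Pn; exists u; rewrite inE ui.
  have Y0 : A' :\: W != set0.
    by case: ck => -[/set0Pn[u uk] _] _; apply/set0Pn; exists u; apply: (subsetP sk).
  have dWY := disjoint_setD (subxx (A' :\: W)).
  have eWY : W :|: A' :\: W = A'.
    by have /clP[WA _] := cW; rewrite -[RHS](setID _ W) setIC (setIidPl WA).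
  have := (cut_pos W0 Y0 cW (cl_compl cW) dWY eWY); rewrite (eratio_par t1 xy dij (cl_noe ci.2 (clP _ _ _ cj.2).1 dij)).
  rewrite -/(s Ui) -/(s Uj) -/(s (A' :\: W)) => h.
  have {}h : s Ui * s Uj * s (A' :\: W) <= - (t - 1).
    by rewrite leNgt; apply/negP => /h.
  move: si sj sY h; rewrite -/(s Ui) -/(s Uj) -/(s (A' :\: W)).
  move: (s Ui) (s Uj) (s (A' :\: W)) => a b c ha hb hc h.
  have ab : 0 < a * b by rewrite nmulr_rgt0.
  rewrite ltNge; apply/negP => ab1.
  have : c < 0 by rewrite -(pmulr_rlt0 _ ab) (le_lt_trans h) // oppr_lt0 subr_gt0.
  move: t1; nra.
have p12 := pair _ _ _ _ c1 c2 c3 c4 (And3 d12 d13 d23) (And3 d14 d24 d34).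
have p13 : 1 < s U1 * s U3.
  by apply: (pair U1 U3 U2 U4) => //; split=> //; rewrite disjoint_sym.
have p23 : 1 < s U2 * s U3.
  by apply: (pair U2 U3 U1 U4) => //; split=> //; rewrite disjoint_sym.
have cW := clU c1.2 c2.2.
have cT := clU cW c3.2; set T := _ :|: U3 in cT.
have dW3 : [disjoint U1 :|: U2 & U3] by rewrite disjoint_setU d13 d23.
have nT : T != A'.
  apply/eqP => e; case: c4 => -[/set0Pn[u u4] _] /clP[uA _].
  have := subsetP uA u u4; rewrite -e !inE.
  by rewrite (disjointFl d14 u4) (disjointFl d24 u4) (disjointFl d34 u4).
have s12 : U1 \subset T by rewrite /T -setUA subsetUl.
have s22 : U2 \subset T by rewrite /T (setUC U1) -setUA subsetUl.
have := eratio_two cT nT c1 c2 s12 s22 d12.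
rewrite (eratio_par t1 xy dW3 (cl_noe cW (clP _ _ _ c3.2).1 dW3)).
rewrite (eratio_par t1 xy d12 (cl_noe c1.2 (clP _ _ _ c2.2).1 d12)).
have := eratio_neg nxy c1 c2 d12; have := eratio_neg nxy c2 c3 d23; have := eratio_neg nxy c3 c4 d34.
rewrite -/(s U1) -/(s U2) -/(s U3); move: p12 p13 p23.
move: (s U1) (s U2) (s U3) => a b c ab ac bc c0 b0 a0 h.
have h1 : a * b * c < 0 by rewrite -mulrA; nra.
(* The square is the product of the three pairs, so the negative number [a * b * c] lies below [-1],
   against the lower bound [- (t - 1)] for three components. *)
have h2 : 1 < (a * b * c) * (a * b * c).
  have -> : a * b * c * (a * b * c) = (a * b) * ((a * c) * (b * c)) by ring.
  have : 1 < (a * c) * (b * c) by nra.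
  nra.
move: t1 t2; nra.
Qed.

(* With two components the product of the two negative ratios is positive, so G is
   no counterexample; with four, the induction hypothesis makes the product of any
   two ratios exceed 1 and the product of three exceed - (t - 1). *)
Lemma cut3_exists C : ~ pos t G A -> C != set0 -> C != A' -> cl G A' C ->
  exists U1 U2 U3, cut3 U1 U2 U3.
Proof.
move=> np C0 nC cC.
have nxy : ~~ G x y by apply/negP => /(adj_cut_pos C0 nC cC).
have A0 : A' != set0.
  by case/set0Pn: C0 => u /(subsetP (clP _ _ _ cC).1) uA; apply/set0Pn; exists u.
have [U1 [k1 l1]] := comp_exists G A0; have c1 : component x y U1 by [].
have n1 : U1 != A' by apply: contraNneq nC => e; move: k1; rewrite e => -[_ /(_ C C0 cC)->].
have [U2 [k2 l2]] := comp_exists G (rest_nonempty l1 n1).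
have c2 : component x y U2 by split=> //; apply: cl_trans (cl_compl l1) l2.
have d12 := disjoint_setD (clP _ _ _ l2).1.
have e12 : U1 :|: A' :\: U1 = A'.
  by have /clP[WA _] := l1; rewrite -[RHS](setID _ U1) setIC (setIidPl WA).
have [e2|n2] := eqVneq U2 (A' :\: U1).
  case: np; apply/(cut_pos k1.1 k2.1 l1 c2.2 d12); first by rewrite e2.
  have := eratio_neg nxy c1 c2 d12; have := eratio_neg nxy c2 c1; rewrite disjoint_sym => /(_ d12).
  move: (eratio _ _ _ _ _) (eratio _ _ _ _ _) => a b ha hb.
  by apply: lt_trans (_ : 0 < _); rewrite ?oppr_lt0 ?subr_gt0 // nmulr_rgt0.
have [U3 [k3 l3]] := comp_exists G (rest_nonempty l2 n2).
have l23 : cl G (A' :\: U1) U3 by apply: cl_trans (cl_compl l2) l3.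
have c3 : component x y U3 by split=> //; apply: cl_trans (cl_compl l1) l23.
have d13 := disjoint_setD (clP _ _ _ l23).1; have d23 := disjoint_setD (clP _ _ _ l3).1.
have [e3|n3] := eqVneq U3 (A' :\: U1 :\: U2).
  exists U1, U2, U3; split=> //; rewrite e3 -[RHS]e12 -setUA; congr (_ :|: _).
  have /clP[WA _] := l2; rewrite -[RHS](setID _ U2) [in RHS]setIC.
  by rewrite (setIidPl WA).
have [U4 [k4 l4]] := comp_exists G (rest_nonempty l3 n3).
have l24 : cl G (A' :\: U1 :\: U2) U4 by apply: cl_trans (cl_compl l3) l4.
have l14 : cl G (A' :\: U1) U4 by apply: cl_trans (cl_compl l2) l24.
have c4 : component x y U4 by split=> //; apply: cl_trans (cl_compl l1) l14.
case: np; apply: (comps4 c1 c2 c3 c4) => //; split=> //.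
- exact: disjoint_setD (clP _ _ _ l14).1.
- exact: disjoint_setD (clP _ _ _ l24).1.
- exact: disjoint_setD (clP _ _ _ l4).1.
Qed.
End Cut.

Lemma cut3_C x y U1 U2 U3 : cut3 x y U1 U2 U3 -> cut3 y x U1 U2 U3.
Proof.
rewrite /cut3 /component (setUC [set y]) => -[[xy xA yA nxy] c d e]; split=> //.
by split=> //; rewrite 1?eq_sym // grC.
Qed.
End TwoCuts.

Notation "W +: x & y" := (W :|: [set x; y])
  (at level 53, x at level 50, y at level 50, format "W  +:  x  &  y").

(** * The three ratios at a cut of a counterexample *)

Section ThreeComponents.
Variables (R : realType) (t : R) (V : finType) (K : graph V -> Prop).
Hypotheses (t1 : 1 < t) (t2 : t < 2) (clK : minor_closed K).
Implicit Types (U W C S D B : {set V}) (u v x y z : V).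
Variables (G : graph V) (A : {set V}).
Hypotheses (KG : K G) (tcA : biconn G A)
  (IH : forall (A' : {set V}) (G' : graph V), (#|A'| < #|A|)%N -> K G' -> biconn G' A' -> pos t G' A').
Hypothesis np : ~ pos t G A.

Notation cut3 := (cut3 G A).
Notation component := (component G A).

Lemma cut3_swap x y U1 U2 U3 : cut3 x y U1 U2 U3 -> cut3 x y U2 U1 U3.
Proof.
move=> [e [c1 c2 c3] [d12 d13 d23] u]; split=> //; last by rewrite (setUC U2).
by split=> //; rewrite disjoint_sym.
Qed.

Lemma cut3_rot x y U1 U2 U3 : cut3 x y U1 U2 U3 -> cut3 x y U2 U3 U1.
Proof.
move=> [e [c1 c2 c3] [d12 d13 d23] u]; split=> //; last by rewrite setUC setUA.
by split=> //; rewrite disjoint_sym.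
Qed.

Section Val.
Variables (x y : V) (U1 U2 U3 : {set V}).
Hypothesis c : cut3 x y U1 U2 U3.

Lemma cut3_neg : eratio t G (U1 +: x & y) x y < 0.
Proof.
by have [[xy xA yA nxy] [c1 c2 c3] [d12 d13 d23] _] := c; apply: (eratio_neg t1 clK KG tcA IH xy xA yA nxy c1 c2).
Qed.

Lemma cut3_prod :
  eratio t G (U1 +: x & y) x y * eratio t G (U2 +: x & y) x y * eratio t G (U3 +: x & y) x y
  <= - (t - 1).
Proof.
have [[xy xA yA nxy] [c1 c2 c3] [d12 d13 d23] e] := c.
have dW3 : [disjoint U1 :|: U2 & U3] by rewrite disjoint_setU d13.
have cW := clU c1.2 c2.2.
have W0 : U1 :|: U2 != set0.
  by case/set0Pn: (c1.1.1) => u u1; apply/set0Pn; exists u; rewrite inE u1.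
have := cut_pos t1 clK KG tcA IH xy xA yA W0 c3.1.1 cW c3.2 dW3 e.
rewrite (eratio_par t1 xy d12 (cl_noe c1.2 (clP _ _ _ c2.2).1 d12)) => h.
by rewrite leNgt; apply/negP => /h.
Qed.

Lemma cut3_apart : apart t G (U1 :|: U2 +: x & y) x y != 0.
Proof.
have [[xy xA yA nxy] [c1 c2 c3] [d12 d13 d23] e] := c.
have dW3 : [disjoint U1 :|: U2 & U3] by rewrite disjoint_setU d13.
have := apart_pos clK KG tcA IH xy xA yA (clU c1.2 c2.2) c3 dW3.
by apply: contraTneq => ->; rewrite mulr0 ltxx.
Qed.

Lemma cut3_par : eratio t G (U1 :|: U2 +: x & y) x y =
  eratio t G (U1 +: x & y) x y * eratio t G (U2 +: x & y) x y.
Proof.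
have [[xy xA yA nxy] [c1 c2 c3] [d12 d13 d23] e] := c.
exact: (eratio_par t1 xy d12 (cl_noe c1.2 (clP _ _ _ c2.2).1 d12)).
Qed.
End Val.

End ThreeComponents.

(** Two edges in series, each of ratio 0. *)
Lemma single_val (R : realType) (t : R) (V : finType) (G : graph V) (x y z : V) :
  1 < t -> x != y -> ~~ G x y -> G x z -> G z y ->
  eratio t G ([set z] +: x & y) x y = - ((t - 1) / (2 - t)).
Proof.
move=> t1 xy nxy xz zy; have xz' := gr_neq xz; have zy' := gr_neq zy.
have t0 : 0 < t by rewrite (lt_trans _ t1).
have -> : [set z] +: x & y = [set x; z] :|: [set z; y].
  by apply/setP => u; rewrite !inE; case: (u == x); case: (u == y); case: (u == z).
have [a1 s1] := edge_val t1 xz; have [a2 s2] := edge_val t1 zy.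
have an : (t - 1) / t != 0 by rewrite mulf_neq0 ?invr_neq0 ?gt_eqF ?subr_gt0.
rewrite (series_val t1 (z := z)) ?a1 ?a2 ?s1 ?s2 //.
- by rewrite mul0r !add0r invrN mulrN.
- by rewrite eq_sym.
- by rewrite !inE eqxx.
- by rewrite !inE eqxx orbT.
- apply/subsetP => u; rewrite !inE => /andP[/orP[]/eqP -> //] /orP[]/eqP e.
  + by rewrite e eqxx in xz'.
  + by rewrite e eqxx in xy.
- move=> u v; rewrite !inE => /orP[]/eqP -> /orP[]/eqP ->; rewrite ?eqxx ?orbT //.
  by rewrite (negPf nxy).
Qed.

(** * No component is 2-connected together with the cut *)

Section NoTwoConnectedComponent.
Variables (R : realType) (t : R) (V : finType) (K : graph V -> Prop).
Hypotheses (t1 : 1 < t) (t2 : t < 2) (clK : minor_closed K).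
Implicit Types (U W C S D B : {set V}) (u v x y z : V).
Variables (G : graph V) (A : {set V}).
Hypotheses (KG : K G) (tcA : biconn G A)
  (IH : forall (A' : {set V}) (G' : graph V), (#|A'| < #|A|)%N -> K G' -> biconn G' A' -> pos t G' A').
Hypothesis np : ~ pos t G A.

Notation cut3 := (cut3 G A).
Notation component := (component G A).
Section Bridge.
Variables (x y : V) (U1 U2 U3 : {set V}).
Hypothesis c : cut3 x y U1 U2 U3.

(* Compare with the graph in which U1 is contracted to one vertex of ratio
   - (t - 1) / (2 - t): it has fewer vertices, hence the product of the other two
   ratios is below 2 - t. *)
Lemma no_bridge : ~ biconn G (U1 +: x & y).
Proof.
move=> T; have [[xy xA yA nxy] [c1 c2 c3] [d12 d13 d23] e] := c.
have [[x1 y1] U1A] := piece_notin c1.2; have [[x2 y2] U2A] := piece_notin c2.2.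
have [[x3 y3] U3A] := piece_notin c3.2.
have s1 : - (t - 1) < eratio t G (U1 +: x & y) x y.
  apply/(pos_eratio t1 (card_piece xy c1.2) (apart_pos clK KG tcA IH xy xA yA c1.2 c2 d12)).
  by apply: IH => //; apply: (piece_small xA yA c1.2 c2 d12).
have s1n := cut3_neg t1 clK KG tcA IH c.
have s2n := cut3_neg t1 clK KG tcA IH (cut3_rot c).
have s3n := cut3_neg t1 clK KG tcA IH (cut3_rot (cut3_rot c)).
have pr3 := cut3_prod t1 clK KG tcA IH np c.
suff s23 : eratio t G (U2 +: x & y) x y * eratio t G (U3 +: x & y) x y < 2 - t.
  move: s1 s1n s2n s3n pr3 s23.
  move: (eratio _ _ _ _ _) (eratio _ _ _ _ _) (eratio _ _ _ _ _) => a b d h1 ha hb hd h h23.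
  have bd : 0 < b * d by rewrite nmulr_rgt0.
  move: t1 t2 h; rewrite -mulrA; move: (b * d) bd h23 => q q0 q1; nra.
(* A single vertex [U1] would be a cut vertex between the nonadjacent [x] and [y]. Hence contracting
   [U1] really loses a vertex. *)
have card1 : (1 < #|U1|)%N.
  rewrite ltnNge; apply/negP => U1c; have [_ /(_ U1 U1c)] := T.
  have -> : (U1 +: x & y) :\: U1 = [set x; y].
    apply/setP => u; rewrite !inE; case: (u =P x) => [->|_]; first by rewrite x1 orbT.
    by case: (u =P y) => [->|_]; rewrite ?y1 ?orbT //= ?orbF andNb.
  have clx : cl G [set x; y] [set x].
    apply/clP; split; first by rewrite sub1set !inE eqxx.
    by move=> u v; rewrite !inE => /eqP -> /orP[]// /eqP ->; rewrite (negPf nxy).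
  have x0 : [set x] != set0 by apply/set0Pn; exists x; rewrite inE.
  by move=> [_ /(_ _ x0 clx)/setP/(_ y)]; rewrite !inE eqxx orbT eq_sym (negPf xy).
have [z zU] : exists z, z \in U1 by apply/set0Pn; exact: c1.1.1.
have [w /andP[wU wz]] : exists w, (w \in U1) && (w != z).
  have : U1 :\ z != set0 by move: card1; rewrite -card_gt0 (cardsD1 z U1) zU /= add1n ltnS.
  by case/set0Pn => w; rewrite !inE => /andP[wz wU]; exists w; rewrite wU.
pose G' := ctr G U1 z; have KG' : K G' by apply: clK.2 c1.1 zU KG.
pose W := U2 :|: U3.
have zx : z != x by apply: contraNneq x1 => <-.
have zy : z != y by apply: contraNneq y1 => <-.
have d1W : [disjoint U1 & W] by rewrite disjoint_sym disjoint_setU !(disjoint_sym _ (mem U1)) d12.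
have zW : z \notin W by rewrite (disjointFr d1W zU).
have outW u : u \in W +: x & y -> u \notin U1.
  rewrite in_setU => /orP[uW|]; first by rewrite (disjointFl d1W uW).
  by rewrite !inE => /orP[]/eqP ->.
have GG' u v : u \notin U1 -> v \notin U1 -> G' u v = G u v.
  move=> u1 v1; apply/ctrP/idP => [[uv [a [b [ea eb ab]]]]|uv].
    have ha p q : retr U1 z p = q -> q \notin U1 -> p = q.
      by rewrite /retr; case: ifP => // _ <-; rewrite zU.
    by rewrite -(ha _ _ ea u1) -(ha _ _ eb v1).
  by split; [exact: gr_neq uv|exists u, v; rewrite !retr_out].
have [[a1 a1U xa1] [b1 b1U yb1]] := comp_att tcA xy xA yA c1.
have Gx : G' x z by apply/ctrP; split; [rewrite eq_sym|exists x, a1; rewrite retr_out // retr_in].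
have Gy : G' y z by apply/ctrP; split; [rewrite eq_sym|exists y, b1; rewrite retr_out // retr_in].
pose B := z |: (W +: x & y).
have xB0 : x \in W +: x & y by rewrite !inE eqxx orbT.
have yB0 : y \in W +: x & y by rewrite !inE eqxx !orbT.
have [xB yB] : x \in B /\ y \in B by rewrite !(in_setU1 _ z) xB0 yB0 !orbT.
have cW := clU c2.2 c3.2.
have tcB : biconn G' B.
  have [a2x a2y] := comp_att tcA xy xA yA c2; have [a3x a3y] := comp_att tcA xy xA yA c3.
  apply: (biconn_ear (x := x) (y := y)) => //; rewrite ?(grC _ z) //.
    apply: biconn_mono (biconn_union tcA xy xA yA cW (subsetUl _ _) (subsetUr _ _) d23 c2.1 c3.1 a2x a2y a3x a3y).
    by move=> u v uW vW; rewrite GG' // outW.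
  by rewrite (in_setU z W) negb_or zW /= !inE negb_or zx zy.
have BA : (#|B| < #|A|)%N.
  apply: proper_card; apply/properP; split.
    rewrite subUset sub1set (subsetP U1A) //=; exact: (piece_sub xA yA cW).
  exists w; first exact: (subsetP U1A).
  rewrite in_setU1 negb_or wz /=; apply/negP => /outW; by rewrite wU.
have IHB (A' : {set V}) (H : graph V) : (#|A'| < #|B|)%N -> K H -> biconn H A' -> pos t H A'.
  by move=> h; apply: IH; apply: ltn_trans BA.
have eB : B :\: [set x; y] = [set z] :|: W.
  apply/setP => u; rewrite !inE; case: (u =P x) => [->|_] /=.
    by rewrite eq_sym (negPf zx) (negPf x2) (negPf x3).
  case: (u =P y) => [->|_] /=; first by rewrite eq_sym (negPf zy) (negPf y2) (negPf y3).
  by rewrite !orbF.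
have dz : [disjoint [set z] & W] by rewrite disjoints1.
have noz u : u \in W -> ~~ G' z u.
  move=> uW; apply/negP => /ctrP[zu [a [b [ea eb ab]]]].
  have bu : b = u.
    by move: eb; rewrite /retr; case: ifP => // _ e'; move: zW; rewrite e' uW.
  have aU : a \in U1 by apply: contraT => aU; move: (zU); rewrite -ea retr_out // (negPf aU).
  by have := cl_noe c1.2 (clP _ _ _ cW).1 d1W aU uW; rewrite -bu ab.
have clz : cl G' (B :\: [set x; y]) [set z].
  apply/clP; rewrite eB; split; first exact: subsetUl.
  move=> u v; rewrite !inE => /eqP -> /orP[//|vW] zv.
  by have := noz v; rewrite inE vW zv => /(_ isT).
have clW' : cl G' (B :\: [set x; y]) W.
  have := cl_compl clz; rewrite eB; congr (cl _ _ _).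
  apply/setP => u; rewrite !inE; case: (u =P z) => [->|_] //=.
  by move: zW; rewrite inE => /negPf ->.
have W0 : W != set0 by case/set0Pn: (c2.1.1) => u u2; apply/set0Pn; exists u; rewrite inE u2.
have z0 : [set z] != set0 by apply/set0Pn; exists z; rewrite inE.
have /(cut_pos t1 clK KG' tcB IHB xy xB yB z0 W0 clz clW' dz (esym eB)) := IH BA KG' tcB.
have Gzy : G' z y by rewrite grC.
have nxy' : ~~ G' x y by rewrite GG'.
rewrite (single_val t1 xy nxy' Gx Gzy).
rewrite (eq_val t x y (G' := G) (S := W +: x & y)); last first.
  by move=> u v uW vW; rewrite GG' // outW.
rewrite (eratio_par t1 xy d23 (cl_noe c2.2 (clP _ _ _ c3.2).1 d23)).
rewrite mulNr ltrN2 mulrAC ltr_pdivrMr ?subr_gt0 //.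
by rewrite ltr_pM2l ?subr_gt0.
Qed.
End Bridge.
End NoTwoConnectedComponent.

(** * Splitting the components recursively and bounding their ratios *)

Section ComponentBounds.
Variables (R : realType) (t : R) (V : finType) (K : graph V -> Prop).
Hypotheses (t1 : 1 < t) (t2 : t < 2) (clK : minor_closed K).
Implicit Types (U W C S D B : {set V}) (u v x y z : V).
Variables (G : graph V) (A : {set V}).
Hypotheses (KG : K G) (tcA : biconn G A)
  (IH : forall (A' : {set V}) (G' : graph V), (#|A'| < #|A|)%N -> K G' -> biconn G' A' -> pos t G' A').
Hypothesis np : ~ pos t G A.

Notation cut3 := (cut3 G A).
Notation component := (component G A).

(* By no_bridge every component U of a cut {x, y} has a cut vertex z separating a
   side D1 at x from a side D2 at y. *)
Definition split_at x y U z D1 D2 : Prop :=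
  [/\ z \in U, U = z |: (D1 :|: D2),
      [/\ z \notin D1, z \notin D2 & [disjoint D1 & D2]],
      forall u v, u \in D1 -> v \in D2 -> ~~ G u v &
      (forall u, u \in D1 -> ~~ G u y) /\ (forall v, v \in D2 -> ~~ G v x)].

Lemma split_atC x y U z D1 D2 : split_at x y U z D1 D2 -> split_at y x U z D2 D1.
Proof.
case=> zU eU [z1 z2 d] n [n1 n2]; split=> //; first by rewrite (setUC D2).
  by split=> //; rewrite disjoint_sym.
by move=> u v u2 v1; rewrite grC n.
Qed.

(* Such a side is either a single edge xz, or consists of two components of the
   cut {x, z}. *)
Definition slot x z D : Prop :=
  (D = set0 /\ G x z) \/
  (exists V1 V2, cut3 x z V1 V2 (A :\: [set x; z] :\: D) /\ D = V1 :|: V2).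

Section Cut.
Variables (x y : V) (U1 U2 U3 : {set V}).
Hypothesis c : cut3 x y U1 U2 U3.

(** The piece is not 2-connected, so deleting at most one vertex separates it, with [x] and [y] on
    different sides. The deleted vertex lies in [U1], since otherwise the connected set [U1] would
    still join [x] to [y]. *)
Lemma split_exists : exists z D1 D2, split_at x y U1 z D1 D2.
Proof.
have [[xy xA yA nxy] [c1 c2 c3] [d12 d13 d23] e] := c.
have [[x1 y1] U1A] := piece_notin c1.2.
have [[a1 a1U xa1] [b1 b1U yb1]] := comp_att tcA xy xA yA c1.
apply: contrapT => nex; apply: (no_bridge t1 t2 clK KG tcA IH np c); split.
  by rewrite (card_piece xy c1.2).
move=> Z Z1; split.
  case: (boolP (x \in Z)) => xZ; last by apply/set0Pn; exists x; rewrite !inE xZ eqxx orbT.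
  case: (boolP (y \in Z)) => yZ; last by apply/set0Pn; exists y; rewrite !inE yZ eqxx !orbT.
  by case: (small_set xy Z1 xZ yZ).
move=> C C0 cC; apply/eqP; apply: contraT => nC; case: nex; set B := _ :\: Z in cC nC.
have cC' := cl_compl cC; have [CB hC] := clP _ _ _ cC.
have D0 := rest_nonempty cC nC.
have := piece_meet tcA xy xA yA c1.2 Z1 C0 cC.
have := piece_meet tcA xy xA yA c1.2 Z1 D0 cC'; rewrite !(in_setD B) => m1 m2.
have [D [cD xD yD [xB yB]]] : exists D, [/\ cl G B D, x \in D, y \notin D & x \in B /\ y \in B].
  case/orP: m1 => /andP[n1 nB]; case/orP: m2 => q.
  - by rewrite q in n1.
  - exists (B :\: C); rewrite !(in_setD B) n1 q; split=> //.
    by split=> //; apply: (subsetP CB).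
  - exists C; split=> //; split=> //; apply: (subsetP CB); exact: q.
  - by rewrite q in n1.
have [DB hD] := clP _ _ _ cD.
have [z zU zZ] : exists2 z, z \in U1 & z \in Z.
  case: (boolP [disjoint U1 & Z]) => [dZ|/pred0Pn[z /andP[zU zZ]]]; last by exists z.
  have UB : U1 \subset B.
    apply/subsetP => u uU; rewrite !inE uU /= andbT.
    by rewrite (disjointFr dZ uU).
  have BU := subsetP UB.
  have aD : a1 \in D by apply: (hD x) => //; exact: BU.
  have bD : b1 \in D := subsetP (conn_cl c1.1 UB cD a1U aD) b1 b1U.
  by rewrite (hD b1 y) // grC in yD.
have eZ u : (u \in Z) = (u == z).
  apply/idP/eqP => [uZ|->] //; apply/eqP; apply: contraT => uz.
  by case: (small_set uz Z1 uZ zZ).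
have eB u : u \in B = (u != z) && (u \in U1 +: x & y) by rewrite in_setD eZ.
have zx : z != x by apply: contraNneq x1 => <-.
have zy : z != y by apply: contraNneq y1 => <-.
have UB u : u \in U1 -> u != z -> u \in B by move=> uU uz; rewrite eB uz in_setU uU.
have DU u : u \in D -> u != x -> u \in U1.
  move=> uD ux; have := subsetP DB u uD; rewrite eB !inE (negPf ux) /=.
  case/andP => _ /orP[//|/eqP uy]; by rewrite uy (negPf yD) in uD.
exists z, (D :\ x), ((B :\: D) :\ y); split=> //.
- apply/setP => u; rewrite !inE eZ; case: (u =P z) => [->|_] /=; first by rewrite zU.
  case: (u =P x) => [->|/eqP ux] /=; first by rewrite xD (negPf x1) andbF.
  case: (u =P y) => [->|/eqP uy] /=; first by rewrite (negPf y1) orbF (negPf yD).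
  case: (boolP (u \in D)) => uD /=; first by rewrite DU.
  by rewrite orbF.
- split; first by rewrite !inE; apply/negP => /andP[_ /(subsetP DB)]; rewrite eB eqxx.
    by rewrite !inE eZ eqxx !andbF.
  rewrite disjoint_subset; apply/subsetP => u; rewrite inE => /andP[_ uD].
  by rewrite !inE uD andbF.
- move=> u v; rewrite in_setD1 => /andP[_ uD]; rewrite in_setD1 in_setD => /and3P[_ vD vB].
  by apply: contra vD => uv; apply: (hD u).
- split.
    by move=> u; rewrite in_setD1 => /andP[_ uD]; apply: contra yD => uy; apply: (hD u).
  move=> v; rewrite in_setD1 in_setD => /and3P[_ vD vB].
  by apply: contra vD => vx; apply: (hD x) => //; rewrite grC.
Qed.

(** A nonempty [D1] is separated from the rest by [x] and [z]. The rest [M] is connected, so it is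
    one of the three components of the cut [{x, z}], and [D1] is the union of the other two. *)
Lemma split_slot z D1 D2 : split_at x y U1 z D1 D2 -> slot x z D1.
Proof.
move=> [zU eU [z1 z2 d] n [n1 n2]].
have [[xy xA yA nxy] [c1 c2 c3] [d12 d13 d23] e] := c.
have [[x1 y1] U1A] := piece_notin c1.2.
have [[x2 y2] U2A] := piece_notin c2.2; have [[x3 y3] U3A] := piece_notin c3.2.
have D1U u : u \in D1 -> u \in U1 by move=> uD; rewrite eU !inE uD orbT.
have D2U u : u \in D2 -> u \in U1 by move=> uD; rewrite eU !inE uD !orbT.
have xz : x != z by apply: contraNneq x1 => ->.
have yz : y != z by apply: contraNneq y1 => ->.
have zA := subsetP U1A z zU.
have [D0|D0] := eqVneq D1 set0.
  left; split=> //; have [[s sU xs] _] := comp_att tcA xy xA yA c1.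
  move: sU; rewrite eU D0 !inE /= => /orP[/eqP <- //|sD].
  by have := n2 s sD; rewrite grC xs.
right; have cD : cl G (A :\: [set x; z]) D1.
  apply/clP; split.
    apply/subsetP => u uD; have uU := D1U u uD.
    rewrite !inE (subsetP U1A u uU) andbT; apply/norP; split.
      by apply: contraNneq x1 => <-.
    by apply: contraNneq z1 => <-.
  move=> u v uD; rewrite !inE => /andP[/norP[vx vz] vA] uv.
  have vy : v != y by apply: contraTneq uv => ->; apply: n1.
  have : v \in U1.
    have [_ h] := clP _ _ _ c1.2; apply: (h u v) => //; first exact: D1U.
    by rewrite !inE negb_or vx vy.
  rewrite eU !inE (negPf vz) /= => /orP[//|vD].
  by have := n u v uD vD; rewrite uv.
set M := A :\: [set x; z] :\: D1.
have clM : cl G (A :\: [set x; z]) M := cl_compl cD.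
have yM : y \in M.
  rewrite !inE yA (negPf yz) eq_sym (negPf xy) /= andbT.
  by apply: contra y1; exact: D1U.
have inM u : u \in M -> [|| u == y, u \in D2, u \in U2 | u \in U3].
  rewrite !inE => /and3P[uD1 /norP[ux uz] uA]; case: eqVneq => //= uy.
  have : u \in A :\: [set x; y] by rewrite !inE negb_or ux uy.
  by rewrite -e !inE eU !inE (negPf uz) (negPf uD1) /= orbA.
have UM U : component x y U -> [disjoint U1 & U] -> U \subset M.
  move=> cU dU; apply/subsetP => u uU; have [[xU yU] UA] := piece_notin cU.2.
  have u1 : u \notin U1 by rewrite (disjointFl dU uU).
  rewrite !inE (subsetP UA u uU) andbT (contra (@D1U u) u1) /=.
  by apply/norP; split; [apply: contraNneq xU => <-|apply: contraNneq u1 => ->].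
have cM : conn G M.
  (* A closed part of [M] avoiding [y] cannot meet [U2] or [U3], which are connected and attached to
     [y]. It would lie in [D2] and be cut off from [x] by [z] alone. *)
  have key N : N != set0 -> cl G M N -> y \in N.
    move=> N0 cN; apply: contraT => yN; have [NM hN] := clP _ _ _ cN.
    have noU U u : component x y U -> [disjoint U1 & U] -> u \in U -> u \notin N.
      move=> cU dU uU; apply: contra yN => uN.
      have sU := conn_cl cU.1 (UM U cU dU) cN uU uN.
      have [_ [s sS ys]] := comp_att tcA xy xA yA cU.
      by apply: (hN s) => //; [exact: (subsetP sU)|rewrite grC].
    have ND u : u \in N -> u \in D2.
      move=> uN; have := inM u (subsetP NM u uN); case: eqVneq => [uy|_] /=.
        by rewrite uy (negPf yN) in uN.
      case/or3P => // uU; first by have := noU U2 u c2 d12 uU; rewrite uN.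
      by have := noU U3 u c3 d13 uU; rewrite uN.
    have [_ /(_ [set z])] := tcA; rewrite cards1 => /(_ isT)[_ /(_ N N0)].
    have -> : cl G (A :\: [set z]) N.
      apply/clP; split.
        apply/subsetP => u /ND uD; have uU := D2U u uD.
        rewrite !inE (subsetP U1A u uU) andbT.
        by apply: contraNneq z2 => <-.
      move=> u v uN; rewrite !inE => /andP[vz vA] uv.
      have vx : v != x by apply: contraTneq uv => ->; exact: n2 (ND u uN).
      apply: (hN u v) => //; have [_ hM] := clP _ _ _ clM.
      apply: (hM u v) => //; first exact: (subsetP NM).
      by rewrite !inE negb_or vx vz.
    move=> /(_ isT)/setP/(_ x); rewrite !inE xz xA => /ND/D2U; by rewrite (negPf x1).
  split; first by apply/set0Pn; exists y.
  move=> N N0 cN; apply/eqP; apply: contraT => nN.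
  have := key _ (rest_nonempty cN nN) (cl_compl cN).
  by rewrite in_setD (key N N0 cN).
have nD : D1 != A :\: [set x; z].
  by apply: contraTneq yM => e1; rewrite /M e1 setDv inE.
have [V1 [V2 [V3 cV]]] := cut3_exists t1 t2 clK KG tcA IH xz xA zA np D0 nD cD.
have step W1 W2 W3 : cut3 x z W1 W2 W3 -> y \in W3 -> exists V1 V2, cut3 x z V1 V2 M /\ D1 = V1 :|: V2.
  move=> cW yW; have [_ [_ _ [k3 l3]] [_ e1 e2] eW] := cW.
  have W3A := (clP _ _ _ l3).1.
  have eM : W3 = M.
    apply/eqP; rewrite eqEsubset (conn_cl k3 W3A clM yW yM).
    exact: (conn_cl cM (clP _ _ _ clM).1 l3 yM yW).
  exists W1, W2; rewrite -eM; split=> //.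
  have : A :\: [set x; z] :\: W3 = D1.
    rewrite eM /M; apply/setP => u; rewrite !in_setD.
    case: (boolP (u \in D1)) => uD /=; last by rewrite andNb.
    by have := subsetP (clP _ _ _ cD).1 u uD; rewrite in_setD.
  rewrite -eW => <-; apply/setP => u; rewrite !inE.
  case: (boolP (u \in W3)) => uW; rewrite ?orbF //=.
  by rewrite (disjointFl e1 uW) (disjointFl e2 uW).
have : y \in A :\: [set x; z] by rewrite !inE negb_or yA eq_sym xy yz.
have [_ _ _ <-] := cV; rewrite !inE => /orP[/orP[yV|yV]|yV].
- exact: (step _ _ _ (cut3_rot cV)).
- exact: (step _ _ _ (cut3_rot (cut3_rot cV))).
- exact: (step _ _ _ cV).
Qed.

(** The first two bounds drive the induction on components. The third, witnessed by [y] and a vertex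
    of [U2], ensures that a single-vertex component at the cut [{x, z}] is one of the two that form
    [D1]. *)
Lemma split_card z D1 D2 : split_at x y U1 z D1 D2 ->
  [/\ (#|D1| < #|U1|)%N, (#|D2| < #|U1|)%N & (1 < #|A :\: [set x; z] :\: D1|)%N].
Proof.
move=> [zU eU [z1 z2 d] n [n1 n2]].
have [[xy xA yA nxy] [c1 c2 c3] [d12 d13 d23] e] := c.
have [[x1 y1] U1A] := piece_notin c1.2.
have [[x2 y2] U2A] := piece_notin c2.2.
split.
- apply: proper_card; apply/properP; split; last by exists z.
  by rewrite eU; apply/subsetP => u uD; rewrite !inE uD orbT.
- apply: proper_card; apply/properP; split; last by exists z.
  by rewrite eU; apply/subsetP => u uD; rewrite !inE uD !orbT.
have [a a2] : exists a, a \in U2 by apply/set0Pn; exact: c2.1.1.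
have ya : y != a by apply: contraNneq y2 => ->.
have a1 : a \notin U1 by rewrite (disjointFl d12 a2).
have D1U u : u \in D1 -> u \in U1 by move=> uD; rewrite eU !inE uD orbT.
have : [set y; a] \subset A :\: [set x; z] :\: D1.
  rewrite subUset !sub1set !inE yA (subsetP U2A a a2) !andbT.
  apply/andP; split; apply/andP; split; try (apply/norP; split).
  - by apply: contra y1; exact: D1U.
  - by rewrite eq_sym.
  - by apply: contraNneq y1 => ->.
  - by apply: contra a1; exact: D1U.
  - by apply: contraNneq x2 => <-.
  - by apply: contraNneq a1 => ->.
by move=> /subset_leq_card; rewrite cards2 ya.
Qed.
End Cut.

Lemma slot_val x z D : slot x z D ->
  apart t G (D +: x & z) x z != 0 /\
  (eratio t G (D +: x & z) x z = 0 \/ exists V1 V2,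
    [/\ cut3 x z V1 V2 (A :\: [set x; z] :\: D), D = V1 :|: V2 &
    eratio t G (D +: x & z) x z = eratio t G (V1 +: x & z) x z * eratio t G (V2 +: x & z) x z]).
Proof.
case=> [[-> xz]|[V1 [V2 [cV eD]]]].
  rewrite set0U; have [-> ->] := edge_val t1 xz; split; last by left.
  by rewrite mulf_neq0 ?invr_neq0 ?gt_eqF ?subr_gt0 // (lt_trans _ t1).
split; first by rewrite [X in X +: _ & _]eD (cut3_apart clK KG tcA IH cV).
right; exists V1, V2; split=> //.
by rewrite [X in X +: _ & _]eD (cut3_par t1 cV).
Qed.

Lemma slot0_val x z : slot x z set0 -> eratio t G (set0 +: x & z) x z = 0.
Proof.
case/slot_val => _ [//|[V1 [V2 [[_ [[[V0 _] _] _ _] _ _] e _]]]].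
case/set0Pn: V0 => u uV; have := in_set0 u; by rewrite e inE uV.
Qed.

Lemma split_val x y U1 U2 U3 z D1 D2 : cut3 x y U1 U2 U3 -> split_at x y U1 z D1 D2 ->
  let s1 := eratio t G (D1 +: x & z) x z in let s2 := eratio t G (D2 +: y & z) y z in
  eratio t G (U1 +: x & y) x y = (s1 * s2 + (t - 1)) / (s1 + s2 - (2 - t)).
Proof.
move=> c sp s1 s2; have sl1 := split_slot c sp; have sl2 := split_slot (cut3_C c) (split_atC sp).
have [a1 _] := slot_val sl1; have [a2 _] := slot_val sl2.
have [[xy xA yA nxy] [c1 c2 c3] [d12 d13 d23] e] := c.
have [[x1 y1] U1A] := piece_notin c1.2.
have [zU eU [z1 z2 d] n [n1 n2]] := sp.
have D1U u : u \in D1 -> u \in U1 by move=> uD; rewrite eU !inE uD orbT.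
have D2U u : u \in D2 -> u \in U1 by move=> uD; rewrite eU !inE uD !orbT.
have xz : x != z by apply: contraNneq x1 => ->.
have yz : y != z by apply: contraNneq y1 => ->.
rewrite /s2 -(valC t G (D2 +: y & z) yz).2.
have -> : U1 +: x & y = (D1 +: x & z) :|: (D2 +: y & z).
  rewrite eU; apply/setP => u; rewrite !inE.
  by case: (u == x); case: (u == y); case: (u == z); case: (u \in D1); case: (u \in D2).
apply: series_val; try assumption.
- by rewrite !inE eqxx orbT.
- by rewrite !inE eqxx orbT.
- apply/subsetP => u; rewrite !inE; case: (u =P z) => [//|_]; rewrite !orbF.
  case/andP => /orP[uD|/eqP ->] /orP[uD'|/eqP uy].
  + by rewrite (disjointFr d uD) in uD'.
  + by rewrite -uy D1U in y1.
  + by rewrite D2U in x1.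
  + by rewrite -uy eqxx in xy.
- move=> u v; rewrite !inE => /orP[uD|/orP[]/eqP ->] /orP[vD|/orP[]/eqP ->] uv; rewrite ?eqxx ?orbT //.
  + by rewrite (negPf (n u v uD vD)) in uv.
  + by rewrite (negPf (n1 u uD)) in uv.
  + by rewrite grC (negPf (n2 v vD)) in uv.
  + by rewrite (negPf nxy) in uv.
- by rewrite (valC t G (D2 +: y & z) yz).1.
Qed.

Lemma single_comp x y U1 U2 U3 : cut3 x y U1 U2 U3 -> #|U1| = 1%N ->
  eratio t G (U1 +: x & y) x y = - ((t - 1) / (2 - t)).
Proof.
move=> [[xy xA yA nxy] [c1 c2 c3] _ _] /eqP/cards1P[z ez].
have [[a]] := comp_att tcA xy xA yA c1; rewrite ez inE => /eqP -> xz [b].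
rewrite inE => /eqP -> yz; apply: single_val => //.
by rewrite grC.
Qed.

(* The ratio of every component of a cut will be above - M, and that of every side in
   [0, s0); the flags h0 and h12 record which minors are excluded. *)
Section Bounds.
Variables (h0 h12 : bool) (M s0 : R).
Hypothesis Hsingle : h12 -> forall x y U1 U2 U3, cut3 x y U1 U2 U3 ->
  [\/ #|U1| = 1%N, #|U2| = 1%N | #|U3| = 1%N].
Hypothesis Hsplit : h0 -> forall x y U1 U2 U3 z D1 D2, cut3 x y U1 U2 U3 ->
  split_at x y U1 z D1 D2 -> D1 = set0 \/ D2 = set0.
(** [Mslot] is the parallel rule for the two components of a side, [Mpath] the series rule for the
    two sides of a component, and [Mtop] the product of the three ratios at a cut. A single-vertex
    component enters as the factor [(t - 1) / (2 - t)], and excluding [H0] makes one of the two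
    sides an edge of ratio 0. *)
Hypotheses (s0_gt0 : 0 < s0) (s0_lt : s0 + s0 < 2 - t)
  (Mslot : (if h12 then (t - 1) / (2 - t) * M else M * M) <= s0)
  (Mpath : if h0 then t - 1 <= M * (2 - t - s0) else s0 * s0 + (t - 1) <= M * (2 - t - s0 - s0))
  (Mtop : (if h12 then (t - 1) / (2 - t) * (M * M) else M * M * M) <= t - 1).

Lemma slot_bound x z D : slot x z D -> (1 < #|A :\: [set x; z] :\: D|)%N ->
  (forall V1 V2 V3, cut3 x z V1 V2 V3 -> V1 \subset D -> - M < eratio t G (V1 +: x & z) x z) ->
  0 <= eratio t G (D +: x & z) x z < s0.
Proof.
move=> /slot_val[_ [->|[V1 [V2 [cV eD ->]]]]] cM bd; first by rewrite lexx.
have cV' := cut3_swap cV.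
have b1 := bd _ _ _ cV; rewrite eD subsetUl in b1; have {}b1 := b1 isT.
have b2 := bd _ _ _ cV'; rewrite eD subsetUr in b2; have {}b2 := b2 isT.
have n1 := cut3_neg t1 clK KG tcA IH cV; have n2 := cut3_neg t1 clK KG tcA IH cV'.
have r0 : 0 < (t - 1) / (2 - t) by rewrite divr_gt0 ?subr_gt0.
have e12 : h12 -> eratio t G (V1 +: x & z) x z = - ((t - 1) / (2 - t)) \/
    eratio t G (V2 +: x & z) x z = - ((t - 1) / (2 - t)).
  move=> h; case: (Hsingle h cV) => e1; last by rewrite e1 in cM.
  - by left; rewrite (single_comp cV e1).
  - by right; rewrite (single_comp cV' e1).
move: e12 b1 b2 n1 n2 Mslot; move: (eratio _ _ _ _ _) (eratio _ _ _ _ _) => a b.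
move: ((t - 1) / _) r0 => r r0 e12 b1 b2 n1 n2 Ms.
apply/andP; split; first by rewrite ltW // nmulr_rgt0.
apply: lt_le_trans Ms; case: h12 e12 => [/(_ isT)[->|->]|_]; last first.
  rewrite -mulrNN; apply: ltr_pM; rewrite ?oppr_ge0 ?(ltW n1) ?(ltW n2) //.
    by rewrite ltrNl.
  by rewrite ltrNl.
- by rewrite mulrN -mulNr mulrC ltr_pM2l // ltrNl.
- by rewrite mulNr -mulrN ltr_pM2l // ltrNl.
Qed.

(** Induction on the size of the component: its sides are made of smaller components of other cuts,
    so their ratios lie in [[0, s0)]. This keeps the denominator of the series rule negative and, by
    [Mpath], the quotient above [- M]. *)
Lemma comp_bound x y U1 U2 U3 : cut3 x y U1 U2 U3 -> - M < eratio t G (U1 +: x & y) x y.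
Proof.
have [k] := ubnP #|U1|; elim: k x y U1 U2 U3 => // k IHk x y U1 U2 U3 Uk c.
have [z [D1 [D2 sp]]] := split_exists c.
have spC := split_atC sp; have cC := cut3_C c.
have [k1 k2 k3] := split_card c sp; have [_ _ k4] := split_card cC spC.
have sl1 := slot_bound (split_slot c sp) k3.
have sl2 := slot_bound (split_slot cC spC) k4.
have bd1 : 0 <= eratio t G (D1 +: x & z) x z < s0.
  apply: sl1 => V1 V2 V3 cV sV; apply: (IHk _ _ _ _ _ _ cV).
  by apply: leq_ltn_trans (subset_leq_card sV) (leq_trans k1 _); rewrite -ltnS.
have bd2 : 0 <= eratio t G (D2 +: y & z) y z < s0.
  apply: sl2 => V1 V2 V3 cV sV; apply: (IHk _ _ _ _ _ _ cV).
  by apply: leq_ltn_trans (subset_leq_card sV) (leq_trans k2 _); rewrite -ltnS.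
have zero : h0 -> eratio t G (D1 +: x & z) x z = 0 \/ eratio t G (D2 +: y & z) y z = 0.
  move=> h; case: (Hsplit h c sp) => e; [left|right].
    by have := split_slot c sp; rewrite e; exact: slot0_val.
  by have := split_slot cC spC; rewrite e; exact: slot0_val.
rewrite (split_val c sp); move: bd1 bd2 zero Mpath.
move: (eratio _ _ _ _ _) (eratio _ _ _ _ _) => b a /andP[a0 a1] /andP[b0 b1] zero Mp.
have d0 : 0 < 2 - t - a - b by move: s0_lt a1 b1; lra.
have -> : a + b - (2 - t) = - (2 - t - a - b) by ring.
rewrite invrN mulrN ltrN2 ltr_pdivrMr //.
case: h0 zero Mp => [/(_ isT) zero|_] Mp.
  have M0 : 0 < M.
    have P : 0 < 2 - t - s0 by move: s0_gt0 s0_lt; lra.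
    by rewrite -(pmulr_lgt0 _ P); apply: lt_le_trans Mp; rewrite subr_gt0.
  apply: (le_lt_trans (y := t - 1)); first by case: zero => ->; rewrite ?mul0r ?mulr0 add0r.
  by apply: le_lt_trans Mp _; rewrite ltr_pM2l //; case: zero a1 b1 => ->; lra.
have M0 : 0 < M.
  have P : 0 < 2 - t - s0 - s0 by move: s0_gt0 s0_lt; lra.
  rewrite -(pmulr_lgt0 _ P).
  by apply: lt_le_trans Mp; apply: addr_gt0; rewrite ?mulr_gt0 // subr_gt0.
apply: (le_lt_trans (y := s0 * s0 + (t - 1))).
  by rewrite lerD2r ler_pM // ltW.
by apply: le_lt_trans Mp _; rewrite ltr_pM2l //; move: a1 b1; lra.
Qed.

(** Three ratios in [(- M, 0)] have a product above [- (t - 1)] by [Mtop], whereas a counterexample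
    needs one of at most [- (t - 1)]. *)
Lemma no_cut x y U1 U2 U3 : ~ cut3 x y U1 U2 U3.
Proof.
move=> c; have c1 := cut3_rot c; have c2 := cut3_rot c1.
have := cut3_prod t1 clK KG tcA IH np c.
have r0 : 0 < (t - 1) / (2 - t) by rewrite divr_gt0 ?subr_gt0.
have n1 := cut3_neg t1 clK KG tcA IH c; have n2 := cut3_neg t1 clK KG tcA IH c1.
have n3 := cut3_neg t1 clK KG tcA IH c2.
have b1 := comp_bound c; have b2 := comp_bound c1; have b3 := comp_bound c2.
have prod2 (a b : R) : a < 0 -> b < 0 -> - M < a -> - M < b -> a * b < M * M.
  move=> a0 b0 ma mb; rewrite -mulrNN; apply: ltr_pM; rewrite ?oppr_ge0 ?(ltW a0) ?(ltW b0) //.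
    by rewrite ltrNl.
  by rewrite ltrNl.
case h: h12 Mtop => Mt; last first.
  have := prod2 _ _ n1 n2 b1 b2; move: n1 n2 n3 b3.
  move: (eratio _ _ _ _ _) (eratio _ _ _ _ _) (eratio _ _ _ _ _) => d b a a0 b0 d0 d1 ab abd.
  have ab0 : 0 < a * b by rewrite nmulr_rgt0.
  have : a * b * (- d) < M * M * M.
    by apply: ltr_pM => //; [exact: ltW | rewrite oppr_ge0 ltW | rewrite ltrNl].
  by rewrite mulrN ltrNl => /lt_le_trans/(_ abd); rewrite ltrN2 => /lt_le_trans/(_ Mt); rewrite ltxx.
have fin (a b : R) : a * b < M * M -> (t - 1) / (2 - t) * (a * b) < t - 1.
  by move=> ab; apply: lt_le_trans Mt; rewrite ltr_pM2l.
have neg (a b X : R) : (t - 1) / (2 - t) * (a * b) < t - 1 ->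
    X = - ((t - 1) / (2 - t) * (a * b)) -> ~ X <= - (t - 1).
  by move=> ab ->; rewrite lerN2 leNgt ab.
case: (Hsingle h c) => e.
- rewrite (single_comp c e); apply: neg (fin _ _ (prod2 _ _ n2 n3 b2 b3)) _.
  by rewrite !mulNr mulrA.
- rewrite (single_comp c1 e); apply: neg (fin _ _ (prod2 _ _ n1 n3 b1 b3)) _.
  by rewrite mulrN mulNr mulrA; congr (- (_ * _)); rewrite mulrC.
- rewrite (single_comp c2 e); apply: neg (fin _ _ (prod2 _ _ n1 n2 b1 b2)) _.
  by rewrite mulrN mulrC.
Qed.
End Bounds.
End ComponentBounds.

(** * The excluded minors *)

Section MinorOfSeq.
Variables (V : finType) (G : graph V).
Implicit Types (P Q Z U S T : {set V}).

Definition touch S T : Prop := exists a b, [/\ a \in S, b \in T & G a b].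

Lemma touchC S T : touch S T -> touch T S.
Proof. by move=> [a [b [aS bT ab]]]; exists b, a; rewrite grC. Qed.

Lemma att_touch S x : att G S x -> touch [set x] S.
Proof. by move=> [s sS xs]; exists x, s; rewrite inE. Qed.

(** Numbering the vertices of [H] reduces the conditions on branch sets to finite checks along a
    list of sets and a list of index pairs. *)
Lemma minor_of_seq (H : sgraph) (idx : H -> nat) (s : seq {set V}) (L : seq (nat * nat)) :
  injective idx -> (forall h, (idx h < size s)%N) ->
  pairwise (fun S T : {set V} => [disjoint S & T]) s ->
  (forall S, S \in s -> conn G S) ->
  (forall h h', adj h h' -> (idx h < idx h')%N -> (idx h, idx h') \in L) ->
  (forall p, p \in L -> touch (nth set0 s p.1) (nth set0 s p.2)) ->
  minor H (sg G).
Proof.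
move=> inj lt dis cs adjL LT; exists (fun h => nth set0 s (idx h)); split.
- by move=> h; apply/conn_connected/cs/mem_nth.
- move=> h h' hh'; have /(pairwiseP set0) dis' := dis.
  have : idx h != idx h' by apply: contra hh' => /eqP/inj ->.
  rewrite neq_ltn => /orP[l|l]; first by apply: dis' => //; exact: lt.
  by rewrite disjoint_sym; apply: dis' => //; exact: lt.
- move=> h h' hh'; have : idx h != idx h'.
    by apply: contraTneq hh' => /inj ->; rewrite adj_irr.
  rewrite neq_ltn => /orP[l|l]; first exact: LT (adjL _ _ hh' l).
  by apply: touchC; apply: LT (adjL _ _ _ l); rewrite adj_sym.
Qed.

(* The original vertices come first, then the subdivision vertices in the order in
   which the edges are subdivided. *)
Definition idxH0 (h : H0) : nat :=
  match h with
  | inl (inl (inl i)) => nat_of_ord i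
  | inl (inl (inr b)) => 3 + ~~ b
  | inl (inr b) => 5 + ~~ b
  | inr b => 7 + ~~ b
  end.

Definition idxH1 (h : H1) : nat :=
  match h with
  | inl (inl (inl (inl i))) => nat_of_ord i
  | inl (inl (inl (inr j))) => 2 + j
  | inl (inl (inr b)) => 5 + ~~ b
  | inl (inr b) => 7 + ~~ b
  | inr b => 9 + ~~ b
  end.

Definition idxH2 (h : H2) : nat := idxH1 h.

Lemma idxH0_inj : injective idxH0.
Proof.
have E (i j : 'I_3) : nat_of_ord i = nat_of_ord j -> i = j by move=> e; apply: val_inj.
case=> [[[i|a]|a]|a] [[[j|b]|b]|b] /=; try (by case: a; case: b);
  try (by case: i => [[|[|[|?]]] ?] //=; case: b);
  try (by case: j => [[|[|[|?]]] ?] //=; case: a).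
by move/E ->.
Qed.

Lemma idxH1_inj : injective idxH1.
Proof.
have E n (i j : 'I_n) : nat_of_ord i = nat_of_ord j -> i = j by move=> e; apply: val_inj.
case=> [[[[i|i]|a]|a]|a] [[[[j|j]|b]|b]|b] /=;
  try (by case: a; case: b); try (by move=> e; do 4 f_equal; apply: E; lia);
  move=> e; exfalso; move: e;
  try (by case: i => [[|[|[|?]]] ?] //=; try (case: j => [[|[|[|?]]] ?] //=); case: b);
  try (by case: j => [[|[|[|?]]] ?] //=; case: a);
  by case: i => [[|[|[|?]]] ?] //=; case: j => [[|[|[|?]]] ?] //=.
Qed.

Definition LH0 : seq (nat * nat) :=
  [:: (0, 3); (0, 4); (1, 3); (1, 4); (1, 5); (1, 6); (2, 5); (2, 6); (0, 7); (0, 8); (2, 7); (2, 8)]%N.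
Definition LH1 : seq (nat * nat) :=
  [:: (0, 5); (0, 6); (2, 5); (2, 6); (0, 7); (0, 8); (3, 7); (3, 8); (0, 9); (0, 10); (4, 9); (4, 10); (1, 2); (1, 3); (1, 4)]%N.
Definition LH2 : seq (nat * nat) :=
  [:: (0, 5); (0, 6); (2, 5); (2, 6); (0, 7); (0, 8); (3, 7); (3, 8); (1, 9); (1, 10); (4, 9); (4, 10); (1, 2); (1, 3); (0, 4)]%N.

Lemma adjH0 h h' : adj h h' -> (idxH0 h < idxH0 h')%N -> (idxH0 h, idxH0 h') \in LH0.
Proof.
case: h => [[[[[|[|[|?]]] ?]|[]]|[]]|[]] //; case: h' => [[[[[|[|[|?]]] ?]|[]]|[]]|[]] //.
Qed.

Lemma adjH1 h h' : adj h h' -> (idxH1 h < idxH1 h')%N -> (idxH1 h, idxH1 h') \in LH1.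
Proof.
case: h => [[[[[[|[|?]] ?]|[[|[|[|?]]] ?]]|[]]|[]]|[]] //;
  case: h' => [[[[[[|[|?]] ?]|[[|[|[|?]]] ?]]|[]]|[]]|[]] //.
Qed.

Lemma adjH2 h h' : adj h h' -> (idxH2 h < idxH2 h')%N -> (idxH2 h, idxH2 h') \in LH2.
Proof.
case: h => [[[[[[|[|?]] ?]|[[|[|[|?]]] ?]]|[]]|[]]|[]] //;
  case: h' => [[[[[[|[|?]] ?]|[[|[|[|?]]] ?]]|[]]|[]]|[]] //.
Qed.

Lemma idxH0_lt h : (idxH0 h < 9)%N.
Proof. by case: h => [[[i|[]]|[]]|[]] //=; apply: leq_trans (ltn_ord i) _. Qed.

Lemma idxH1_lt h : (idxH1 h < 11)%N.
Proof.
case: h => [[[[i|i]|[]]|[]]|[]] //=; first by apply: leq_trans (ltn_ord i) _.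
by rewrite !ltnS; apply: leq_trans (ltnW (ltn_ord i)) _.
Qed.

Lemma disjoint_setUr (A B C : {set V}) :
  [disjoint A & B :|: C] = [disjoint A & B] && [disjoint A & C].
Proof. by rewrite !(disjoint_sym A) disjoint_setU. Qed.

Lemma H0_minor x z y A1 A2 B1 B2 C1 C2 :
  [/\ x != z, x != y & z != y] ->
  [/\ conn G A1, conn G A2, conn G B1, conn G B2 & conn G C1 /\ conn G C2] ->
  [/\ att G A1 x, att G A1 z, att G A2 x & att G A2 z] ->
  [/\ att G B1 z, att G B1 y, att G B2 z & att G B2 y] ->
  [/\ att G C1 y, att G C1 x, att G C2 y & att G C2 x] ->
  [/\ [disjoint A1 & A2], [disjoint B1 & B2] & [disjoint C1 & C2]] ->
  [/\ [disjoint A1 :|: A2 & B1 :|: B2], [disjoint A1 :|: A2 & C1 :|: C2] &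
      [disjoint B1 :|: B2 & C1 :|: C2]] ->
  [disjoint [set x; z; y] & A1 :|: A2 :|: (B1 :|: B2) :|: (C1 :|: C2)] ->
  minor H0 (sg G).
Proof.
move=> [xz xy zy] [cA1 cA2 cB1 cB2 [cC1 cC2]] [a1 a2 a3 a4] [b1 b2 b3 b4] [c1 c2 c3 c4].
rewrite !disjoint_setU !disjoint_setUr !disjoints1.
case=> dA dB dC [/andP[/andP[e1 e2] /andP[e3 e4]] /andP[/andP[f1 f2] /andP[f3 f4]]].
move=> /andP[/andP[g1 g2] /andP[g3 g4]].
case/andP => /andP[/andP[/andP[/andP[x1 x2] /andP[x3 x4]] /andP[x5 x6]]].
case/andP => /andP[/andP[z1 z2] /andP[z3 z4]] /andP[z5 z6].
case/andP => /andP[/andP[y1 y2] /andP[y3 y4]] /andP[y5 y6].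
apply: (@minor_of_seq H0 idxH0 [:: [set x]; [set z]; [set y]; A1; A2; B1; B2; C1; C2] LH0).
- exact: idxH0_inj.
- exact: idxH0_lt.
- by rewrite /= !disjoints1 !inE xz xy zy x1 x2 x3 x4 x5 x6 y1 y2 y3 y4 y5 y6 z1 z2 z3 z4 z5 z6 dA dB dC e1 e2 e3 e4 f1 f2 f3 f4 g1 g2 g3 g4.
- by move=> S; rewrite !inE; do 8 (case/predU1P => [->|]; first by [|exact: conn1]); move/eqP ->.
- exact: adjH0.
- by move=> p; rewrite !inE; do 11 (case/predU1P => [->|]; first exact: att_touch); move/eqP ->; exact: att_touch.
Qed.

(* The branch sets of a doubly subdivided edge xZ, with Z attached to y. *)
Record handle x y U P Q Z : Prop := Handle {
  h_conn : [/\ conn G P, conn G Q & conn G Z];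
  h_sub : [/\ P \subset U, Q \subset U & Z \subset U];
  h_dis : [/\ [disjoint P & Q], [disjoint P & Z] & [disjoint Q & Z]];
  h_att : [/\ att G P x, att G Q x & att G Z y];
  h_touch : touch Z P /\ touch Z Q }.

Section Handles.
Variables (x y : V) (U1 U2 U3 P1 Q1 Z1 P2 Q2 Z2 P3 Q3 Z3 : {set V}).
Hypotheses (xy : x != y) (d12 : [disjoint U1 & U2]) (d13 : [disjoint U1 & U3])
  (d23 : [disjoint U2 & U3])
  (x1 : x \notin U1) (x2 : x \notin U2) (x3 : x \notin U3)
  (y1 : y \notin U1) (y2 : y \notin U2) (y3 : y \notin U3).
Hypotheses (h1 : handle x y U1 P1 Q1 Z1) (h2 : handle x y U2 P2 Q2 Z2).

Let s := [:: [set x]; [set y]; Z1; Z2; Z3; P1; Q1; P2; Q2; P3; Q3].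

Let pw : (exists x' y', handle x' y' U3 P3 Q3 Z3) ->
  pairwise (fun S T : {set V} => [disjoint S & T]) s /\ (forall S, S \in s -> conn G S).
Proof.
move=> [x' [y' h3]].
case: (h1) => -[c1 c2 c3] [s1 s2 s3] [e1 e2 e3] _ _.
case: (h2) => -[c1' c2' c3'] [s1' s2' s3'] [e1' e2' e3'] _ _.
case: h3 => -[k1 k2 k3] [t1 t2 t3] [f1 f2 f3] _ _.
have no v U S : v \notin U -> S \subset U -> v \notin S by move=> h /subsetP k; apply: contra h; exact: k.
have dj U U' S S' : [disjoint U & U'] -> S \subset U -> S' \subset U' -> [disjoint S & S'].
  by move=> d a b; apply: disjointWl a _; apply: disjointWr b d.
have dj' U U' S S' : [disjoint U & U'] -> S \subset U -> S' \subset U' -> [disjoint S' & S].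
  by move=> d a b; rewrite disjoint_sym; apply: dj d a b.
split.
  rewrite /= !disjoints1 !inE xy /= !andbT.
  repeat (apply/andP; split);
    first [ exact: (no _ _ _ x1) | exact: (no _ _ _ x2) | exact: (no _ _ _ x3)
          | exact: (no _ _ _ y1) | exact: (no _ _ _ y2) | exact: (no _ _ _ y3)
          | exact: (dj _ _ _ _ d12) | exact: (dj _ _ _ _ d13) | exact: (dj _ _ _ _ d23)
          | exact: (dj' _ _ _ _ d12) | exact: (dj' _ _ _ _ d13) | exact: (dj' _ _ _ _ d23)
          | by [] | by rewrite disjoint_sym ].
by move=> S; rewrite !inE; do 10 (case/predU1P => [->|]; first by [|exact: conn1]); move/eqP ->.
Qed.

Lemma H1_minor : handle x y U3 P3 Q3 Z3 -> minor H1 (sg G).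
Proof.
move=> h3; have [d c] : _ /\ _ := pw (ex_intro _ x (ex_intro _ y h3)).
apply: (@minor_of_seq H1 idxH1 s LH1 idxH1_inj idxH1_lt d c adjH1).
have [[p1 q1 z1] [tp1 tq1]] := (h_att h1, h_touch h1).
have [[p2 q2 z2] [tp2 tq2]] := (h_att h2, h_touch h2).
have [[p3 q3 z3] [tp3 tq3]] := (h_att h3, h_touch h3).
by move=> p; rewrite !inE; do 14 (case/predU1P => [->|]; first by [|exact: att_touch]); move/eqP ->; exact: att_touch.
Qed.

(** The third handle has its doubled edge at [y] instead of [x], like the edge [yw] in [H2]. *)
Lemma H2_minor : handle y x U3 P3 Q3 Z3 -> minor H2 (sg G).
Proof.
move=> h3; have [d c] : _ /\ _ := pw (ex_intro _ y (ex_intro _ x h3)).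
apply: (@minor_of_seq H2 idxH2 s LH2 idxH1_inj idxH1_lt d c adjH2).
have [[p1 q1 z1] [tp1 tq1]] := (h_att h1, h_touch h1).
have [[p2 q2 z2] [tp2 tq2]] := (h_att h2, h_touch h2).
have [[p3 q3 z3] [tp3 tq3]] := (h_att h3, h_touch h3).
by move=> p; rewrite !inE; do 14 (case/predU1P => [->|]; first by [|exact: att_touch]); move/eqP ->; exact: att_touch.
Qed.
End Handles.
End MinorOfSeq.

(** * Excluded minors produced by a cut with three components *)

Section ForbiddenMinors.
Variables (R : realType) (t : R) (V : finType) (K : graph V -> Prop).
Hypotheses (t1 : 1 < t) (t2 : t < 2) (clK : minor_closed K).
Implicit Types (U W C S D B P Q Z : {set V}) (u v x y z : V).
Variables (G : graph V) (A : {set V}).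
Hypotheses (KG : K G) (tcA : biconn G A)
  (IH : forall (A' : {set V}) (G' : graph V), (#|A'| < #|A|)%N -> K G' -> biconn G' A' -> pos t G' A').
Hypothesis np : ~ pos t G A.

Notation cut3 := (cut3 G A).
Notation component := (component G A).
Notation split_at := (split_at G).

Lemma slot_nonempty x z D : slot G A x z D -> D != set0 ->
  exists V1 V2, [/\ D = V1 :|: V2, [disjoint V1 & V2], conn G V1, conn G V2 &
    [/\ att G V1 x, att G V1 z, att G V2 x & att G V2 z]].
Proof.
case=> [[-> _]|[V1 [V2 [[[xz xA zA _] [c1 c2 _] [d _ _] _] e]]] _]; first by rewrite eqxx.
have [a1 b1] := comp_att tcA xz xA zA c1; have [a2 b2] := comp_att tcA xz xA zA c2.
by exists V1, V2; split; [| |exact: c1.1|exact: c2.1|].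
Qed.

(** Two nonempty sides would doubly subdivide [xz] and [zy], while the components [U2] and [U3]
    doubly subdivide [xy]: together this is [H0] on the triangle [x], [z], [y]. *)
Lemma no_H0_split x y U1 U2 U3 z D1 D2 : ~ minor H0 (sg G) ->
  cut3 x y U1 U2 U3 -> split_at x y U1 z D1 D2 -> D1 = set0 \/ D2 = set0.
Proof.
move=> nH c sp; have [D10|D10] := eqVneq D1 set0; first by left.
have [D20|D20] := eqVneq D2 set0; first by right.
have [V1 [V2 [e1 dV k1 k2 [a1 a2 a3 a4]]]] := slot_nonempty (split_slot t1 t2 clK KG tcA IH np c sp) D10.
have [W1 [W2 [e2 dW l1 l2 [b1 b2 b3 b4]]]] :=
  slot_nonempty (split_slot t1 t2 clK KG tcA IH np (cut3_C c) (split_atC sp)) D20.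
have [zU eU [z1 z2 d] n [n1 n2]] := sp.
have [[xy xA yA nxy] [c1 c2 c3] [d12 d13 d23] e] := c.
have [[x1 y1] _] := piece_notin c1.2; have [[x2 y2] _] := piece_notin c2.2.
have [[x3 y3] _] := piece_notin c3.2.
have [p1 q1] := comp_att tcA xy xA yA c2; have [p2 q2] := comp_att tcA xy xA yA c3.
have xz : x != z by apply: contraNneq x1 => ->.
have zy : z != y by apply: contraNneq y1 => <-.
have D1U : D1 \subset U1 by rewrite eU; apply/subsetP => u uD; rewrite !inE uD orbT.
have D2U : D2 \subset U1 by rewrite eU; apply/subsetP => u uD; rewrite !inE uD !orbT.
have dU : [disjoint U1 & U2 :|: U3] by rewrite disjoint_setUr d12.
case: nH; apply: (@H0_minor _ _ x z y V1 V2 W1 W2 U2 U3) => //.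
- by split=> //; split; [exact: c2.1|exact: c3.1].
- rewrite -e1 -e2; split=> //; [exact: disjointWl D1U dU|exact: disjointWl D2U dU].
rewrite -e1 -e2 !disjoint_setU !disjoints1 !(in_setU _ _ (U2 :|: U3)) !(in_setU _ D1) !(in_setU _ U2) !negb_or.
rewrite x2 x3 y2 y3 z1 z2 (disjointFr d12 zU) (disjointFr d13 zU) /= !andbT.
rewrite (contra (subsetP D1U x) x1) (contra (subsetP D2U x) x1).
by rewrite (contra (subsetP D1U y) y1) (contra (subsetP D2U y) y1).
Qed.

(** The two components forming [D1] subdivide the edge doubly; its far end is [z] together with the
    other side [D2], which is connected and reaches [y]. *)
Lemma split_handle x y U1 U2 U3 z D1 D2 : cut3 x y U1 U2 U3 -> split_at x y U1 z D1 D2 ->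
  D1 != set0 -> exists P Q Z, handle G x y U1 P Q Z.
Proof.
move=> c sp D10.
have [V1 [V2 [e1 dV k1 k2 [a1 a2 a3 a4]]]] := slot_nonempty (split_slot t1 t2 clK KG tcA IH np c sp) D10.
have sl2 := split_slot t1 t2 clK KG tcA IH np (cut3_C c) (split_atC sp).
have [zU eU [z1 z2 d] n [n1 n2]] := sp.
have zZ : z \in z |: D2 by rewrite !inE eqxx.
have [cZ aZ] : conn G (z |: D2) /\ att G (z |: D2) y.
  have [D20|D20] := eqVneq D2 set0.
    case: sl2; rewrite D20 setU0.
      by case=> _ yz; split; [exact: conn1|exists z => //; rewrite inE].
    case=> W1 [W2 [[_ [[[/set0Pn[w wW] _] _] _ _] _ _] e]].
    by have := in_set0 w; rewrite e inE wW.
  have [W1 [W2 [e2 dW l1 l2 [b1 b2 b3 b4]]]] := slot_nonempty sl2 D20.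
  rewrite e2; case: b1 => s sW ys; split; last by exists s => //; rewrite !inE sW orbT.
  case: b2 => p pW zp; case: b4 => q qW zq; rewrite setUA.
  by apply: (connU (connU (conn1 G z) l1 _ pW zp) l2 _ qW zq); rewrite !inE eqxx.
have s1 : V1 \subset D1 by rewrite e1 subsetUl.
have s2 : V2 \subset D1 by rewrite e1 subsetUr.
have dZ : [disjoint D1 & z |: D2] by rewrite disjoint_setUr d disjoint_sym disjoints1 z1.
exists V1, V2, (z |: D2); split=> //.
- have D1U : D1 \subset U1 by rewrite eU; apply/subsetP => u uD; rewrite !inE uD orbT.
  split; [exact: subset_trans D1U|exact: subset_trans D1U|].
  by rewrite eU; apply/subsetP => u; rewrite !inE => /orP[->//|->]; rewrite !orbT.
- by split=> //; [exact: disjointWl s1 dZ|exact: disjointWl s2 dZ].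
- by split; [case: a2|case: a4] => s sV zs; exists z, s.
Qed.

Lemma handle_exists x y U1 U2 U3 : cut3 x y U1 U2 U3 -> #|U1| <> 1%N ->
  exists P Q Z, handle G x y U1 P Q Z \/ handle G y x U1 P Q Z.
Proof.
move=> c U1n; have [z [D1 [D2 sp]]] := split_exists t1 t2 clK KG tcA IH np c.
have [D10|D10] := eqVneq D1 set0; last first.
  by have [P [Q [Z h]]] := split_handle c sp D10; exists P, Q, Z; left.
have [D20|D20] := eqVneq D2 set0; last first.
  by have [P [Q [Z h]]] := split_handle (cut3_C c) (split_atC sp) D20; exists P, Q, Z; right.
by have [_ eU _ _ _] := sp; case: U1n; rewrite eU D10 D20 !setU0 cards1.
Qed.

(** Each component with more than one vertex contains a handle with its doubled edge at [x] or at
    [y]. Three handles doubled at the same vertex give [H1], any other distribution gives [H2]. *)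
Lemma no_H12_single x y U1 U2 U3 : ~ minor H1 (sg G) -> ~ minor H2 (sg G) ->
  cut3 x y U1 U2 U3 -> [\/ #|U1| = 1%N, #|U2| = 1%N | #|U3| = 1%N].
Proof.
move=> nH1 nH2 c.
have [e1|/eqP e1] := eqVneq #|U1| 1%N; first by constructor 1.
have [e2|/eqP e2] := eqVneq #|U2| 1%N; first by constructor 2.
have [e3|/eqP e3] := eqVneq #|U3| 1%N; first by constructor 3.
have [P1 [Q1 [Z1 h1]]] := handle_exists c e1.
have [P2 [Q2 [Z2 h2]]] := handle_exists (cut3_rot c) e2.
have [P3 [Q3 [Z3 h3]]] := handle_exists (cut3_rot (cut3_rot c)) e3.
have [[xy xA yA nxy] [c1 c2 c3] [d12 d13 d23] e] := c.
have [[x1 y1] _] := piece_notin c1.2; have [[x2 y2] _] := piece_notin c2.2.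
have [[x3 y3] _] := piece_notin c3.2; have yx : y != x by rewrite eq_sym.
have d32 : [disjoint U3 & U2] by rewrite disjoint_sym.
have d31 : [disjoint U3 & U1] by rewrite disjoint_sym.
have d21 : [disjoint U2 & U1] by rewrite disjoint_sym.
case: h1 => h1; case: h2 => h2; case: h3 => h3; exfalso.
- exact: nH1 (H1_minor xy d12 d13 d23 x1 x2 x3 y1 y2 y3 h1 h2 h3).
- exact: nH2 (H2_minor xy d12 d13 d23 x1 x2 x3 y1 y2 y3 h1 h2 h3).
- exact: nH2 (H2_minor xy d13 d12 d32 x1 x3 x2 y1 y3 y2 h1 h3 h2).
- exact: nH2 (H2_minor yx d23 d21 d31 y2 y3 y1 x2 x3 x1 h2 h3 h1).
- exact: nH2 (H2_minor xy d23 d21 d31 x2 x3 x1 y2 y3 y1 h2 h3 h1).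
- exact: nH2 (H2_minor yx d13 d12 d32 y1 y3 y2 x1 x3 x2 h1 h3 h2).
- exact: nH2 (H2_minor yx d12 d13 d23 y1 y2 y3 x1 x2 x3 h1 h2 h3).
- exact: nH1 (H1_minor yx d12 d13 d23 y1 y2 y3 x1 x2 x3 h1 h2 h3).
Qed.
End ForbiddenMinors.

(** * Absence of small roots *)

Section DeletionContraction.
Variables (R : realType) (t : R) (V : finType).
Hypothesis t0 : t != 0.
Implicit Types (G : graph V) (A : {set V}) (x y : V).

Lemma ctr_del G x y : ctr (delE G x y) [set x; y] x =2 ctr G [set x; y] x.
Proof.
move=> u v; apply/ctrP/ctrP => -[uv [a [b [ea eb ab]]]]; split=> //; exists a, b; split=> //.
  by move: ab; rewrite delEE => /andP[].
rewrite delEE ab /=; apply: contra uv => /orP[]/andP[/eqP ax /eqP bx].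
  by rewrite -ea -eb ax bx !retr_in ?inE ?eqxx ?orbT.
by rewrite -ea -eb ax bx !retr_in ?inE ?eqxx ?orbT.
Qed.

Lemma del_ctr G x y : G x y -> pr t G = pr t (delE G x y) - pr t (ctr G [set x; y] x) / t.
Proof.
move=> Gxy; have xy := gr_neq Gxy.
have nxy : ~~ delE G x y x y by rewrite delEE !eqxx /= andbF.
have := peq_ctr t0 xy nxy; rewrite /peq (eq_pr t (@ctr_del G x y)) => <-.
rewrite opprB addrC subrK; apply: eq_pr => u v; rewrite addEE // delEE.
case: (boolP ((u == x) && (v == y))) => [/andP[/eqP -> /eqP ->]|_] /=; first by rewrite Gxy orbT.
case: (boolP ((u == y) && (v == x))) => [/andP[/eqP -> /eqP ->]|_] /=; first by rewrite grC Gxy orbT.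
by rewrite andbT orbF.
Qed.

Definition nedges G := #|[set p : V * V | G p.1 p.2]|.

Lemma nedges_del G x y : G x y -> (nedges (delE G x y) < nedges G)%N.
Proof.
move=> Gxy; apply: proper_card; apply/properP; split.
  by apply/subsetP => p; rewrite !inE delEE => /andP[].
by exists (x, y); rewrite in_set // delEE !eqxx andbF.
Qed.

(** Contraction shrinks the vertex set and deletion only the edge set, so the induction is
    lexicographic. *)
Lemma graph_ind (P : {set V} -> graph V -> Prop) :
  (forall (A : {set V}) G, (forall (A' : {set V}) G', (#|A'| < #|A|)%N -> P A' G') ->
    (forall G', (nedges G' < nedges G)%N -> P A G') -> P A G) ->
  forall A G, P A G.
Proof.
move=> step A; have [n] := ubnP #|A|; elim: n A => // n IHn A An G.
have [m] := ubnP (nedges G); elim: m G => // m IHm G Gm.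
apply: step => [A' G' A'A|G' G'G]; first by apply: IHn; apply: leq_trans A'A _.
by apply: IHm; apply: leq_trans G'G _.
Qed.

Lemma ind_ctr G A x y : x \in A -> y \in A ->
  ind (ctr G [set x; y] x) (A :\ y) =2 ind (ctr (ind G A) [set x; y] x) (A :\ y).
Proof.
move=> xA yA u v; rewrite !indE; apply/and3P/and3P => -[uA vA /ctrP[uv [a [b [ea eb ab]]]]];
  split=> //; apply/ctrP; split=> //; exists a, b; split=> //.
  have inA c w : retr [set x; y] x c = w -> w \in A :\ y -> c \in A.
    rewrite /retr !inE; case: ifP => [/orP[]/eqP -> //|_ ->]; by case/andP.
  by rewrite indE ab (inA _ _ ea uA) (inA _ _ eb vA).
by move: ab; rewrite indE => /and3P[].
Qed.

Lemma supp_ctr G A x y : x \in A -> x != y -> supp G A -> supp (ctr G [set x; y] x) (A :\ y).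
Proof.
move=> xA xy sG u v /ctrP[_ [a [b [<- _ ab]]]]; rewrite !inE /retr !inE.
have aA := sG _ _ ab; case: ifP => [_|/norP[_ ay]]; first by rewrite xy.
by rewrite ay.
Qed.

Lemma ind_id G A : supp G A -> ind G A =2 G.
Proof.
move=> sG u v; rewrite indE; apply/and3P/idP => [[]//|uv]; split=> //; first exact: sG uv.
by apply: (sG v u); rewrite grC.
Qed.

Lemma del_ctr_ind G A x y : x \in A -> y \in A -> G x y ->
  pr t (ind G A) = pr t (ind (delE G x y) A) - pr t (ind (ctr G [set x; y] x) (A :\ y)) / t.
Proof.
move=> xA yA Gxy; have xy := gr_neq Gxy.
rewrite (del_ctr (x := x) (y := y) (G := ind G A)); last by rewrite indE xA yA.
congr (_ - _ / _).
  by apply: eq_pr => u v; rewrite delEE !indE delEE !andbA.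
rewrite (eq_pr t (ind_ctr G xA yA)); apply: eq_pr => u v; rewrite ind_id //.
by apply: supp_ctr => //; exact: ind_supp.
Qed.
End DeletionContraction.

(** * The sign of the value of a 2-connected graph *)

Section MainInduction.
Variables (R : realType) (t : R) (V : finType) (K : graph V -> Prop) (h0 h12 : bool) (M s0 : R).
Hypotheses (t1 : 1 < t) (t2 : t < 2) (clK : minor_closed K).
Hypothesis KH0 : h0 -> forall G, K G -> ~ minor H0 (sg G).
Hypothesis KH12 : h12 -> forall G, K G -> ~ minor H1 (sg G) /\ ~ minor H2 (sg G).
Hypotheses (s0_gt0 : 0 < s0) (s0_lt : s0 + s0 < 2 - t)
  (Mslot : (if h12 then (t - 1) / (2 - t) * M else M * M) <= s0)
  (Mpath : if h0 then t - 1 <= M * (2 - t - s0) else s0 * s0 + (t - 1) <= M * (2 - t - s0 - s0))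
  (Mtop : (if h12 then (t - 1) / (2 - t) * (M * M) else M * M * M) <= t - 1).
Implicit Types (A C Z : {set V}) (x y z : V).

Let t0 : 0 < t. Proof. exact: lt_trans t1. Qed.
Let tn0 : t != 0. Proof. by rewrite gt_eqF. Qed.

Lemma pos_card2 (G : graph V) A : biconn G A -> #|A| = 2%N -> pos t G A.
Proof.
move=> tcA A2; have /eqP/cards2P[a [b [ab eA]]] := A2.
have Gab : G a b.
  have [_ /(_ set0)] := tcA; rewrite cards0 setD0 => /(_ isT)[_ h].
  apply: contraT => nab; have : cl G A [set a].
    apply/clP; rewrite eA; split; first by rewrite sub1set !inE eqxx.
    by move=> u v; rewrite !inE => /eqP -> /orP[//|/eqP ->]; rewrite (negPf nab).
  move=> /(h _ _) e; have /setP/(_ b) : [set a] = A.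
    by apply: e; apply/set0Pn; exists a; rewrite inE.
  by rewrite eA !inE eqxx orbT eq_sym (negPf ab).
rewrite /pos A2 sqrrN expr1n mul1r eA.
have [aA bA] : a \in [set a; b] /\ b \in [set a; b] by rewrite !inE !eqxx orbT.
by rewrite -(val_adj t aA bA Gab).1 (edge_val t1 Gab).1 divr_gt0 // subr_gt0.
Qed.

Lemma biconn_adj2 (G : graph V) x y z : x != y -> biconn G ([set z] +: x & y) ->
  x != z -> y != z -> G x y.
Proof.
move=> xy [_ /(_ [set z])]; rewrite cards1 => /(_ isT)[_ h] xz yz; apply: contraT => nxy.
have e : ([set z] +: x & y) :\: [set z] = [set x; y].
  apply/setP => u; rewrite !inE; case: (u =P z) => [->|_] //=.
  by rewrite eq_sym (negPf xz) eq_sym (negPf yz).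
have : [set x] = [set x; y].
  rewrite -[RHS]e; apply: h; rewrite ?e; first by apply/set0Pn; exists x; rewrite inE.
  apply/clP; split; first by rewrite sub1set !inE eqxx.
  by move=> u v; rewrite !inE => /eqP -> /orP[//|/eqP ->]; rewrite (negPf nxy).
by move=> /setP/(_ y); rewrite !inE eqxx orbT eq_sym (negPf xy).
Qed.

(** Deleting an edge of a triangle leaves a path, which is not 2-connected, so the general induction
    step fails here. The value is computed from the total and the ratio of that path. *)
Lemma pos_card3 (G : graph V) A : biconn G A -> #|A| = 3%N -> pos t G A.
Proof.
move=> tcA A3.
have [x xA] : exists x, x \in A by apply/set0Pn; rewrite -card_gt0 A3.
have := cardsD1 x A; rewrite xA A3 add1n => -[/esym/eqP/cards2P[y [z [yz e]]]].
have [yA zA] : y \in A :\ x /\ z \in A :\ x by rewrite e !inE !eqxx orbT.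
have {yA}[yx yA] : y != x /\ y \in A by move: yA; rewrite !inE => /andP[].
have {zA}[zx zA] : z != x /\ z \in A by move: zA; rewrite !inE => /andP[].
have eA : A = [set z] +: x & y.
  by rewrite -(setD1K xA) e; apply/setP => u; rewrite !inE; do 3 case: (u == _).
have [xy xz zy] : [/\ x != y, x != z & z != y] by rewrite !(eq_sym x) yx zx eq_sym yz.
have Gxy : G x y by apply: biconn_adj2 xy _ xz yz; rewrite -eA.
have Gxz : G x z.
  apply: (@biconn_adj2 _ _ _ y) => //; rewrite (_ : _ +: _ & _ = A) // eA.
  by apply/setP => u; rewrite !inE; do 3 case: (u == _).
have Gzy : G z y.
  apply: (@biconn_adj2 _ _ _ x) => //; rewrite 1?eq_sym // (_ : _ +: _ & _ = A) // eA.
  by apply/setP => u; rewrite !inE; do 3 case: (u == _).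
pose G' := delE G x y.
have nxy : ~~ G' x y by rewrite delEE !eqxx andbF.
have G'xz : G' x z by rewrite delEE Gxz eqxx /= (eq_sym z) (negPf yz) (negPf xy).
have G'zy : G' z y by rewrite delEE Gzy eqxx /= (negPf zx) (negPf zy).
have ap : apart t G' A x y = pr t (ind G A).
  apply: eq_pr => u v; rewrite addEE // !indE delEE.
  case: (boolP ((u == x) && (v == y))) => [/andP[/eqP -> /eqP ->]|_] /=.
    by rewrite xA yA Gxy orbT.
  case: (boolP ((u == y) && (v == x))) => [/andP[/eqP -> /eqP ->]|_] /=.
    by rewrite xA yA grC Gxy orbT.
  by rewrite andbT !orbF.
have er := single_val t1 xy nxy G'xz G'zy; rewrite -eA in er.
have pE : pr t (ind G' A) = (t - 1) / t * ((t - 1) / t).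
  have -> : A = [set x; z] :|: [set z; y].
    by rewrite eA; apply/setP => u; rewrite !inE; do 3 case: (u == _).
  rewrite (pr_cut tn0 (ind_union _) (@ind_supp _ _ _) (@ind_supp _ _ _) (z := z)).
  - have [xS zS] : x \in [set x; z] /\ z \in [set x; z] by rewrite !inE !eqxx orbT.
    have [zS' yS'] : z \in [set z; y] /\ y \in [set z; y] by rewrite !inE !eqxx orbT.
    rewrite -(val_adj t xS zS G'xz).1 -(val_adj t zS' yS' G'zy).1.
    by rewrite (edge_val t1 G'xz).1 (edge_val t1 G'zy).1.
  - move=> u v; rewrite !inE => /orP[]/eqP -> /orP[]/eqP ->; rewrite ?eqxx ?orbT //.
    by rewrite (negPf nxy).
  - apply/subsetP => u; rewrite !inE => /andP[/orP[]/eqP -> //].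
    by rewrite (negPf xz) (negPf xy).
move: pE er; rewrite (pr_val t G' A x y) /eratio ap /pos A3 => pE er.
have s1 : (-1 : R) ^+ 3 = -1 by rewrite exprS sqrrN expr1n mulr1.
rewrite s1 mulN1r oppr_gt0; move: (pr t _) (merged _ _ _ _ _) pE er => a g pE er.
have t20 : 2 - t != 0 by rewrite gt_eqF // subr_gt0.
have t10 : t - 1 != 0 by rewrite gt_eqF // subr_gt0.
have a0 : a != 0.
  apply/eqP => a0; move: er; rewrite a0 invr0 mulr0 => /esym/eqP.
  by rewrite oppr_eq0 mulf_eq0 invr_eq0 (negPf t20) (negPf t10).
have eg : g = - a / (2 - t).
  have -> : g = (t - 1) * g / a * a / (t - 1) by field; rewrite a0 t10.
  by rewrite er; field; rewrite t20 t10.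
have -> : a = - ((2 - t) * (t - 1) / (t * t)).
  have -> : a = (g + a) * (2 - t) / (1 - t).
    by rewrite eg; field; rewrite t20 -opprB oppr_eq0 t10.
  by rewrite pE; field; rewrite tn0 -opprB oppr_eq0 t10.
by rewrite oppr_lt0 divr_gt0 ?mulr_gt0 ?subr_gt0.
Qed.

(** If [z] became a cut vertex when [xy] is deleted, [xy] would be the only edge across the
    separation, and [{x, z}] or [{y, z}] would be a 2-vertex cut of the original graph. *)
Lemma del_biconn (G : graph V) A x y :
  (forall x y C, x != y -> x \in A -> y \in A -> C != set0 ->
     C != A :\: [set x; y] -> ~~ cl G (A :\: [set x; y]) C) ->
  biconn G A -> (3 < #|A|)%N -> x \in A -> y \in A -> G x y -> biconn (delE G x y) A.
Proof.
move=> no tcA A4 xA yA Gxy; have xy := gr_neq Gxy.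
have dconn z : z \in A -> conn (delE G x y) (A :\ z).
  move=> zA; have [_ /(_ [set z])] := tcA; rewrite cards1 => /(_ isT) cG.
  have mono : (z == x) || (z == y) -> conn (delE G x y) (A :\ z).
    move=> zxy; apply: conn_mono cG => u v; rewrite !inE => /andP[uz _] /andP[vz _] uv.
    rewrite delEE uv /=; apply/norP; split; apply/negP => /andP[/eqP e1 /eqP e2].
      by move: zxy uz vz; rewrite e1 e2 !(eq_sym z) => /orP[]->.
    by move: zxy uz vz; rewrite e1 e2 !(eq_sym z) => /orP[]->.
  have [zx|zx] := eqVneq z x; first by apply: mono; rewrite zx eqxx.
  have [zy|zy] := eqVneq z y; first by apply: mono; rewrite zy eqxx orbT.
  split; first by apply/set0Pn; exists x; rewrite !inE eq_sym zx.
  move=> C C0 cC; apply/eqP; apply: contraT => nC.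
  have key D : cl (delE G x y) (A :\ z) D -> x \in D -> y \notin D -> False.
    move=> cD xD yD; have [DA hD] := clP _ _ _ cD.
    have cross u v : u \in D -> v \in A -> v != z -> v \notin D -> G u v -> (u = x) /\ (v = y).
      move=> uD vA vz vD uv; have : ~~ delE G x y u v.
        by apply: contra vD => h; apply: (hD u) => //; rewrite !inE vz.
      rewrite delEE uv /= negbK => /orP[/andP[/eqP -> /eqP ->] //|/andP[/eqP e1 _]].
      by rewrite -e1 uD in yD.
    have cDx : cl G (A :\: [set x; z]) (D :\ x).
      apply/clP; split.
        apply/subsetP => u; rewrite !inE => /andP[ux uD].
        by have := subsetP DA u uD; rewrite !inE (negPf ux).
      move=> u v; rewrite !inE negb_or => /andP[ux uD] /andP[/andP[vx vz] vA] uv.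
      rewrite vx; apply: contraT => vD; have [e _] := cross u v uD vA vz vD uv.
      by rewrite e eqxx in ux.
    have cDy : cl G (A :\: [set y; z]) (A :\: [set y; z] :\: D).
      apply: cl_compl; apply/clP; split.
        apply/subsetP => u uD; have := subsetP DA u uD; rewrite !inE => /andP[uz ->].
        by rewrite andbT negb_or uz andbT; apply: contraNneq yD => <-.
      move=> u v uD; rewrite !inE negb_or => /andP[/andP[vy vz] vA] uv.
      apply: contraT => vD; have [_ e] := cross u v uD vA vz vD uv.
      by rewrite e eqxx in vy.
    (* If the side of [x] has a vertex besides [x], then [{x, z}] is a cut. If it is [x] alone, the
       other side has a vertex besides [y], because [A] has more than three vertices, and [{y, z}]
       is a cut. *)
    have [Dx|Dx] := eqVneq (D :\ x) set0; last first.
      have xz : x != z by rewrite eq_sym.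
      have nA : D :\ x != A :\: [set x; z].
        apply/eqP => /setP/(_ y).
        by rewrite !inE (negPf yD) andbF (eq_sym y x) (negPf xy) (eq_sym y z) (negPf zy) yA.
      by have := no x z _ xz xA zA Dx nA; rewrite cDx.
    have eD : D = [set x].
      by apply/setP => u; have /setP/(_ u) := Dx; rewrite !inE; case: eqVneq => [->|].
    have yz : y != z by rewrite eq_sym.
    have n0 : A :\: [set y; z] :\: D != set0.
      rewrite -card_gt0 eD.
      have : (#|A| <= #|A :\: [set y; z] :\: [set x]| + #|[set x; y; z]|)%N.
        rewrite -cardsUI; apply: leq_trans (leq_addr _ _).
        apply/subset_leq_card/subsetP => u uA; rewrite !inE uA.
        by case: (u == x); case: (u == y); case: (u == z).
      have : (#|[set x; y; z]| <= 3)%N.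
        by rewrite cardsU cards2 cards1; case: (x != y) => /=; clear; lia.
      by move: A4; clear; lia.
    have n1 : A :\: [set y; z] :\: D != A :\: [set y; z].
      by apply/eqP => /setP/(_ x); rewrite !inE xD xA (negPf xy) (eq_sym x z) (negPf zx).
    by have := no y z _ yz yA zA n0 n1; rewrite cDy.
  have [CA hC] := clP _ _ _ cC; have [_ hG] := cG.
  have nclG : ~~ cl G (A :\ z) C by apply: contra nC => /(hG C C0)->.
  have xz : x \in A :\ z by rewrite !inE eq_sym zx.
  have yz : y \in A :\ z by rewrite !inE eq_sym zy.
  have : (x \in C) (+) (y \in C).
    apply: contraR nclG => ne.
    have e : (x \in C) = (y \in C) by move: ne; case: (x \in C); case: (y \in C).
    apply/clP; split=> // u v uC vA uv.
    case: (boolP (delE G x y u v)) => [|]; first exact: hC.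
    rewrite delEE uv /= negbK => /orP[]/andP[/eqP e1 /eqP e2].
      by rewrite e2 -e -e1.
    by rewrite e2 e -e1.
  case: (boolP (x \in C)) => xC /= yC; first by case: (key C cC xC yC).
  case: (key _ (cl_compl cC)); first by rewrite in_setD xC.
  by rewrite in_setD yC.
have whole : conn (delE G x y) A.
  have [w] : exists w, w \in A :\: [set x; y].
    apply/set0Pn; rewrite -card_gt0 cardsD; have := subset_leq_card (subsetIr A [set x; y]).
    by rewrite cards2; case: (x != y) => /=; move: A4; clear; lia.
  rewrite !inE negb_or => /andP[/andP[wx wy] wA].
  have [s sA ws] : exists2 s, s \in A & G w s.
    have [_ /(_ set0)] := tcA; rewrite cards0 setD0 => /(_ isT)[_ h].
    apply: contrapT => n; have : [set w] = A.
      apply: h; first by apply/set0Pn; exists w; rewrite inE.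
      apply/clP; split; first by rewrite sub1set.
      by move=> u v; rewrite inE => /eqP -> vA wv; case: n; exists v.
    by move=> e; move: A4; rewrite -e cards1.
  rewrite -(setD1K wA).
  apply: (connU (conn1 _ w) (dconn w wA) (_ : w \in [set w]) (_ : s \in _)).
  - by rewrite inE.
  - by rewrite !inE sA andbT eq_sym (gr_neq ws).
  - by rewrite delEE ws (negPf wx) (negPf wy).
split; first by apply: leq_trans A4.
move=> Z Z1; have [->|Z0] := eqVneq Z set0; first by rewrite setD0.
have /cards1P[z ->] : #|Z| == 1%N by rewrite eqn_leq Z1 card_gt0.
case: (boolP (z \in A)) => zA; first exact: dconn.
suff -> : A :\ z = A by [].
by apply/setP => u; rewrite !inE; case: (u =P z) => [->|] //; rewrite (negPf zA).
Qed.

Theorem biconn_pos A (G : graph V) : K G -> biconn G A -> pos t G A.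
Proof.
move: A G; apply: graph_ind => A G IHA IHE KG tcA.
have IH (A' : {set V}) (G' : graph V) : (#|A'| < #|A|)%N -> K G' -> biconn G' A' -> pos t G' A'.
  exact: IHA.
have [A1 _] := tcA.
have [A2|A2] := eqVneq #|A| 2%N; first exact: pos_card2.
have [A3|A3] := eqVneq #|A| 3%N; first exact: pos_card3.
have A4 : (3 < #|A|)%N by move: A1 A2 A3; clear; case: #|A| => [|[|[|[|]]]].
apply: contrapT => np.
have no x y C : x != y -> x \in A -> y \in A -> C != set0 ->
     C != A :\: [set x; y] -> ~~ cl G (A :\: [set x; y]) C.
  move=> xy xA yA C0 nC; apply/negP => cC.
  have [U1 [U2 [U3 c]]] := cut3_exists t1 t2 clK KG tcA IH xy xA yA np C0 nC cC.
  apply: (no_cut t1 t2 clK KG tcA IH np (h0 := h0) (h12 := h12) _ _ s0_gt0 s0_lt Mslot Mpath Mtop c).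
    move=> /KH12/(_ G KG)[n1 n2] x' y' W1 W2 W3 c'.
    exact: (no_H12_single t1 t2 clK KG tcA IH np n1 n2 c').
  move=> /KH0/(_ G KG) n0 x' y' W1 W2 W3 z D1 D2 c' sp.
  exact: (no_H0_split t1 t2 clK KG tcA IH np n0 c' sp).
have [x xA] : exists x, x \in A by apply/set0Pn; rewrite -card_gt0 (ltn_trans _ A4).
have [y yA xy] : exists2 y, y \in A & G x y.
  have [_ /(_ set0)] := tcA; rewrite cards0 setD0 => /(_ isT)[_ h].
  apply: contrapT => n; have : [set x] = A.
    apply: h; first by apply/set0Pn; exists x; rewrite inE.
    apply/clP; split; first by rewrite sub1set.
    by move=> u v; rewrite inE => /eqP -> vA xv; case: n; exists v.
  by move=> e; move: A4; rewrite -e cards1.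
have xny := gr_neq xy.
have p1 : pos t (delE G x y) A.
  apply: IHE; [exact: nedges_del| |exact: del_biconn].
  by apply: (clK.1 G) => // u v; rewrite delEE => /andP[].
have sm : (#|A :\ y| < #|A|)%N by rewrite [X in (_ < X)%N](cardsD1 y) yA.
have p2 : pos t (ctr G [set x; y] x) (A :\ y).
  apply: IHA => //.
    apply: clK.2 => //; rewrite ?inE ?eqxx //.
    by apply: (connU (conn1 G x) (conn1 G y) _ _ xy); rewrite inE.
  have cW : cl G (A :\: [set x; y]) (A :\: [set x; y]) by apply/clP.
  (* In the absence of 2-vertex cuts the rest is a single component, which makes the contraction of
     [xy] 2-connected. *)
  have kW : conn G (A :\: [set x; y]).
    split.
      rewrite -card_gt0 cardsD; have := subset_leq_card (subsetIr A [set x; y]).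
      by rewrite cards2 xny; move: A4; clear; lia.
    move=> C C0 cC; apply/eqP; apply: contraT => nC.
    by have := no x y C xny xA yA C0 nC; rewrite cC.
  have := biconn_ctr tcA xny xA yA cW kW.
  have -> : x |: A :\: [set x; y] = A :\ y.
    apply/setP => u; rewrite !inE; case: (u =P x) => [->|_] //=.
    by rewrite xA xny.
  apply: biconn_mono => u v _ _ /ctrP[uv [a [b [ea eb ab]]]]; apply/ctrP; split=> //.
  by exists a, b; split=> //; move: ab; rewrite indE => /and3P[].
apply: np; move: p1 p2; rewrite /pos (del_ctr_ind tn0 xA yA xy).
have -> : #|A| = #|A :\ y|.+1 by rewrite (cardsD1 y) yA.
rewrite exprS mulN1r mulrBr => p1 p2; apply: addr_gt0 => //.
by rewrite mulNr opprK mulrA divr_gt0.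
Qed.
End MainInduction.

(** * Reduction to 2-connected graphs; the ranges t < 0 and 0 < t < 1 *)

Section NonZero.
Variables (R : realType) (t : R) (V : finType).
Hypothesis t0 : t != 0.
Implicit Types (G : graph V) (A C Z S : {set V}) (x y : V).

Lemma pr_ind_edgeless G A : {in A &, forall u v, ~~ G u v} -> pr t (ind G A) = 1.
Proof.
move=> h; apply: pr_edgeless => // u v; rewrite indE.
by apply/negP => /and3P[uA vA]; apply/negP/h.
Qed.

Lemma pr_glue G S1 S2 : (forall u v, u \in S1 -> v \in S2 -> G u v -> (u \in S2) || (v \in S1)) ->
  forall z, S1 :&: S2 \subset [set z] ->
  pr t (ind G (S1 :|: S2)) = pr t (ind G S1) * pr t (ind G S2).
Proof. by move=> h z s12; apply: (pr_cut t0 (ind_union h) (@ind_supp _ _ _) (@ind_supp _ _ _) s12). Qed.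

Lemma not_conn G B : B != set0 -> ~ conn G B ->
  exists C, [/\ C != set0, C != B & cl G B C].
Proof.
move=> B0 nc; apply: contrapT => n; apply: nc; split=> // C C0 cC.
by apply/eqP; apply: contraT => nC; case: n; exists C.
Qed.

(** A set of at least two vertices that is not 2-connected is glued from two smaller sets along at
    most one vertex, where [pr] is multiplicative. *)
Lemma pr_nz G : (forall A, biconn G A -> pr t (ind G A) != 0) -> forall A, pr t (ind G A) != 0.
Proof.
move=> htc A; have [n] := ubnP #|A|; elim: n A => // n IHn A An.
have [A1|A1] := leqP #|A| 1.
  rewrite pr_ind_edgeless ?oner_neq0 // => u v uA vA; apply/negP => /gr_neq uv.
  exact: small_set uv A1 uA vA.
have [T|nT] := pselect (biconn G A); first exact: htc.
have [Z [Z1 nZ]] : exists Z, (#|Z| <= 1)%N /\ ~ conn G (A :\: Z).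
  by apply: contrapT => n1; apply: nT; split=> // Z Z1; apply: contrapT => n2; apply: n1; exists Z.
have [z Zz] : exists z, Z \subset [set z].
  move: Z1; rewrite leq_eqVlt => /orP[/cards1P[z ->]|]; first by exists z.
  rewrite ltnS leqn0 cards_eq0 => /eqP ->.
  have [z _] : exists z, z \in A by apply/set0Pn; rewrite -card_gt0 (ltn_trans _ A1).
  by exists z; exact: sub0set.
have B0 : A :\: Z != set0.
  by rewrite -card_gt0 cardsD; have := subset_leq_card (subsetIr A Z); move: A1 Z1; clear; lia.
have [C [C0 nC cC]] := not_conn B0 nZ; have [CB hC] := clP _ _ _ cC.
have D0 := rest_nonempty cC nC; set D := _ :\: C in D0.
pose Y := Z :&: A; pose S1 := C :|: Y; pose S2 := D :|: Y.
have CA : C \subset A by apply: subset_trans CB (subsetDl _ _).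
have eA : A = S1 :|: S2.
  apply/setP => u; rewrite /S1 /S2 /D /Y !inE; case: (boolP (u \in C)) => [/(subsetP CA)->//|_] /=.
  by case: (u \in Z); case: (u \in A).
have CZ u : u \in C -> u \notin Z by move=> /(subsetP CB); rewrite inE => /andP[].
have l1 : (#|S1| < #|A|)%N.
  apply: proper_card; rewrite eA; apply/properP; split; first exact: subsetUl.
  case/set0Pn: D0 => d; rewrite /D !inE => /and3P[dC dZ dA].
  by exists d; rewrite /S1 /S2 /D /Y !inE ?dC ?dZ ?dA //= ?(negPf dZ) ?(negPf dC).
have l2 : (#|S2| < #|A|)%N.
  apply: proper_card; rewrite eA; apply/properP; split; first exact: subsetUr.
  case/set0Pn: C0 => d dC; exists d; first by rewrite /S1 !inE dC.
  by rewrite /S2 /D /Y !inE dC (negPf (CZ d dC)).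
have h u v : u \in S1 -> v \in S2 -> G u v -> (u \in S2) || (v \in S1).
  rewrite /S1 /S2 !(in_setU _ _ Y) => /orP[uC|->]; rewrite ?orbT //.
  case/orP => [vD uv|->]; rewrite ?orbT //.
  have vC : v \in C by apply: (hC u) => //; move: vD; rewrite /D in_setD => /andP[].
  by rewrite vC orbT.
have s12 : S1 :&: S2 \subset [set z].
  apply: subset_trans Zz; apply/subsetP => u.
  by rewrite /S1 /S2 /D /Y !inE; case: (u \in C); case: (u \in Z); case: (u \in A).
rewrite eA (pr_glue h s12) mulf_neq0 //; apply: IHn.
  by apply: leq_trans l1 _; rewrite -ltnS.
by apply: leq_trans l2 _; rewrite -ltnS.
Qed.

(** In deletion and contraction the contracted term is divided by the negative [t] and then
    subtracted, so both contributions are positive. *)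
Lemma pr_neg A G : t < 0 -> 0 < pr t (ind G A).
Proof.
move=> tn; move: A G; apply: graph_ind => A G IHA IHE.
have [[x [y [xA yA xy]]]|n] := pselect (exists x y, [/\ x \in A, y \in A & G x y]); last first.
  by rewrite pr_ind_edgeless ?ltr01 // => u v uA vA; apply/negP => uv; apply: n; exists u, v.
rewrite (del_ctr_ind t0 xA yA xy) subr_gt0; apply: (lt_trans (y := 0)); last first.
  by apply: IHE; exact: nedges_del.
rewrite nmulr_llt0 ?invr_lt0 //; apply: IHA.
by rewrite [X in (_ < X)%N](cardsD1 y) yA.
Qed.

Lemma conn_ctr G A x y : x \in A -> x != y -> conn G A -> conn (ctr G [set x; y] x) (A :\ y).
Proof.
move=> xA xy [_ hA]; split; first by apply/set0Pn; exists x; rewrite !inE xy.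
move=> C C0 /clP[CA hC]; pose rho := retr [set x; y] x.
have ry u : u != y -> rho u = u.
  by rewrite /rho /retr !inE => /negPf->; rewrite orbF; case: eqP => [->|].
have rA u : u \in A -> rho u \in A :\ y.
  move=> uA; have [->|uy] := eqVneq u y; last by rewrite ry // !inE uy.
  by rewrite /rho /retr !inE eqxx orbT xy.
have e : [set u in A | rho u \in C] = A.
  apply: hA.
    case/set0Pn: C0 => c cC; have := subsetP CA c cC; rewrite !inE => /andP[cy cA].
    by apply/set0Pn; exists c; rewrite inE cA ry.
  apply/clP; split; first by apply/subsetP => u; rewrite inE => /andP[].
  move=> u v; rewrite !inE => /andP[uA uC] vA uv; rewrite vA /=.
  have [<-//|ruv] := eqVneq (rho u) (rho v).
  by apply: (hC (rho u)) => //; [exact: rA|exact: ctr_edge].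
apply/eqP; rewrite eqEsubset CA; apply/subsetP => u; rewrite !inE => /andP[uy uA].
by have := uA; rewrite -{1}e inE ry // => /andP[].
Qed.

Lemma pr_edge G x y : G x y -> pr t (ind G [set x; y]) = 1 - 1 / t.
Proof.
move=> xy; have [xS yS] : x \in [set x; y] /\ y \in [set x; y] by rewrite !inE !eqxx orbT.
rewrite (del_ctr_ind t0 xS yS xy) !pr_ind_edgeless // => u v; rewrite !inE.
  by move=> /andP[uy +] /andP[vy +]; rewrite (negPf uy) (negPf vy) !orbF => /eqP -> /eqP ->; rewrite grI.
by move=> /orP[]/eqP -> /orP[]/eqP ->; rewrite delEE ?grI // !eqxx ?orbT ?andbF.
Qed.

(** If the deletion of an edge stays connected, both terms of deletion and contraction have the same
    sign. Otherwise the edge is a bridge, and the value is the product over its two sides times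
    [1 - 1 / t], which is negative. *)
Lemma pr_conn A G : 0 < t -> t < 1 -> conn G A -> 0 < (-1) ^+ #|A|.-1 * pr t (ind G A).
Proof.
move=> tp t1; move: A G; apply: graph_ind => A G IHA IHE cA.
have [x xA] : exists x, x \in A by apply/set0Pn; exact: cA.1.
have [[y yA xy]|n] := pselect (exists2 y, y \in A & G x y); last first.
  have eA : [set x] = A.
    apply: cA.2; first by apply/set0Pn; exists x; rewrite inE.
    apply/clP; split; first by rewrite sub1set.
    by move=> u v; rewrite inE => /eqP -> vA xv; case: n; exists v.
  rewrite -eA cards1 mul1r pr_ind_edgeless ?ltr01 // => u v.
  by rewrite !inE => /eqP -> /eqP ->; rewrite grI.
have xny := gr_neq xy.
have cardA : #|A| = #|A :\ y|.+1 by rewrite (cardsD1 y) yA.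
have [cD|nD] := pselect (conn (delE G x y) A).
  have p1 := IHE _ (nedges_del xy) cD.
  have p2 : 0 < (-1) ^+ #|A :\ y|.-1 * pr t (ind (ctr G [set x; y] x) (A :\ y)).
    by apply: IHA; [rewrite cardA|exact: conn_ctr].
  have A0 : (0 < #|A :\ y|)%N by rewrite card_gt0; apply/set0Pn; exists x; rewrite !inE xny.
  rewrite (del_ctr_ind t0 xA yA xy); move: p1 p2; rewrite cardA /=.
  rewrite -{1 3}(prednK A0) exprS mulN1r !mulNr mulrBr opprB => p1 p2.
  by rewrite addrC; apply: addr_gt0 => //; rewrite mulrA divr_gt0.
have [C [C0 nC cC]] := not_conn cA.1 nD.
have [D [clD xD yD]] : exists D, [/\ cl (delE G x y) A D, x \in D & y \notin D].
  have e : (x \in C) (+) (y \in C).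
    apply: contraR nC => ne; have e : (x \in C) = (y \in C).
      by move: ne; case: (x \in C); case: (y \in C).
    apply/eqP/cA.2 => //; have [CA hC] := clP _ _ _ cC; apply/clP; split=> // u v uC vA uv.
    case: (boolP (delE G x y u v)) => [|]; first exact: hC.
    rewrite delEE uv /= negbK => /orP[]/andP[/eqP e1 /eqP e2].
      by rewrite e2 -e -e1.
    by rewrite e2 e -e1.
  case: (boolP (x \in C)) e => xC /= yC; first by exists C.
  by exists (A :\: C); rewrite !in_setD xC xA yC; split=> //; exact: cl_compl.
have [DA hD] := clP _ _ _ clD; pose E := A :\: D.
have cross u v : u \in D -> v \in E -> G u v -> u = x /\ v = y.
  rewrite inE => uD /andP[vD vA] uv; have : ~~ delE G x y u v by apply: contra vD; exact: hD.
  rewrite delEE uv /= negbK => /orP[/andP[/eqP -> /eqP ->] //|/andP[/eqP e1 _]].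
  by rewrite -e1 uD in yD.
have xE : x \notin E by rewrite inE xD.
have yE : y \in E by rewrite inE yD.
(* A closed part of [S] that avoids the end [a] of the bridge would be closed in all of [A]. *)
have side S a b : S \subset A -> b \in A -> b \notin S -> a \in S ->
    (forall u v, u \in S -> v \in A -> v \notin S -> G u v -> u = a) -> conn G S.
  move=> SA bA bS aS hS; have key T : T != set0 -> cl G S T -> a \in T.
    move=> T0 /clP[TS hT]; apply: contraT => aT.
    have e : T = A.
      apply: cA.2 => //; apply/clP; split; first exact: subset_trans SA.
      move=> u v uT vA uv; have uS := subsetP TS u uT.
      case: (boolP (v \in S)) => vS; first exact: (hT u).
      by rewrite -(hS u v uS vA vS uv) uT in aT.
    by have := subsetP TS b; rewrite e (negPf bS) => /(_ bA).
  split; first by apply/set0Pn; exists a.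
  move=> T T0 cT; apply/eqP; apply: contraT => nT.
  by have := key _ (rest_nonempty cT nT) (cl_compl cT); rewrite inE (key T T0 cT).
have cDG : conn G D.
  apply: (side D x y) => // u v uD vA vD uv; have vE : v \in E by rewrite inE vD.
  by have [] := cross u v uD vE uv.
have cEG : conn G E.
  apply: (side E y x) => //; first exact: subsetDl.
  move=> u v uE vA; rewrite inE vA andbT negbK => vD uv.
  by have [] := cross v u vD uE; rewrite // grC.
have cardDE : #|A| = (#|D| + #|E|)%N by rewrite -[LHS](cardsID D) (setIidPr DA).
have D0 : (0 < #|D|)%N by rewrite card_gt0 cDG.1.
have E0 : (0 < #|E|)%N by rewrite card_gt0 cEG.1.
have p1 := IHA D G _ cDG; have {}p1 := p1 (ltac:(by rewrite cardDE -addn1 leq_add2l)).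
have p2 := IHA E G _ cEG; have {}p2 := p2 (ltac:(by rewrite cardDE -add1n leq_add2r)).
have eA : A = E :|: (D :|: [set x; y]).
  apply/setP => u; rewrite !inE.
  case: (u =P x) => [->|_]; first by rewrite xA xD.
  case: (u =P y) => [->|_]; first by rewrite yA (negPf yD).
  case: (boolP (u \in D)) => [/(subsetP DA)->|_] //=.
  by rewrite orbF.
have -> : pr t (ind G A) = pr t (ind G E) * (pr t (ind G D) * (1 - 1 / t)).
  rewrite eA (@pr_glue G E (D :|: [set x; y]) _ y).
  - rewrite (@pr_glue G D [set x; y] _ x) ?pr_edge //.
      move=> u v uD; rewrite !inE => /orP[]/eqP ->; first by rewrite xD orbT.
      by move=> uy; have [->] := cross u y uD yE uy; rewrite eqxx.
    apply/subsetP => u; rewrite !inE => /andP[uD /orP[//|/eqP uy]].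
    by rewrite uy (negPf yD) in uD.
  - move=> u v uE; rewrite !inE => /orP[vD|/orP[]/eqP ->] uv.
    + by have [] := cross v u vD uE; rewrite 1?grC // => _ ->; rewrite eqxx !orbT.
    + have [] := cross x u xD uE; rewrite 1?grC // => _ ->; by rewrite eqxx !orbT.
    + by rewrite yA yD orbT.
  - apply/subsetP => u; rewrite !inE => /andP[/andP[uD uA]].
    by rewrite (negPf uD) /= => /orP[/eqP ux|//]; rewrite ux xD in uD.
rewrite cardDE -(prednK D0) -(prednK E0) addSn addnS /= exprS exprD.
have -> : forall a b c d e : R, -1 * (a * b) * (c * (d * e)) = (a * d) * (b * c) * (- e).
  by move=> *; ring.
apply: mulr_gt0; first exact: mulr_gt0 p1 p2.
by rewrite oppr_gt0 subr_lt0 ltr_pdivlMr // mul1r.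
Qed.
End NonZero.

(** * The thresholds as conditions on the bounds *)

Section LowerBound.
Variables (R : realType) (h0 h12 : bool).

Definition avoids (G : sgraph) : Prop :=
  (h0 -> ~ minor H0 G) /\ (h12 -> ~ minor H1 G /\ ~ minor H2 G).

Lemma H0_noniso (h : H0) : exists h', adj h h'.
Proof.
pose a : H0 := inl (inl (inr true)); pose b : H0 := inl (inr true).
pose i0 : H0 := inl (inl (inl (@Ordinal 3 0 isT))); pose i1 : H0 := inl (inl (inl (@Ordinal 3 1 isT))).
case: h => [[[[[|[|[|?]]] ?]|c]|c]|c] //; first by exists a.
- by exists a.
- by exists b.
- by exists i0.
- by exists i1.
- by exists i0.
Qed.

Lemma H1_noniso (h : H1) : exists h', adj h h'.
Proof.
pose y : H1 := inl (inl (inl (inl (@Ordinal 2 1 isT)))).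
pose x : H1 := inl (inl (inl (inl (@Ordinal 2 0 isT)))).
pose u : H1 := inl (inl (inl (inr (@Ordinal 3 0 isT)))).
case: h => [[[[[[|[|?]] ?]|[[|[|[|?]]] ?]]|c]|c]|c] //.
- by exists (inr true).
- by exists u.
- by exists y.
- by exists y.
- by exists y.
- by exists x.
- by exists x.
- by exists x.
Qed.

Lemma H2_noniso (h : H2) : exists h', adj h h'.
Proof.
pose y : H2 := inl (inl (inl (inl (@Ordinal 2 1 isT)))).
pose x : H2 := inl (inl (inl (inl (@Ordinal 2 0 isT)))).
pose u : H2 := inl (inl (inl (inr (@Ordinal 3 0 isT)))).
case: h => [[[[[[|[|?]] ?]|[[|[|[|?]]] ?]]|c]|c]|c] //.
- by exists (inl (inr true)).
- by exists u.
- by exists y.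
- by exists y.
- by exists x.
- by exists x.
- by exists x.
- by exists y.
Qed.

Lemma avoids_closed (V : finType) : minor_closed (fun G : graph V => avoids (sg G)).
Proof.
split=> [G G' le [a b]|G D z cD zD [a b]]; split.
- by move=> /a n m; apply: n; apply: minor_sub m.
- by move=> /b[n1 n2]; split=> m; [apply: n1|apply: n2]; apply: minor_sub m.
- by move=> /a n m; apply: n; apply: minor_ctr m => //; exact: H0_noniso.
- by move=> /b[n1 n2]; split=> m; [apply: n1|apply: n2]; apply: minor_ctr m => //;
    [exact: H1_noniso|exact: H2_noniso].
Qed.

(* With p = t - 1 these inequalities say that t lies below 5/4, below the root of the
   cubic, or below the root of the quartic. *)
Definition admissible (p : R) : Prop :=
  [/\ 0 < p, p < 1, h0 || h12, ~~ h12 -> 4 * p < 1 &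
    h12 -> if h0 then 4 * p ^+ 2 < (1 - p) ^+ 3 else 4 * p ^+ 2 * (2 - p) < (1 - p) ^+ 4].

(* If H1 and H2 are excluded, some component of each cut is a single vertex, of ratio
   - p / (1 - p), and M = 2 p / (1 - p) works exactly up to the threshold;
   otherwise H0 is excluded and M = 2 p does. *)
Lemma admissible_bounds p : admissible p -> exists M s0 : R,
  [/\ 0 < s0, s0 + s0 < 1 - p,
   (if h12 then p / (1 - p) * M else M * M) <= s0,
   (if h0 then p <= M * (1 - p - s0) else s0 * s0 + p <= M * (1 - p - s0 - s0)) &
   (if h12 then p / (1 - p) * (M * M) else M * M * M) <= p].
Proof.
case=> p0 p1; case: h12 => [_ _ /(_ isT) c|]; last first.
  case: h0 => // _ /(_ isT) c _; exists (2 * p), (4 * p ^+ 2).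
  have p2 : p ^+ 2 < p / 4 by rewrite expr2; nra.
  have p20 : 0 < p ^+ 2 by rewrite exprn_gt0.
  split.
  - by rewrite mulr_gt0.
  - by lra.
  - by rewrite expr2; lra.
  - by nra.
  - by rewrite (_ : 2 * p * (2 * p) * (2 * p) = 8 * p ^+ 2 * p); [nra|ring].
have q0 : 0 < 1 - p by rewrite subr_gt0.
have qn : 1 - p != 0 by rewrite gt_eqF.
exists (2 * p / (1 - p)), (2 * p ^+ 2 / (1 - p) ^+ 2).
(* The quartic condition is the stronger one: [(1 - p)^4 < (1 - p)^3 (2 - p)]. *)
have c' : 4 * p ^+ 2 < (1 - p) ^+ 3.
  case: h0 c => // c; rewrite -(ltr_pM2r (_ : 0 < 2 - p)); last by lra.
  by apply: lt_trans c _; rewrite exprSr ltr_pM2l ?exprn_gt0 //; lra.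
have q2 : 0 < (1 - p) ^+ 2 by rewrite exprn_gt0.
have s0 : 0 < 2 * p ^+ 2 / (1 - p) ^+ 2 by rewrite divr_gt0 // mulr_gt0 // exprn_gt0.
split=> //.
- rewrite -mulrDl ltr_pdivrMr // -exprS; apply: le_lt_trans c'; rewrite le_eqVlt; apply/orP; left.
  by apply/eqP; ring.
- by rewrite le_eqVlt; apply/orP; left; apply/eqP; field.
- case: h0 c => c.
    have -> : 2 * p / (1 - p) * (1 - p - 2 * p ^+ 2 / (1 - p) ^+ 2) =
      p + p * ((1 - p) ^+ 3 - 4 * p ^+ 2) / (1 - p) ^+ 3 by field.
    by rewrite lerDl divr_ge0 ?mulr_ge0 ?exprn_ge0 ?ltW ?subr_gt0.
  rewrite -subr_ge0.
  have -> : 2 * p / (1 - p) * (1 - p - 2 * p ^+ 2 / (1 - p) ^+ 2 - 2 * p ^+ 2 / (1 - p) ^+ 2) -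
     (2 * p ^+ 2 / (1 - p) ^+ 2 * (2 * p ^+ 2 / (1 - p) ^+ 2) + p) =
     p * ((1 - p) ^+ 4 - 4 * p ^+ 2 * (2 - p)) / (1 - p) ^+ 4 by field.
  by rewrite divr_ge0 ?mulr_ge0 ?exprn_ge0 ?ltW ?subr_gt0.
- have -> : p / (1 - p) * (2 * p / (1 - p) * (2 * p / (1 - p))) = p * (4 * p ^+ 2 / (1 - p) ^+ 3) by field.
  by rewrite -[leRHS]mulr1 ler_pM2l // ler_pdivrMr ?exprn_gt0 // mul1r ltW.
Qed.

Theorem no_small_root (G : sgraph) (t : R) : avoids G ->
  t != 0 -> t != 1 -> (1 < t -> admissible (t - 1)) -> t < 2 -> ~~ root (chromatic_poly G R) t.
Proof.
move=> aG t0 tn1 adm t2; case: G aG => V e es ei aG.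
pose G : graph V := Grel es ei; apply/negP => /rootP r.
have : pr t (ind G [set: V]) != 0.
  apply: pr_nz => // A tcA; case: (ltrgtP t 1) tn1 => // t1 _.
    case: (ltrgtP t 0) t0 => // ts _; first by rewrite gt_eqF // pr_neg // lt_eqF.
    have tA : conn G A by have [_ /(_ set0)] := tcA; rewrite cards0 setD0; exact.
    have t0' : t != 0 by rewrite gt_eqF.
    have := pr_conn t0' ts t1 tA.
    by apply: contraTneq => ->; rewrite mulr0 ltxx.
  have [M [s0 [m1 m2 m3 m4 m5]]] := admissible_bounds (adm t1).
  have e1 : 1 - (t - 1) = 2 - t by ring.
  rewrite !e1 in m2 m3 m4 m5.
  have : pos t G A.
    apply: (@biconn_pos R t V _ h0 h12 M s0 t1 t2 (avoids_closed V)) => //.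
    - by move=> h G' [/(_ h)].
    - by move=> h G' [_ /(_ h)].
  by rewrite /pos; apply: contraTneq => ->; rewrite mulr0 ltxx.
rewrite (eq_pr t (G' := G)); last by apply: ind_id => u v _; rewrite inE.
rewrite prE; move: r; rewrite /G /sg /= => ->.
by rewrite mul0r eqxx.
Qed.
End LowerBound.

(** * Iterated double subdivisions *)

(* GL is an edge uv; GN l1 r1 l2 r2 replaces it by two paths u - z1 - v and u - z2 - v
   whose edges are replaced according to l1, r1 and l2, r2.  The new vertices of
   tadj T u v b are numbered b, ..., b + gsize T - 1 in such a way that z1 and z2
   follow the vertices of l1 and l2. *)
Inductive dstree := GL | GN of dstree & dstree & dstree & dstree.

Fixpoint gsize (T : dstree) : nat :=
  if T is GN l1 r1 l2 r2 then (gsize l1 + gsize r1 + gsize l2 + gsize r2 + 2)%N else 0%N.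

Fixpoint tadj (T : dstree) (u v b : nat) : rel nat := fun i j =>
  match T with
  | GL => (i == u) && (j == v)
  | GN l1 r1 l2 r2 =>
      let z1 := (b + gsize l1)%N in let b2 := (z1.+1 + gsize r1)%N in let z2 := (b2 + gsize l2)%N in
      (tadj l1 u z1 b i j || tadj r1 z1 v z1.+1 i j) ||
      (tadj l2 u z2 b2 i j || tadj r2 z2 v z2.+1 i j)
  end.

Lemma tadj_supp T u v b i j : tadj T u v b i j ->
  [|| i == u, i == v | (b <= i < b + gsize T)%N] && [|| j == u, j == v | (b <= j < b + gsize T)%N].
Proof.
elim: T u v b => [|l1 I1 r1 I2 l2 I3 r2 I4] u v b /=.
  by move=> /andP[/eqP -> /eqP ->]; rewrite !eqxx orbT.
by case/orP => [/orP[/I1|/I2]|/orP[/I3|/I4]]; lia.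
Qed.

Section TreePoly.
Variable R : realType.

(* For a graph with terminals x, y the pair (alpha, gamma) represents apart and merged
   up to the factors of has_polys; gamma / alpha is eratio. *)
Definition path_polys (p q : {poly R} * {poly R}) : {poly R} * {poly R} :=
  (p.2 * q.1 + p.1 * q.2 + ('X - 2%:P) * (p.1 * q.1),
   p.2 * q.2 + ('X - 1) * (p.1 * q.1)).

Fixpoint tree_polys (T : dstree) : {poly R} * {poly R} :=
  if T is GN l1 r1 l2 r2 then
    let p := path_polys (tree_polys l1) (tree_polys r1) in
    let q := path_polys (tree_polys l2) (tree_polys r2) in
    (p.1 * q.1, p.2 * q.2)
  else (1, 0).

Section Eval.
Variables (V : finType) (t : R).
Hypotheses (t0 : t != 0) (tn1 : t != 1).
Implicit Types (G : graph V) (S : {set V}).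

(** The exponent [m] counts the vertices other than the two terminals. With these powers of [t] and
    the factor [(t - 1) / t] split off, the series and parallel rules become polynomial. *)
Definition has_polys (p : {poly R} * {poly R}) (m : nat) G x y : Prop :=
  pne t G x y = (t - 1) / t * (p.1.[t] / t ^+ m) /\ peq t G x y = p.2.[t] / t ^+ m.+1.

Lemma has_polys_path p q m n G G1 G2 S1 S2 x y z : x != z -> y != z ->
  x \in S1 -> y \in S2 -> edge_union G G1 G2 -> supp G1 S1 -> supp G2 S2 -> S1 :&: S2 \subset [set z] ->
  has_polys p m G1 x z -> has_polys q n G2 z y ->
  has_polys (path_polys p q) (m + n).+1 G x y.
Proof.
move=> xz yz xS yS U s1 s2 s12 [a1 g1] [a2 g2].
have gE := peq_series t0 tn1 xz yz xS yS U s1 s2 s12.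
have pE := pr_cut t0 U s1 s2 s12.
have e1 : pr t G1 = peq t G1 x z + pne t G1 x z by rewrite /peq subrK.
have e2 : pr t G2 = peq t G2 z y + pne t G2 z y by rewrite /peq subrK.
have t10 : t - 1 != 0 by rewrite subr_eq0.
have tm := expf_neq0 m t0; have tn := expf_neq0 n t0.
have gE' : peq t G x y = (path_polys p q).2.[t] / t ^+ (m + n).+2.
  rewrite gE a1 a2 g1 g2 /path_polys !hornerE /= !exprS exprD.
  by move: tm tn; move: (t ^+ m) (t ^+ n) => x1 x2 n1 n2; field; rewrite t0 n1 n2 t10.
split=> //; have -> : pne t G x y = pr t G - peq t G x y by rewrite /peq; ring.
rewrite gE pE e1 e2 a1 a2 g1 g2 /path_polys !hornerE /= !exprS exprD.
by move: tm tn; move: (t ^+ m) (t ^+ n) => x1 x2 n1 n2; field; rewrite t0 n1 n2 t10.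
Qed.

Lemma has_polys_par p q m n G G1 G2 S1 S2 x y : x != y ->
  edge_union G G1 G2 -> supp G1 S1 -> supp G2 S2 -> S1 :&: S2 \subset [set x; y] ->
  has_polys p m G1 x y -> has_polys q n G2 x y ->
  has_polys (p.1 * q.1, p.2 * q.2) (m + n) G x y.
Proof.
move=> xy U s1 s2 s12 [a1 g1] [a2 g2].
have t10 : t - 1 != 0 by rewrite subr_eq0.
have tm := expf_neq0 m t0; have tn := expf_neq0 n t0.
split.
  rewrite (pne_par t0 tn1 xy U s1 s2 s12) a1 a2 !hornerE /= exprD.
  by move: tm tn; move: (t ^+ m) (t ^+ n) => x1 x2 n1 n2; field; rewrite t0 n1 n2 t10.
rewrite (peq_par t0 xy U s1 s2 s12) g1 g2 !hornerE /= !exprS exprD.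
by move: tm tn; move: (t ^+ m) (t ^+ n) => x1 x2 n1 n2; field; rewrite t0 n1 n2.
Qed.

Lemma has_polys_edge G x y : x != y ->
  (forall u v, G u v = (u == x) && (v == y) || (u == y) && (v == x)) -> has_polys (1, 0) 0 G x y.
Proof.
move=> xy hG; have eG : G =2 ind G [set x; y].
  move=> u v; rewrite indE hG !inE.
  by case: (u == x); case: (u == y); case: (v == x); case: (v == y).
have Gxy : G x y by rewrite hG !eqxx.
have a : pne t G x y = pr t G.
  apply: eq_pr => u v; rewrite addEE // hG.
  by rewrite orbb.
rewrite /has_polys /peq a subrr; split; last by rewrite /= horner0 mul0r.
by rewrite (eq_pr t eG) pr_edge //= hornerC expr0 divr1 mulr1; field.
Qed.
End Eval.

Section TreeGraph.
Variable m : nat.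

Definition tree_rel_graph (T : dstree) (u v b : nat) : graph 'I_m := gr [rel i j : 'I_m | tadj T u v b i j].

Definition tsupp (T : dstree) (u v b : nat) : {set 'I_m} :=
  [set i : 'I_m | [|| nat_of_ord i == u, nat_of_ord i == v | (b <= i < b + gsize T)%N]].

Lemma tree_rel_graph_supp T u v b : supp (tree_rel_graph T u v b) (tsupp T u v b).
Proof.
by move=> i j /andP[_ /orP[]/tadj_supp/andP[h1 h2]]; rewrite inE.
Qed.

Lemma gr_union (V : finType) (e e1 e2 : rel V) : (forall i j, e i j = e1 i j || e2 i j) ->
  edge_union (gr e) (gr e1) (gr e2).
Proof.
move=> h i j; rewrite /= /gr_adj /= !h; case: (i != j) => //=.
by case: (e1 i j); case: (e2 i j); case: (e1 j i); case: (e2 j i).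
Qed.

Lemma tree_rel_graph_polys t T (u v : 'I_m) b : t != 0 -> t != 1 -> (b + gsize T <= m)%N -> u != v ->
  ~~ (b <= u < b + gsize T)%N -> ~~ (b <= v < b + gsize T)%N ->
  has_polys t (tree_polys T) (gsize T) (tree_rel_graph T u v b) u v.
Proof.
move=> t0 t1; elim: T u v b => [|l1 I1 r1 I2 l2 I3 r2 I4] u v b bm uv ub vb.
  apply: has_polys_edge => // i j; rewrite /= /gr_adj /=.
  apply/idP/idP => [/andP[_ /orP[]/andP[/eqP/val_inj -> /eqP/val_inj ->]]|/orP[]/andP[/eqP -> /eqP ->]];
    by rewrite !eqxx ?orbT ?uv // eq_sym uv.
rewrite /= in bm ub vb.
set z1n := (b + gsize l1)%N; set b2 := (z1n.+1 + gsize r1)%N; set z2n := (b2 + gsize l2)%N.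
have z1m : (z1n < m)%N by rewrite /z1n; lia.
have z2m : (z2n < m)%N by rewrite /z2n /b2 /z1n; lia.
pose z1 : 'I_m := Ordinal z1m; pose z2 : 'I_m := Ordinal z2m.
have nq (i j : 'I_m) : nat_of_ord i <> nat_of_ord j -> i != j by move=> h; apply/eqP => e; apply: h; rewrite e.
have uvn : nat_of_ord u <> nat_of_ord v by move=> /val_inj e; rewrite e eqxx in uv.
have pt (l r : dstree) (z : 'I_m) c : nat_of_ord z = (c + gsize l)%N ->
    (b <= c)%N -> (c + gsize l + gsize r < b + (gsize l1 + gsize r1 + gsize l2 + gsize r2 + 2))%N ->
    has_polys t (tree_polys l) (gsize l) (tree_rel_graph l u z c) u z ->
    has_polys t (tree_polys r) (gsize r) (tree_rel_graph r z v z.+1) z v ->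
    has_polys t (path_polys (tree_polys l) (tree_polys r)) (gsize l + gsize r).+1
      (gr [rel i j : 'I_m | tadj l u z c i j || tadj r z v z.+1 i j]) u v.
  move=> zc c1 c2 h1 h2.
  apply: (has_polys_path t0 t1 _ _ _ _ (gr_union _) (@tree_rel_graph_supp l u z c) (@tree_rel_graph_supp r z v z.+1) _ h1 h2) => //.
  - by apply: nq; lia.
  - by apply: nq; lia.
  - by rewrite inE eqxx.
  - by rewrite inE eqxx orbT.
  apply/subsetP => i; rewrite !inE -(inj_eq val_inj) /=; lia.
have h1 : has_polys t (path_polys (tree_polys l1) (tree_polys r1)) (gsize l1 + gsize r1).+1
    (gr [rel i j : 'I_m | tadj l1 u z1 b i j || tadj r1 z1 v z1.+1 i j]) u v.
  apply: (pt l1 r1 z1 b) => //; first by lia.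
    by apply: I1; [|apply: nq| |] => /=; rewrite /z1n; lia.
  by apply: (I2 z1 v); [|apply: nq| |] => /=; rewrite /z1n; lia.
have h2 : has_polys t (path_polys (tree_polys l2) (tree_polys r2)) (gsize l2 + gsize r2).+1
    (gr [rel i j : 'I_m | tadj l2 u z2 b2 i j || tadj r2 z2 v z2.+1 i j]) u v.
  apply: (pt l2 r2 z2 b2) => //; [by rewrite /b2 /z1n; lia|by rewrite /b2 /z1n; lia| |].
    by apply: I3; [|apply: nq| |] => /=; rewrite /z2n /b2 /z1n; lia.
  by apply: (I4 z2 v); [|apply: nq| |] => /=; rewrite /z2n /b2 /z1n; lia.
have -> : gsize (GN l1 r1 l2 r2) = ((gsize l1 + gsize r1).+1 + (gsize l2 + gsize r2).+1)%N.
  by rewrite /=; lia.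
apply: (has_polys_par t0 t1 uv (gr_union _)
  (S1 := [set i : 'I_m | [|| nat_of_ord i == u, nat_of_ord i == v | (b <= i < b2)%N]])
  (S2 := [set i : 'I_m | [|| nat_of_ord i == u, nat_of_ord i == v | (b2 <= i < b + gsize (GN l1 r1 l2 r2))%N]]) _ _ _ h1 h2) => //.
- move=> i j /andP[_ /orP[]/orP[]/tadj_supp/andP[k1 k2]]; rewrite inE; move: k1 k2 => /=; rewrite /b2 /z1n; lia.
- move=> i j /andP[_ /orP[]/orP[]/tadj_supp/andP[k1 k2]]; rewrite inE; move: k1 k2 => /=; rewrite /z2n /b2 /z1n; lia.
- by apply/subsetP => i; rewrite !inE -!(inj_eq val_inj) /=; lia.
Qed.
End TreeGraph.
End TreePoly.

(** * Roots forced by iterations without a fixed point *)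

Section FamilyRoots.
Variable R : realType.
Notation alpha T := (@tree_polys R T).1.
Notation gamma T := (@tree_polys R T).2.

Definition fam (st : dstree -> dstree) (n : nat) : dstree := iter n st GL.

(* If no member of the family had a root in [6/5, t1], then the ratio gamma / alpha,
   which starts at 0, would stay below (2 - t1) / kap at t1 by the intermediate value
   theorem, although every step increases it by at least del. *)
Section Escape.
Variables (st : dstree -> dstree) (kap t1 : R) (Phi : R -> R -> R).
(** This is [alpha] times [kap * s - (2 - t)] for the ratio [s], the denominator of the series rule
    when [kap] copies of [T] follow each other; its zeros are poles of the next ratio. *)
Definition dpoly T : {poly R} := kap%:P * gamma T + ('X - 2%:P) * alpha T.
Hypotheses (k1 : 1 <= kap) (k3 : kap < 4) (t1l : 6 / 5 <= t1) (t12 : t1 < 2).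
Hypothesis root_step : forall T t, (dpoly T).[t] = 0 -> (alpha (st T)).[t] = 0.
Hypothesis ratio_step : forall T t, 1 < t -> t < 2 -> (alpha T).[t] != 0 -> (dpoly T).[t] != 0 ->
  (gamma (st T)).[t] / (alpha (st T)).[t] = Phi t ((gamma T).[t] / (alpha T).[t]).
Hypothesis Phi_inv : forall s, 0 <= s <= 1 / 5 -> 0 <= Phi (6 / 5) s <= 1 / 5.
Variable del : R.
Hypotheses (del0 : 0 < del)
  (Phi_escape : forall s, 0 <= s -> kap * s < 2 - t1 -> s + del <= Phi t1 s).

(** The starting point [6 / 5] lies below all three thresholds. There [[0, 1 / 5]] is invariant, and
    [kap < 4] keeps [kap * s] below [4 / 5 = 2 - 6 / 5], so no pole is met. *)
Lemma family_root : exists n x, 6 / 5 <= x <= t1 /\ root (alpha (fam st n)) x.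
Proof.
apply: contrapT => none.
pose sig n t := (gamma (fam st n)).[t] / (alpha (fam st n)).[t].
have an n x : 6 / 5 <= x -> x <= t1 -> (alpha (fam st n)).[x] != 0.
  move=> x1 x2; apply/negP => r; apply: none; exists n, x; rewrite x1 x2; split=> //.
have dn n x : 6 / 5 <= x -> x <= t1 -> (dpoly (fam st n)).[x] != 0.
  by move=> x1 x2; apply/negP => /eqP/root_step r; move: (an n.+1 x x1 x2); rewrite /fam iterS r eqxx.
have stepE n x : 6 / 5 <= x -> x <= t1 -> sig n.+1 x = Phi x (sig n x).
  move=> x1 x2; rewrite /sig /fam iterS ratio_step ?an ?dn //; last exact: le_lt_trans t12.
  by apply: lt_le_trans x1; lra.
have s65 n : 0 <= sig n (6 / 5) <= 1 / 5.
  elim: n => [|n IH]; last by rewrite stepE // Phi_inv.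
  by rewrite /sig /= horner0 mul0r lexx; lra.
have dE n x : 6 / 5 <= x -> x <= t1 ->
    (alpha (fam st n) * dpoly (fam st n)).[x] = (alpha (fam st n)).[x] ^+ 2 * (kap * sig n x - (2 - x)).
  by move=> x1 x2; have := an n x x1 x2; rewrite /sig /dpoly !hornerE /= => nz; field.
have neg1 n : kap * sig n t1 < 2 - t1.
  have l65 : (alpha (fam st n) * dpoly (fam st n)).[6 / 5] < 0.
    rewrite dE // pmulr_rlt0 ?exprn_even_gt0 ?an //= subr_lt0.
    have /andP[a0 a1] := s65 n; apply: (@le_lt_trans _ _ (kap * (1 / 5))).
      by rewrite ler_wpM2l // (le_trans _ k1).
    by move: k3; lra.
  (* This product has the sign of [kap * s - (2 - x)] and has no poles. A sign change would give a
     root of [alpha], or one of [dpoly] and hence of the next [alpha]. *)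
  have : ~~ (0 <= (alpha (fam st n) * dpoly (fam st n)).[t1]).
    apply/negP => h; have [x /andP[x1 x2]] := poly_ivt t1l (introT andP (conj (ltW l65) h)).
    by rewrite rootM /root (negPf (an n x x1 x2)) (negPf (dn n x x1 x2)).
  by rewrite -ltNge dE // pmulr_rlt0 ?exprn_even_gt0 ?an //= subr_lt0.
have s0 n : n%:R * del <= sig n t1.
  elim: n => [|n IH]; first by rewrite mul0r /sig /= horner0 mul0r.
  rewrite stepE //; apply: le_trans (Phi_escape _ (neg1 n)); last first.
    by apply: le_trans IH; rewrite mulr_ge0 // ltW.
  by rewrite -natr1 mulrDl mul1r lerD2r.
have s1 n : sig n t1 < 1.
  have s00 : 0 <= sig n t1 by apply: le_trans (s0 n); rewrite mulr_ge0 // ltW.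
  apply: le_lt_trans (_ : kap * sig n t1 < 1); first by rewrite -{1}[sig n t1]mul1r ler_wpM2r.
  by apply: lt_trans (neg1 n) _; move: t1l; lra.
have d1 : 0 <= del^-1 by rewrite invr_ge0 ltW.
have := archi_boundP d1; set n := Num.bound _ => h.
have := le_lt_trans (s0 n) (s1 n); rewrite -ltr_pdivlMr // mul1r => h2.
by have := lt_trans h h2; rewrite ltxx.
Qed.
End Escape.

(** These are the extreme cases of the lower bound: one side of each component is an edge ([step1]),
    one component is a single vertex ([step2]), or both restrictions hold ([step3]). *)
Definition step1 T := GN T GL T GL.
Definition step2 T := GN GL GL T T.
Definition step3 T := GN GL GL T GL.

Lemma step1_root (t1 : R) : 5 / 4 < t1 -> t1 < 2 ->
  exists n x, 6 / 5 <= x <= t1 /\ root (alpha (fam step1 n)) x.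
Proof.
move=> l5 l2; set q := 2 - t1; set p := t1 - 1.
have q0 : 0 < q by rewrite subr_gt0.
(* On [[0, q]] the maximum of [s (q - s)^2] is [4 q^3 / 27], taken at [s = q / 3]. A fixed point
   solves [s (q - s)^2 = p^2], and at [t = 5 / 4] both values are [1 / 16]. *)
have d0 : 0 < p ^+ 2 - 4 * q ^+ 3 / 27.
  have q3 : q ^+ 3 < (3 / 4) ^+ 3 by rewrite ltrXn2r ?ltW //; rewrite /q; lra.
  have p2 : (1 / 4) ^+ 2 < p ^+ 2 by rewrite ltrXn2r //; rewrite /p; lra.
  by move: q3 p2; rewrite !expr2 !exprS expr0; lra.
apply: (@family_root step1 1 t1 (fun t s => ((t - 1) / (s - (2 - t))) ^+ 2) _ _ _ l2 _ _ _ _ d0).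
- by [].
- by lra.
- by lra.
- move=> T t; rewrite /dpoly /step1 /= /path_polys !hornerE /= => h.
  move: h; move: (alpha T).[t] (gamma T).[t] => a g h.
  have {}h : g + (t - 2) * a = 0 by rewrite -[RHS]h; ring.
  by transitivity ((g + (t - 2) * a) ^+ 2); [ring|rewrite h expr0n].
- move=> T t lt1 lt2; rewrite /dpoly /step1 /= /path_polys !hornerE /= => a0 dd0.
  move: a0 dd0; move: (alpha T).[t] (gamma T).[t] => a g a0 dd0.
  have {}dd0 : g + (t - 2) * a != 0 by apply: contra dd0 => /eqP <-; apply/eqP; ring.
  have e1 : g / a - (2 - t) = (g + (t - 2) * a) / a by field.
  have e2 : forall X Y : R, X = ((t - 1) * a) ^+ 2 -> Y = (g + (t - 2) * a) ^+ 2 ->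
      X / Y = ((t - 1) / (g / a - (2 - t))) ^+ 2.
    by move=> X Y -> ->; rewrite e1; field; rewrite a0 dd0.
  by apply: e2; ring.
- move=> s /andP[s0 s1].
  have -> : ((6 / 5 - 1 : R) / (s - (2 - 6 / 5))) ^+ 2 = 1 / ((4 - 5 * s) ^+ 2).
    by field; try (apply/andP; split); first [by rewrite lt_eqF //; lra | by rewrite gt_eqF //; lra].
  have h : 9 <= (4 - 5 * s) ^+ 2 by rewrite expr2; nra.
  by rewrite divr_ge0 ?sqr_ge0 //= ler_pdivrMr; [lra|lra].
move=> s s0; rewrite mul1r => sq; rewrite -/q -/p.
have qs : 0 < q - s by rewrite subr_gt0.
have qs2 : 0 < (q - s) ^+ 2 by rewrite exprn_gt0.
have -> : (p / (s - q)) ^+ 2 = p ^+ 2 / (q - s) ^+ 2.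
  by rewrite -opprB invrN mulrN sqrrN expr_div_n.
rewrite ler_pdivlMr //; apply: (@le_trans _ _ (s * (q - s) ^+ 2 + (p ^+ 2 - 4 * q ^+ 3 / 27))).
  rewrite mulrDl lerD2l -[leRHS]mulr1 ler_pM2l // expr_le1 //; first by rewrite /q; lra.
  exact: ltW.
rewrite addrCA gerDl subr_le0 -subr_ge0.
have -> : 4 * q ^+ 3 / 27 - s * (q - s) ^+ 2 = (q - 3 * s) ^+ 2 * (4 * q - 3 * s) / 27 by field.
by rewrite divr_ge0 // mulr_ge0 ?sqr_ge0 //; lra.
Qed.

Lemma step3_root (t1 : R) : 6 / 5 <= t1 -> (2 - t1) ^+ 3 < 4 * (t1 - 1) ^+ 2 -> t1 < 2 ->
  exists n x, 6 / 5 <= x <= t1 /\ root (alpha (fam step3 n)) x.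
Proof.
move=> l5 l4 l2; set q := 2 - t1 in l4; set p := t1 - 1 in l4.
have q0 : 0 < q by rewrite subr_gt0.
(* A fixed point solves [s q (q - s) = p^2], whose left side is at most [q^3 / 4], with equality at
   [s = q / 2]. *)
have d0 : 0 < p ^+ 2 - q ^+ 3 / 4 by lra.
apply: (@family_root step3 1 t1 (fun t s => (t - 1) ^+ 2 / ((2 - t) * (2 - t - s))) _ _ l5 l2 _ _ _ _ d0).
- by [].
- by lra.
- move=> T t; rewrite /dpoly /step3 /= /path_polys !hornerE /= => h.
  move: h; move: (alpha T).[t] (gamma T).[t] => a g h.
  have {}h : g + (t - 2) * a = 0 by rewrite -[RHS]h; ring.
  by transitivity ((t - 2) * (g + (t - 2) * a)); [ring|rewrite h mulr0].
- move=> T t lt1 lt2; rewrite /dpoly /step3 /= /path_polys !hornerE /= => a0 dd0.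
  have t20 : 2 - t != 0 by rewrite subr_eq0 gt_eqF.
  have t21 : t - 2 != 0 by rewrite subr_eq0 lt_eqF.
  move: a0 dd0; move: (alpha T).[t] (gamma T).[t] => a g a0 dd0.
  have {}dd0 : g + (t - 2) * a != 0 by apply: contra dd0 => /eqP <-; apply/eqP; ring.
  have e1 : 2 - t - g / a = - (g + (t - 2) * a) / a by field.
  have e2 : forall X Y : R, X = (t - 1) ^+ 2 * a -> Y = (t - 2) * (g + (t - 2) * a) ->
      X / Y = (t - 1) ^+ 2 / ((2 - t) * (2 - t - g / a)).
    by move=> X Y -> ->; rewrite e1; field; rewrite a0 dd0 t20 t21.
  by apply: e2; ring.
- move=> s /andP[s0 s1].
  have -> : (6 / 5 - 1 : R) ^+ 2 / ((2 - 6 / 5) * (2 - 6 / 5 - s)) = 1 / (4 * (4 - 5 * s)).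
    by field; try (apply/andP; split); first [by rewrite lt_eqF //; lra | by rewrite gt_eqF //; lra].
  by rewrite divr_ge0 /= ?ler_pdivrMr; lra.
move=> s s0; rewrite mul1r => sq; rewrite -/q -/p.
have qs : 0 < q - s by rewrite subr_gt0.
rewrite ler_pdivlMr ?mulr_gt0 //; apply: (@le_trans _ _ (s * (q * (q - s)) + (p ^+ 2 - q ^+ 3 / 4))).
  rewrite mulrDl lerD2l -[leRHS]mulr1 ler_pM2l //; apply: mulr_ile1; rewrite ?ltW //; rewrite /q; lra.
rewrite addrCA gerDl subr_le0 -subr_ge0.
have -> : q ^+ 3 / 4 - s * (q * (q - s)) = q * (q / 2 - s) ^+ 2 by field.
by rewrite mulr_ge0 ?sqr_ge0 // ltW.
Qed.

Lemma step2_root (t1 : R) : 6 / 5 <= t1 -> (2 - t1) ^+ 4 < 4 * (t1 - 1) ^+ 2 * (3 - t1) -> t1 < 2 ->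
  exists n x, 6 / 5 <= x <= t1 /\ root (alpha (fam step2 n)) x.
Proof.
move=> l5 l4 l2; have e3 : 3 - t1 = 1 + (2 - t1) by ring.
rewrite e3 in l4; set q := 2 - t1 in l4; set p := t1 - 1 in l4.
have q0 : 0 < q by rewrite subr_gt0.
have q1 : 0 < 1 + q by lra.
have qn : 1 + q != 0 by rewrite gt_eqF.
(* With [p + 2 q = 1 + q], a fixed point is a zero of [(1 + q) s^2 - q^2 s + p^2]; the number here
   is the minimum of this quadratic, taken at [s = q^2 / (2 (1 + q))]. *)
have d0 : 0 < p ^+ 2 - q ^+ 4 / (4 * (1 + q)).
  by rewrite subr_gt0 ltr_pdivrMr ?mulr_gt0 // mulrCA mulrA.
apply: (@family_root step2 2 t1
  (fun t s => (t - 1) * (s ^+ 2 + (t - 1)) / ((2 - t) * (2 - t - 2 * s))) _ _ l5 l2 _ _ _ _ d0).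
- by lra.
- by lra.
- move=> T t; rewrite /dpoly /step2 /= /path_polys !hornerE /= => h.
  move: h; move: (alpha T).[t] (gamma T).[t] => a g h.
  have {}h : 2 * g + (t - 2) * a = 0 by rewrite -[RHS]h; ring.
  by transitivity ((t - 2) * (a * (2 * g + (t - 2) * a))); [ring|rewrite h !mulr0].
- move=> T t lt1 lt2; rewrite /dpoly /step2 /= /path_polys !hornerE /= => a0 dd0.
  have t20 : 2 - t != 0 by rewrite subr_eq0 gt_eqF.
  have t21 : t - 2 != 0 by rewrite subr_eq0 lt_eqF.
  move: a0 dd0; move: (alpha T).[t] (gamma T).[t] => a g a0 dd0.
  have {}dd0 : 2 * g + (t - 2) * a != 0 by apply: contra dd0 => /eqP <-; apply/eqP; ring.
  have e1 : 2 - t - 2 * g / a = - (2 * g + (t - 2) * a) / a by field.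
  have e2 : forall X Y : R, X = (t - 1) * (g ^+ 2 + (t - 1) * a ^+ 2) ->
      Y = (t - 2) * (a * (2 * g + (t - 2) * a)) ->
      X / Y = (t - 1) * ((g / a) ^+ 2 + t - 1) / ((2 - t) * (2 - t - 2 * g / a)).
    by move=> X Y -> ->; rewrite e1; field; rewrite a0 dd0 t20 t21.
by apply: e2; ring.
- move=> s /andP[s0 s1].
  have -> : (6 / 5 - 1 : R) * (s ^+ 2 + (6 / 5 - 1)) / ((2 - 6 / 5) * (2 - 6 / 5 - 2 * s)) =
     (5 * s ^+ 2 + 1) / (4 * (4 - 10 * s)).
    by field; try (apply/andP; split); first [by rewrite lt_eqF //; lra | by rewrite gt_eqF //; lra].
  have s2 : s ^+ 2 <= 1 / 25 by rewrite expr2; nra.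
  have s20 : 0 <= s ^+ 2 by rewrite sqr_ge0.
  by rewrite divr_ge0 /= ?ler_pdivrMr; lra.
move=> s s0 sq; rewrite -/q -/p in sq *.
have qs : 0 < q - 2 * s by rewrite subr_gt0.
rewrite ler_pdivlMr ?mulr_gt0 //.
apply: (@le_trans _ _ (s * (q * (q - 2 * s)) + (p ^+ 2 - q ^+ 4 / (4 * (1 + q))))).
  rewrite mulrDl lerD2l -[leRHS]mulr1 ler_pM2l //; apply: mulr_ile1; rewrite ?ltW //; rewrite /q; lra.
rewrite -subr_ge0.
have -> : p * (s ^+ 2 + p) - (s * (q * (q - 2 * s)) + (p ^+ 2 - q ^+ 4 / (4 * (1 + q)))) =
   (1 + q) * (s - q ^+ 2 / (2 * (1 + q))) ^+ 2.
  have -> : p = 1 - q by rewrite /p /q; ring.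
  by field.
by rewrite mulr_ge0 ?sqr_ge0 // ltW.
Qed.
End FamilyRoots.

(** * The families avoid the excluded minors *)

(* Without a0 the graph is a forest, each vertex having at most one later neighbour,
   whereas deleting any branch set of H0 leaves a cycle of length 4. *)
Section ApexForest.
Variables (m : nat) (G : graph 'I_m) (a0 : 'I_m).
Hypothesis up_unique : forall i j j' : 'I_m, i != a0 ->
  G i j -> G i j' -> (i < j)%N -> (i < j')%N -> j = j'.
Implicit Types (S T : {set 'I_m}).

Definition top S (i : 'I_m) : Prop := i \in S /\ forall j : 'I_m, j \in S -> (j <= i)%N.

Lemma top_exists S : S != set0 -> exists i, top S i.
Proof.
case/set0Pn => i0 iS; case: (@arg_maxnP _ i0 (mem S) (fun i => nat_of_ord i) iS) => i iS' h.
by exists i; split.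
Qed.

(** If [i] had no larger neighbour in [S], the vertices from which [i] is reached along ascending
    edges of [S] would form a closed set, hence all of [S]. The top vertex would then be at most
    [i]. *)
Lemma up_in S i x : conn G S -> a0 \notin S -> top S x -> i \in S -> i != x ->
  exists j, [/\ j \in S, G i j & (i < j)%N].
Proof.
move=> cS aS [xS xt] iS ix; apply: contrapT => n.
pose up := [rel k j : 'I_m | [&& k \in S, j \in S, G k j & (k < j)%N]].
have e : [set k in S | connect up k i] = S.
  apply: cS.2; first by apply/set0Pn; exists i; rewrite inE iS connect0.
  apply/clP; split; first by apply/subsetP => k; rewrite inE => /andP[].
  move=> k j; rewrite !inE => /andP[kS ki] jS kj; rewrite jS /=.
  case: (ltngtP k j) => [kj'|jk|/val_inj e]; last by rewrite e grI in kj.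
    case/connectP: ki => -[|l p] /=; first by move=> _ ei; case: n; exists j; rewrite ei.
    case/andP => /and4P[_ lS kl kl'] pp ei; have -> : j = l.
      by apply: up_unique kj kl kj' kl'; apply: contraNneq aS => <-.
    by apply/connectP; exists p.
  by apply: connect_trans (connect1 _) ki; rewrite /= jS kS grC kj.
have : x \in S by []; rewrite -{1}e inE => /andP[_ /connectP[p pp ei]].
have : (x <= last x p)%N.
  elim: p x {xS xt ix e ei} pp => //= l p IH k /andP[/and4P[_ _ _ kl] /IH]; exact: leq_trans (ltnW kl).
rewrite -ei => xi; have := xt i iS => ix'.
by case/eqP: ix; apply: val_inj; apply/eqP; rewrite eqn_leq xi ix'.
Qed.

(** Below the top of its set, a vertex has its unique larger neighbour inside that set. An edge
    between the two sets must therefore ascend from a top, and it can only be the lower one. *)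
Lemma touch_up S T x y : conn G S -> conn G T -> a0 \notin S -> a0 \notin T -> [disjoint S & T] ->
  top S x -> top T y -> (x < y)%N -> touch G S T -> exists2 j, j \in T & G x j /\ (x < j)%N.
Proof.
move=> cS cT aS aT d tx ty xy [i [j [iS jT ij]]].
have [ix|ix] := eqVneq i x; last first.
  exfalso; have [k [kS ik ik']] := up_in cS aS tx iS ix.
  case: (ltngtP i j) => [l|l|/val_inj e]; last by rewrite e grI in ij.
    have e : j = k by apply: up_unique ij ik l ik'; apply: contraNneq aS => <-.
    by move: jT; rewrite e (disjointFr d kS).
  have jy : j != y.
    apply/eqP => e; have := tx.2 i iS; rewrite e in l; move: l xy; clear; lia.
  have [k' [kT jk jk']] := up_in cT aT ty jT jy.
  have e : i = k'.
    by apply: (up_unique (i := j)) jk l jk'; [apply: contraNneq aT => <-|rewrite grC].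
  by move: kT; rewrite -e (disjointFr d iS).
exists j => //; rewrite -ix; split=> //.
case: (ltngtP i j) => [//|l|/val_inj e]; last by rewrite e grI in ij.
have jy : j != y by apply/eqP => e; move: l xy; rewrite ix e; clear; lia.
have [k' [kT jk jk']] := up_in cT aT ty jT jy.
have e : i = k'.
  by apply: (up_unique (i := j)) jk l jk'; [apply: contraNneq aT => <-|rewrite grC].
by move: kT; rewrite -e (disjointFr d iS).
Qed.

(** Around the cycle some set has a lower top than both its neighbours. This top would have larger
    neighbours in two disjoint sets. *)
Lemma no_C4 (S1 S2 S3 S4 : {set 'I_m}) :
  [/\ conn G S1, conn G S2, conn G S3 & conn G S4] ->
  [/\ a0 \notin S1, a0 \notin S2, a0 \notin S3 & a0 \notin S4] ->
  [/\ [disjoint S1 & S2], [disjoint S2 & S3], [disjoint S3 & S4], [disjoint S1 & S4] &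
   [disjoint S1 & S3] /\ [disjoint S2 & S4]] ->
  [/\ touch G S1 S2, touch G S2 S3, touch G S3 S4 & touch G S4 S1] -> False.
Proof.
move=> [c1 c2 c3 c4] [n1 n2 n3 n4] [d12 d23 d34 d14 [d13 d24]] [t12 t23 t34 t41].
have [x1 X1] := top_exists c1.1; have [x2 X2] := top_exists c2.1.
have [x3 X3] := top_exists c3.1; have [x4 X4] := top_exists c4.1.
have key (A B C : {set 'I_m}) x y z : conn G A -> conn G B -> conn G C -> a0 \notin A -> a0 \notin B -> a0 \notin C ->
    [disjoint A & B] -> [disjoint A & C] -> [disjoint B & C] -> touch G A B -> touch G A C ->
    top A x -> top B y -> top C z -> (x < y)%N -> (x < z)%N -> False.
  move=> cA cB cC nA nB nC dAB dAC dBC tAB tAC X Y Z xy xz.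
  have [j jB [xj xj']] := touch_up cA cB nA nB dAB X Y xy tAB.
  have [k kC [xk xk']] := touch_up cA cC nA nC dAC X Z xz tAC.
  have e : j = k by apply: up_unique xj xk xj' xk'; apply: contraNneq nA => <-; exact: X.1.
  by rewrite -e (disjointFr dBC jB) in kC.
have ne (A B : {set 'I_m}) x y : [disjoint A & B] -> top A x -> top B y -> nat_of_ord x <> nat_of_ord y.
  by move=> d [xA _] [yB _] /val_inj e; rewrite -e (disjointFr d xA) in yB.
have e12 := ne _ _ _ _ d12 X1 X2; have e23 := ne _ _ _ _ d23 X2 X3.
have e34 := ne _ _ _ _ d34 X3 X4; have e14 := ne _ _ _ _ d14 X1 X4.
have : [\/ (x1 < x2) && (x1 < x4), (x2 < x1) && (x2 < x3), (x3 < x2) && (x3 < x4) | (x4 < x1) && (x4 < x3)]%N.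
  move: e12 e23 e34 e14; clear; case: (ltngtP x1 x2) => // h1 _; case: (ltngtP x2 x3) => // h2 _;
  case: (ltngtP x3 x4) => // h3 _; case: (ltngtP x1 x4) => // h4 _;
  try (by constructor 1); try (by constructor 2); try (by constructor 3); try (by constructor 4); lia.
have d31 : [disjoint S3 & S1] by rewrite disjoint_sym.
have d42 : [disjoint S4 & S2] by rewrite disjoint_sym.
have d21 : [disjoint S2 & S1] by rewrite disjoint_sym.
have d32 : [disjoint S3 & S2] by rewrite disjoint_sym.
have d43 : [disjoint S4 & S3] by rewrite disjoint_sym.
have d41 : [disjoint S4 & S1] by rewrite disjoint_sym.
case=> /andP[l1 l2].
- exact: (key S1 S2 S4 x1 x2 x4 c1 c2 c4 n1 n2 n4 d12 d14 d24 t12 (touchC t41) X1 X2 X4).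
- exact: (key S2 S1 S3 x2 x1 x3 c2 c1 c3 n2 n1 n3 d21 d23 d13 (touchC t12) t23 X2 X1 X3).
- exact: (key S3 S2 S4 x3 x2 x4 c3 c2 c4 n3 n2 n4 d32 d34 d24 (touchC t23) t34 X3 X2 X4).
- exact: (key S4 S1 S3 x4 x1 x3 c4 c1 c3 n4 n1 n3 d41 d43 d13 t41 (touchC t34) X4 X1 X3).
Qed.

Lemma no_H0 : ~ minor H0 (sg G).
Proof.
move=> [phi [h1 h2 h3]].
have c h : conn G (phi h) by apply/conn_connected.
pose i0 : H0 := inl (inl (inl (@Ordinal 3 0 isT))).
pose i1 : H0 := inl (inl (inl (@Ordinal 3 1 isT))).
pose i2 : H0 := inl (inl (inl (@Ordinal 3 2 isT))).
have C4 (p q r s : H0) : p != q -> q != r -> r != s -> p != s -> p != r -> q != s ->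
   adj p q -> adj q r -> adj r s -> adj s p ->
   a0 \in phi p :|: phi q :|: phi r :|: phi s.
  move=> n1 n2 n3 n4 n5 n6 a1 a2 a3 a4; apply: contraT; rewrite !in_setU !negb_or.
  move=> /andP[/andP[/andP[m1 m2] m3] m4].
  case: (@no_C4 (phi p) (phi q) (phi r) (phi s)); split=> //; try exact: h2; try exact: h3.
  by split; exact: h2.
have k1 := C4 i0 (inl (inl (inr true))) i1 (inl (inl (inr false))) isT isT isT isT isT isT isT isT isT isT.
have k2 := C4 i1 (inl (inr true)) i2 (inl (inr false)) isT isT isT isT isT isT isT isT isT isT.
have k3 := C4 i2 (inr true) i0 (inr false) isT isT isT isT isT isT isT isT isT isT.
have uniq h h' : a0 \in phi h -> a0 \in phi h' -> h == h'.
  by move=> u1 u2; apply: contraT => /h2/disjointFr/(_ u1); rewrite u2.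
move: k1 k2 k3; rewrite !in_setU.
case/orP => [/orP[/orP[]|]|] u1; case/orP => [/orP[/orP[]|]|] u2; case/orP => [/orP[/orP[]|]|] u3;
  first [by have := uniq _ _ u1 u2 | by have := uniq _ _ u1 u3 | by have := uniq _ _ u2 u3].
Qed.
End ApexForest.

(** * Graphs with noncrossing edges have no K_{2,3} minor *)

Section Noncrossing.
Variables (m : nat) (O : graph 'I_m).
Hypothesis noX : forall i j i' j' : 'I_m, O i j -> O i' j' ->
  (i < i')%N -> (i' < j)%N -> (j < j')%N -> False.
Implicit Types (S T X Y U : {set 'I_m}).

(** An edge of [S] has all of [T] either strictly between its ends or outside. Hence no edge of [S]
    leaves the interval between [t1] and [t2], and [S], which has [s2] inside it, cannot contain
    [s1]. *)
Lemma conn_noncross S T (s1 s2 t1 t2 : 'I_m) : conn O S -> conn O T -> [disjoint S & T] ->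
  s1 \in S -> s2 \in S -> t1 \in T -> t2 \in T ->
  (s1 < t1)%N -> (t1 < s2)%N -> (s2 < t2)%N -> False.
Proof.
move=> [_ hS] [_ hT] d s1S s2S t1T t2T l1 l2 l3.
have ne (s t : 'I_m) : s \in S -> t \in T -> nat_of_ord s <> nat_of_ord t.
  by move=> sS tT /val_inj e; rewrite -e (disjointFr d sS) in tT.
have inT (a b : 'I_m) : O a b -> a \in S -> b \in S -> (a < b)%N ->
    forall t t', t \in T -> t' \in T -> (a < t < b)%N -> (a < t' < b)%N.
  move=> ab aS bS lab t t' tT t'T tin.
  have e : [set k in T | (a < k < b)%N] = T.
    apply: hT; first by apply/set0Pn; exists t; rewrite inE tT.
    apply/clP; split; first by apply/subsetP => k; rewrite inE => /andP[].
    move=> k l; rewrite !inE => /andP[kT /andP[k1 k2]] lT kl; rewrite lT /=.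
    have na := ne a l aS lT; have nb := ne b l bS lT.
    case: (ltngtP a l) => [al|la|/na //] /=; last by case: (noX (i := l) (j := k) (i' := a) (j' := b)) => //; rewrite grC.
    by case: (ltngtP l b) => [//|bl|/esym/nb //]; case: (noX ab kl k1 k2 bl).
  by have := t'T; rewrite -{1}e inE => /andP[].
have e : [set s in S | (t1 < s < t2)%N] = S.
  apply: hS; first by apply/set0Pn; exists s2; rewrite inE s2S l2 l3.
  apply/clP; split; first by apply/subsetP => k; rewrite inE => /andP[].
  move=> k l; rewrite !inE => /andP[kS /andP[k1 k2]] lS kl; rewrite lS /=.
  have n1 := ne l t1 lS t1T; have n2 := ne l t2 lS t2T.
  apply/andP; split; rewrite ltnNge; apply/negP => bad.
    have lt : (l < t1)%N by move: bad n1; clear; lia.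
    have := inT l k _ lS kS _ t1 t2 t1T t2T; rewrite grC kl (ltn_trans lt k1) lt k1.
    by move=> /(_ isT isT isT); move: k2; clear; lia.
  have lt : (t2 < l)%N by move: bad n2; clear; lia.
  have := inT k l kl kS lS (ltn_trans k2 lt) t2 t1 t2T t1T; rewrite k2 lt.
  by move=> /(_ isT); move: k1; clear; lia.
by have := s1S; rewrite -{1}e inE; move: l1; clear; lia.
Qed.

Let alt (s t s' t' : nat) : bool :=
  ((s < s') && (s' < t) && (t < t') || (s' < s) && (s < t') && (t' < t))%N.

(** If [u] and [w] lie on the same arc between [x] and [y], then the chords [xu], [yw] or the chords
    [xw], [yu] cross. Since [alt] reads each chord in a fixed direction, all orientations are
    listed. *)
Lemma circle_cross (x y u w : nat) : x <> y -> x <> u -> y <> u -> x <> w -> y <> w -> u <> w ->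
  ((x < u < y) || (y < u < x))%N = ((x < w < y) || (y < w < x))%N ->
  [|| alt x u y w, alt x u w y, alt u x y w, alt u x w y,
      alt x w y u, alt x w u y, alt w x y u | alt w x u y].
Proof.
rewrite /alt => n1 n2 n3 n4 n5 n6.
case: (ltngtP x y) => [h1|h1|/n1 //]; case: (ltngtP x u) => [h2|h2|/n2 //];
case: (ltngtP y u) => [h3|h3|/n3 //]; case: (ltngtP x w) => [h4|h4|/n4 //];
case: (ltngtP y w) => [h5|h5|/n5 //]; case: (ltngtP u w) => [h6|h6|/n6 //] //=;
move=> _; exfalso; clear - h1 h2 h3 h4 h5 h6; lia.
Qed.

(** Two of the three sets have representatives on the same arc between [x] and [y]. Joining one of
    them to [X] and the other to [Y] gives disjoint connected sets, in one of the two ways with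
    crossing chords. *)
Lemma no_K23 X Y U1 U2 U3 : [/\ conn O X, conn O Y, conn O U1, conn O U2 & conn O U3] ->
  [disjoint X & Y] ->
  [/\ [disjoint X & U1], [disjoint X & U2] & [disjoint X & U3]] ->
  [/\ [disjoint Y & U1], [disjoint Y & U2] & [disjoint Y & U3]] ->
  [/\ [disjoint U1 & U2], [disjoint U1 & U3] & [disjoint U2 & U3]] ->
  [/\ touch O X U1, touch O X U2 & touch O X U3] ->
  [/\ touch O Y U1, touch O Y U2 & touch O Y U3] -> False.
Proof.
move=> [cX cY c1 c2 c3] dXY [dX1 dX2 dX3] [dY1 dY2 dY3] [d12 d13 d23] [tX1 tX2 tX3] [tY1 tY2 tY3].
have [x xX] : exists x, x \in X by apply/set0Pn; exact: cX.1.
have [y yY] : exists y, y \in Y by apply/set0Pn; exact: cY.1.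
have [u1 uU1] : exists u, u \in U1 by apply/set0Pn; exact: c1.1.
have [u2 uU2] : exists u, u \in U2 by apply/set0Pn; exact: c2.1.
have [u3 uU3] : exists u, u \in U3 by apply/set0Pn; exact: c3.1.
have cU (A B : {set 'I_m}) : conn O A -> conn O B -> touch O A B -> conn O (A :|: B).
  by move=> cA cB [a [b [aA bB ab]]]; exact: connU cA cB aA bB ab.
have ne (A B : {set 'I_m}) (a b : 'I_m) : [disjoint A & B] -> a \in A -> b \in B -> nat_of_ord a <> nat_of_ord b.
  by move=> d aA bB /val_inj e; rewrite -e (disjointFr d aA) in bB.
have nxy := ne _ _ _ _ dXY xX yY.
have side U W (u w : 'I_m) : conn O U -> conn O W -> touch O X U -> touch O Y U -> touch O X W -> touch O Y W ->
    [disjoint X & U] -> [disjoint Y & U] -> [disjoint X & W] -> [disjoint Y & W] -> [disjoint U & W] ->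
    u \in U -> w \in W -> ((x < u < y) || (y < u < x))%N = ((x < w < y) || (y < w < x))%N -> False.
  move=> kU kW xU yU xW yW dXU dYU dXW dYW dUW uU wW.
  have NC (A B : {set 'I_m}) (a b s t : 'I_m) : conn O A -> conn O B -> touch O X A -> touch O Y B ->
      [disjoint X & B] -> [disjoint Y & A] -> [disjoint A & B] -> a \in A -> b \in B ->
      [/\ s = x & t = a] \/ [/\ s = a & t = x] -> forall s' t', [/\ s' = y & t' = b] \/ [/\ s' = b & t' = y] ->
      ((s < s') && (s' < t) && (t < t') = false)%N /\ ((s' < s) && (s < t') && (t' < t) = false)%N.
    move=> kA kB xA yB dXB dYA dAB aA bB st s' t' st'.
    have sX : s \in X :|: A by rewrite inE; case: st => -[-> _]; rewrite ?xX ?aA ?orbT.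
    have tX : t \in X :|: A by rewrite inE; case: st => -[_ ->]; rewrite ?xX ?aA ?orbT.
    have sY : s' \in Y :|: B by rewrite inE; case: st' => -[-> _]; rewrite ?yY ?bB ?orbT.
    have tY : t' \in Y :|: B by rewrite inE; case: st' => -[_ ->]; rewrite ?yY ?bB ?orbT.
    have dd : [disjoint X :|: A & Y :|: B].
      by rewrite !disjoint_setU !disjoint_setUr dXY dXB dAB (disjoint_sym A) dYA.
    have kXA := cU _ _ cX kA xA; have kYB := cU _ _ cY kB yB.
    split; apply/negP => /andP[/andP[q1 q2] q3].
      exact: (conn_noncross kXA kYB dd sX tX sY tY q1 q2 q3).
    by rewrite disjoint_sym in dd; exact: (conn_noncross kYB kXA dd sY tY sX tX q1 q2 q3).
  have dWU : [disjoint W & U] by rewrite disjoint_sym.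
  have n1 := ne _ _ _ _ dXU xX uU; have n2 := ne _ _ _ _ dYU yY uU.
  have n3 := ne _ _ _ _ dXW xX wW; have n4 := ne _ _ _ _ dYW yY wW.
  have n5 := ne _ _ _ _ dUW uU wW.
  have P1 s t s' t' h h' := NC U W u w s t kU kW xU yW dXW dYU dUW uU wW h s' t' h'.
  have P2 s t s' t' h h' := NC W U w u s t kW kU xW yU dXU dYW dWU wW uU h s' t' h'.
  have [a1 a2] := P1 x u y w (or_introl (conj erefl erefl)) (or_introl (conj erefl erefl)).
  have [a3 a4] := P1 x u w y (or_introl (conj erefl erefl)) (or_intror (conj erefl erefl)).
  have [a5 a6] := P1 u x y w (or_intror (conj erefl erefl)) (or_introl (conj erefl erefl)).
  have [a7 a8] := P1 u x w y (or_intror (conj erefl erefl)) (or_intror (conj erefl erefl)).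
  have [b1 b2] := P2 x w y u (or_introl (conj erefl erefl)) (or_introl (conj erefl erefl)).
  have [b3 b4] := P2 x w u y (or_introl (conj erefl erefl)) (or_intror (conj erefl erefl)).
  have [b5 b6] := P2 w x y u (or_intror (conj erefl erefl)) (or_introl (conj erefl erefl)).
  have [b7 b8] := P2 w x u y (or_intror (conj erefl erefl)) (or_intror (conj erefl erefl)).
  have F := circle_cross nxy n1 n2 n3 n4 n5.
  by move=> /F; rewrite /alt a1 a2 a3 a4 a5 a6 a7 a8 b1 b2 b3 b4 b5 b6 b7 b8.
pose I (u : 'I_m) := ((x < u < y) || (y < u < x))%N.
have s12 := side U1 U2 u1 u2 c1 c2 tX1 tY1 tX2 tY2 dX1 dY1 dX2 dY2 d12 uU1 uU2.
have s13 := side U1 U3 u1 u3 c1 c3 tX1 tY1 tX3 tY3 dX1 dY1 dX3 dY3 d13 uU1 uU3.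
have s23 := side U2 U3 u2 u3 c2 c3 tX2 tY2 tX3 tY3 dX2 dY2 dX3 dY3 d23 uU2 uU3.
move: s12 s13 s23; rewrite -/(I u1) -/(I u2) -/(I u3).
by case: (I u1); case: (I u2); case: (I u3) => p q r; first [exact: p|exact: q|exact: r].
Qed.
End Noncrossing.

(* W is an independent set of vertices of degree two whose suppression gives the
   outerplanar graph O; H1 and H2 would yield K_{2,3} in O. *)
Section SubdividedOuterplanar.
Variables (m : nat) (G O : graph 'I_m) (W : {set 'I_m}).
Hypothesis noX : forall i j i' j' : 'I_m, O i j -> O i' j' ->
  (i < i')%N -> (i' < j)%N -> (j < j')%N -> False.
Hypothesis edge_out : forall i j, G i j -> i \notin W -> j \notin W -> O i j.
Hypothesis edge_in : forall i, i \in W -> exists j1 j2,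
  [/\ O j1 j2, j1 \notin W, j2 \notin W & forall j, G i j -> j = j1 \/ j = j2].
Implicit Types (S T X Y : {set 'I_m}).

Notation trim S := (S :\: W).

Lemma conn_nbr S a : conn G S -> a \in S -> S != [set a] -> exists2 s, s \in S & G a s.
Proof.
move=> [_ hS] aS nS; apply: contrapT => n; case/eqP: nS; symmetry; apply: hS.
  by apply/set0Pn; exists a; rewrite inE.
apply/clP; split; first by rewrite sub1set.
by move=> u v; rewrite inE => /eqP -> vS av; case: n; exists v.
Qed.

Lemma in_nbr i j : i \in W -> G i j -> j \notin W.
Proof. by move=> /edge_in[j1 [j2 [_ n1 n2 h]]] /h[]->. Qed.

Lemma in_nbr2 i j j' : i \in W -> G i j -> G i j' -> j != j' -> O j j'.
Proof.
move=> /edge_in[j1 [j2 [o _ _ h]]] /h[]-> /h[]->; rewrite ?eqxx // => _.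
by rewrite grC.
Qed.

(** A vertex of [W] only passes between its two neighbours, which are adjacent in [O]. So a closed
    set of the trimmed graph, together with the vertices of [S :&: W] adjacent to it, is closed in
    [S]. *)
Lemma trim_conn S : conn G S -> trim S != set0 -> conn O (trim S).
Proof.
move=> [_ hS] S0; split=> // C C0 /clP[CS hC].
pose C' := C :|: [set w in S :&: W | [exists c in C, G w c]].
have e : C' = S.
  apply: hS; first by case/set0Pn: C0 => c cC; apply/set0Pn; exists c; rewrite inE cC.
  apply/clP; split.
    apply/subsetP => u; rewrite !inE => /orP[/(subsetP CS)|]; first by rewrite inE => /andP[].
    by case/andP => /andP[].
  move=> u v; rewrite !inE => /orP[uC|/andP[/andP[uS uW] /existsP[c /andP[cC uc]]]] vS uv.
    have := subsetP CS u uC; rewrite inE => /andP[uW uS].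
    case: (boolP (v \in W)) => vW.
      by rewrite vS /=; apply/orP; right; apply/existsP; exists u; rewrite uC grC.
    by rewrite (hC u v) // ?inE ?vW // edge_out.
  have vW := in_nbr uW uv; have [<-|cv] := eqVneq c v; first by rewrite cC.
  by rewrite (hC c v) // ?inE ?vW // (in_nbr2 uW).
apply/eqP; rewrite eqEsubset CS; apply/subsetP => u; rewrite inE => /andP[uW uS].
by have := uS; rewrite -{1}e !inE (negPf uW) andbF /= orbF.
Qed.

(** If the contact is at a vertex of [W] in one of the sets, this vertex has another neighbour in
    its own set, and its two neighbours are joined in [O]. *)
Lemma trim_touch S T : conn G S -> conn G T -> [disjoint S & T] ->
  trim S != set0 -> trim T != set0 -> touch G S T -> touch O (trim S) (trim T).
Proof.
have half (A B : {set 'I_m}) a b : conn G A -> [disjoint A & B] -> trim A != set0 -> a \in A -> b \in B -> G a b ->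
    a \in W -> touch O (trim A) (trim B).
  move=> cA d A0 aA bB ab aW.
  have [|s sA as_] := conn_nbr cA aA.
    by apply: contraNneq A0 => ->; rewrite setD_eq0 sub1set.
  exists s, b; split; rewrite ?inE ?sA ?bB ?(in_nbr aW ab) ?(in_nbr aW as_) //.
  by apply: (in_nbr2 aW) => //; apply/eqP => e; move: bB; rewrite -e (disjointFr d sA).
move=> cS cT d S0 T0 [a [b [aS bT ab]]].
case: (boolP (a \in W)) => aW; first exact: half cS d S0 aS bT ab aW.
case: (boolP (b \in W)) => bW; last by exists a, b; rewrite !inE aW bW aS bT edge_out.
apply: touchC; rewrite disjoint_sym in d; rewrite grC in ab.
exact: half cT d T0 bT aS ab bW.
Qed.

(** As [W] is independent, a connected set inside it is a single vertex; its degree is at most two,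
    so it cannot touch three disjoint sets. *)
Lemma trim_nonempty S T1 T2 T3 : conn G S ->
  [/\ [disjoint T1 & T2], [disjoint T1 & T3] & [disjoint T2 & T3]] ->
  [/\ touch G S T1, touch G S T2 & touch G S T3] -> trim S != set0.
Proof.
move=> cS [d12 d13 d23] [t1 t2 t3]; apply/negP; rewrite setD_eq0 => SW.
have [a aS] : exists a, a \in S by apply/set0Pn; exact: cS.1.
have aW := subsetP SW a aS.
have [eS|nS] := eqVneq S [set a]; last first.
  have [s sS as_] := conn_nbr cS aS nS.
  by have := in_nbr aW as_; rewrite (subsetP SW).
have nb (T : {set 'I_m}) : touch G S T -> exists2 s, s \in T & G a s.
  by move=> [a' [s [+ sT as_]]]; rewrite eS inE => /eqP e; exists s; rewrite // -e.
have [s1 m1 e1] := nb _ t1; have [s2 m2 e2] := nb _ t2; have [s3 m3 e3] := nb _ t3.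
have [j1 [j2 [_ _ _ h]]] := edge_in aW.
have x12 : s1 != s2 by apply/eqP => e; rewrite -e (disjointFr d12 m1) in m2.
have x13 : s1 != s3 by apply/eqP => e; rewrite -e (disjointFr d13 m1) in m3.
have x23 : s2 != s3 by apply/eqP => e; rewrite -e (disjointFr d23 m2) in m3.
by case: (h _ e1) x12 x13 x23 => ->; case: (h _ e2) => ->; case: (h _ e3) => ->; rewrite ?eqxx.
Qed.

(** Merging each [P] with one subdivision set [Q] restores the edge that was doubly subdivided and
    yields K_{2,3}. The [Q] may vanish when [W] is removed, but the unions do not. *)
Lemma no_subdivided_K23 X Y P1 P2 P3 Q1 Q2 Q3 :
  [/\ conn G X, conn G Y & pairwise (fun S T : {set 'I_m} => [disjoint S & T]) [:: X; Y; P1; P2; P3; Q1; Q2; Q3]] ->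
  [/\ conn G P1, conn G P2 & conn G P3] -> [/\ conn G Q1, conn G Q2 & conn G Q3] ->
  [/\ touch G P1 Q1, touch G P2 Q2 & touch G P3 Q3] ->
  [/\ touch G X (P1 :|: Q1), touch G X (P2 :|: Q2) & touch G X (P3 :|: Q3)] ->
  [/\ touch G Y (P1 :|: Q1), touch G Y (P2 :|: Q2) & touch G Y (P3 :|: Q3)] ->
  [/\ trim X != set0, trim Y != set0 &
    [/\ trim P1 != set0, trim P2 != set0 & trim P3 != set0]] -> False.
Proof.
move=> [cX cY dis] [p1 p2 p3] [q1 q2 q3] [t1 t2 t3] [x1 x2 x3] [y1 y2 y3] [X0 Y0 [n1 n2 n3]].
move: dis; rewrite /= !andbT.
case/andP => /and5P[dxy dx1 dx2 dx3 /and3P[dx4 dx5 dx6]].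
case/andP => /and5P[dy1 dy2 dy3 dy4 /andP[dy5 dy6]].
case/andP => /and5P[d12 d13 e1 e2 e3].
case/andP => /and4P[d23 f1 f2 f3].
case/andP => /and3P[g1 g2 g3] /andP[/andP[k12 k13] k23].
have cU (A B : {set 'I_m}) : conn G A -> conn G B -> touch G A B -> conn G (A :|: B).
  by move=> cA cB [a [b [aA bB ab]]]; exact: connU cA cB aA bB ab.
have trU (A B : {set 'I_m}) : trim A != set0 -> trim (A :|: B) != set0.
  by case/set0Pn => a; rewrite inE => /andP[aW aA]; apply/set0Pn; exists a; rewrite !inE aW aA.
have trd (A B : {set 'I_m}) : [disjoint A & B] -> [disjoint trim A & trim B].
  by move=> d; apply: disjointWl (subsetDl A W) _; apply: disjointWr (subsetDl B W) d.
have c1 := cU _ _ p1 q1 t1; have c2 := cU _ _ p2 q2 t2; have c3 := cU _ _ p3 q3 t3.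
have m1 := trU _ Q1 n1; have m2 := trU _ Q2 n2; have m3 := trU _ Q3 n3.
have [X1 X2 X3] : [/\ [disjoint X & P1 :|: Q1], [disjoint X & P2 :|: Q2] & [disjoint X & P3 :|: Q3]].
  by rewrite !disjoint_setUr dx1 dx2 dx3 dx4 dx5 dx6.
have [Y1 Y2 Y3] : [/\ [disjoint Y & P1 :|: Q1], [disjoint Y & P2 :|: Q2] & [disjoint Y & P3 :|: Q3]].
  by rewrite !disjoint_setUr dy1 dy2 dy3 dy4 dy5 dy6.
apply: (no_K23 noX (X := trim X) (Y := trim Y) (U1 := trim (P1 :|: Q1)) (U2 := trim (P2 :|: Q2)) (U3 := trim (P3 :|: Q3))).
- by split; apply: trim_conn.
- exact: trd.
- by split; apply: trd.
- by split; apply: trd.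
- split; apply: trd; rewrite !disjoint_setU !disjoint_setUr.
  + by rewrite d12 e2 k12 (disjoint_sym Q1) f1.
  + by rewrite d13 e3 k13 (disjoint_sym Q1) g1.
  + by rewrite d23 f3 k23 (disjoint_sym Q2) g2.
- by split; apply: trim_touch.
- by split; apply: trim_touch.
Qed.

Section FromMinor.
Variables (H : sgraph) (phi : H -> {set 'I_m}).
Hypotheses (h1 : forall h, connected_set (G := sg G) (phi h))
  (h2 : forall h h', h != h' -> [disjoint phi h & phi h'])
  (h3 : forall h h', adj h h' -> touch G (phi h) (phi h')).

Lemma branch_nonempty h k1 k2 k3 : adj h k1 -> adj h k2 -> adj h k3 ->
  [/\ k1 != k2, k1 != k3 & k2 != k3] -> trim (phi h) != set0.
Proof.
move=> a1 a2 a3 [n1 n2 n3]; apply: (@trim_nonempty _ (phi k1) (phi k2) (phi k3)).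
- exact/conn_connected.
- by split; exact: h2.
- by split; exact: h3.
Qed.

Lemma no_branch_K23 (x y p1 p2 p3 q1 q2 q3 : H) : uniq [:: x; y; p1; p2; p3; q1; q2; q3] ->
  [/\ adj p1 q1, adj p2 q2 & adj p3 q3] ->
  [/\ adj x p1 || adj x q1, adj x p2 || adj x q2 & adj x p3 || adj x q3] ->
  [/\ adj y p1 || adj y q1, adj y p2 || adj y q2 & adj y p3 || adj y q3] ->
  [/\ trim (phi x) != set0, trim (phi y) != set0 &
    [/\ trim (phi p1) != set0, trim (phi p2) != set0 & trim (phi p3) != set0]] -> False.
Proof.
move=> un [a1 a2 a3] [x1 x2 x3] [y1 y2 y3].
have c h : conn G (phi h) by exact/conn_connected.
have tU h p q : adj h p || adj h q -> touch G (phi h) (phi p :|: phi q).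
  by case/orP => /h3[a [b [aP bP ab]]]; exists a, b; rewrite inE bP ?orbT.
apply: (@no_subdivided_K23 _ _ _ _ _ (phi q1) (phi q2) (phi q3)); split; try exact: c; try exact: tU; try exact: h3.
rewrite -[[:: phi x; _; _; _; _; _; _; _]]/(map phi [:: x; y; p1; p2; p3; q1; q2; q3]).
rewrite pairwise_map; move: un; rewrite uniq_pairwise; apply: sub_pairwise => h h'; exact: h2.
Qed.
End FromMinor.

Lemma no_H1 : ~ minor H1 (sg G).
Proof.
move=> [phi [h1 h2 h3]].
pose x : H1 := inl (inl (inl (inl (@Ordinal 2 0 isT)))).
pose y : H1 := inl (inl (inl (inl (@Ordinal 2 1 isT)))).
pose u : H1 := inl (inl (inl (inr (@Ordinal 3 0 isT)))).
pose v : H1 := inl (inl (inl (inr (@Ordinal 3 1 isT)))).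
pose w : H1 := inl (inl (inl (inr (@Ordinal 3 2 isT)))).
pose a c : H1 := inl (inl (inr c)); pose b c : H1 := inl (inr c); pose d c : H1 := inr c.
apply: (no_branch_K23 h1 h2 h3 (x := x) (y := y) (p1 := u) (p2 := v) (p3 := w)
  (q1 := a true) (q2 := b true) (q3 := d true)) => //; split; last split.
- by apply: (branch_nonempty h1 h2 h3 (k1 := a true) (k2 := b true) (k3 := d true)).
- by apply: (branch_nonempty h1 h2 h3 (k1 := u) (k2 := v) (k3 := w)).
- by apply: (branch_nonempty h1 h2 h3 (k1 := a true) (k2 := a false) (k3 := y)).
- by apply: (branch_nonempty h1 h2 h3 (k1 := b true) (k2 := b false) (k3 := y)).
- by apply: (branch_nonempty h1 h2 h3 (k1 := d true) (k2 := d false) (k3 := y)).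
Qed.

Lemma no_H2 : ~ minor H2 (sg G).
Proof.
move=> [phi [h1 h2 h3]].
pose x : H2 := inl (inl (inl (inl (@Ordinal 2 0 isT)))).
pose y : H2 := inl (inl (inl (inl (@Ordinal 2 1 isT)))).
pose u : H2 := inl (inl (inl (inr (@Ordinal 3 0 isT)))).
pose v : H2 := inl (inl (inl (inr (@Ordinal 3 1 isT)))).
pose w : H2 := inl (inl (inl (inr (@Ordinal 3 2 isT)))).
pose a c : H2 := inl (inl (inr c)); pose b c : H2 := inl (inr c); pose d c : H2 := inr c.
apply: (no_branch_K23 h1 h2 h3 (x := x) (y := y) (p1 := u) (p2 := v) (p3 := w)
  (q1 := a true) (q2 := b true) (q3 := d true)) => //; split; last split.
- by apply: (branch_nonempty h1 h2 h3 (k1 := a true) (k2 := b true) (k3 := w)).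
- by apply: (branch_nonempty h1 h2 h3 (k1 := u) (k2 := v) (k3 := d true)).
- by apply: (branch_nonempty h1 h2 h3 (k1 := a true) (k2 := a false) (k3 := y)).
- by apply: (branch_nonempty h1 h2 h3 (k1 := b true) (k2 := b false) (k3 := y)).
- by apply: (branch_nonempty h1 h2 h3 (k1 := d true) (k2 := d false) (k3 := x)).
Qed.
End SubdividedOuterplanar.

(** * Shapes of trees whose graphs avoid the excluded minors *)

Fixpoint apex_tree (T : dstree) : bool :=
  match T with
  | GL => true
  | GN l1 GL l2 GL => apex_tree l1 && apex_tree l2
  | _ => false
  end.

Fixpoint outer_tree (T : dstree) : bool :=
  match T with
  | GL => true
  | GN GL GL l r => outer_tree l && outer_tree r
  | _ => false
  end.

Definition tsym T u v b i j := tadj T u v b i j || tadj T u v b j i.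

Lemma tsym_supp T u v b i j : tsym T u v b i j ->
  [|| i == u, i == v | (b <= i < b + gsize T)%N] && [|| j == u, j == v | (b <= j < b + gsize T)%N].
Proof. by case/orP => /tadj_supp //; rewrite andbC. Qed.

(** The middle vertices come after all vertices of their left halves, and the right halves are edges
    to [v]. So within each half the right terminal is the largest vertex, and the only larger
    neighbour of a middle vertex is [v]. *)
Lemma apex_up_unique T u v b i j j' : apex_tree T -> (u < b)%N -> (b + gsize T <= v)%N ->
  i != u -> tsym T u v b i j -> tsym T u v b i j' -> (i < j)%N -> (i < j')%N -> j = j'.
Proof.
elim: T u v b i j j' => [|l1 I1 r1 _ l2 I3 r2 _] u v b i j j' /=.
  by rewrite /tsym /=; lia.
case: r1 => //; case: r2 => // /andP[s1 s2] ub bv iu.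
have key k : tsym (GN l1 GL l2 GL) u v b i k -> (i < k)%N ->
    [\/ tsym l1 u (b + gsize l1) b i k /\ (b <= i < b + gsize l1)%N,
        (i == b + gsize l1)%N && (k == v),
        tsym l2 u ((b + gsize l1).+1 + gsize l2)%N (b + gsize l1).+1 i k /\
          ((b + gsize l1).+1 <= i < (b + gsize l1).+1 + gsize l2)%N |
        (i == (b + gsize l1).+1 + gsize l2)%N && (k == v)].
  rewrite {1}/tsym /= !addn0 => h ik.
  have : [\/ tsym l1 u (b + gsize l1) b i k, 
     (i == (b + gsize l1)%N) && (k == v) || (k == (b + gsize l1)%N) && (i == v),
     tsym l2 u ((b + gsize l1).+1 + gsize l2)%N (b + gsize l1).+1 i k |
     (i == ((b + gsize l1).+1 + gsize l2)%N) && (k == v) || (k == ((b + gsize l1).+1 + gsize l2)%N) && (i == v)].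
    case/orP: h => /orP[]/orP[] h; [constructor 1|constructor 2|constructor 3|constructor 4|constructor 1|constructor 2|constructor 3|constructor 4];
      rewrite /tsym ?h ?orbT //.
  move: bv => /= bv; case=> h2.
  - by constructor 1; split=> //; move: (tsym_supp h2) ik iu ub; clear; lia.
  - by constructor 2; move: h2 ik bv iu; clear; lia.
  - by constructor 3; split=> //; move: (tsym_supp h2) ik iu ub; clear; lia.
  - by constructor 4; move: h2 ik bv iu; clear; lia.
move=> /key k1 /key k2 l l'; have := k2 l'; have := k1 l; case=> [[h hi]|h|[h hi]|h] [[h' hi']|h'|[h' hi']|h'];
  try (exfalso; move: h h' hi hi'; clear; lia); try (exfalso; move: h h' hi; clear; lia);
  try (exfalso; move: h h' hi'; clear; lia); try (exfalso; move: h h'; clear; lia).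
- exact: (I1 u (b + gsize l1)%N b i j j').
- by move: h h'; clear; lia.
- by apply: (I3 u ((b + gsize l1).+1 + gsize l2)%N (b + gsize l1).+1 i j j') => //; apply: leq_trans ub _; clear; lia.
- by move: h h'; clear; lia.
Qed.

(* For trees of the form GN GL GL l r, sub_vertex lists the vertices in the middle of
   the subdivided path, and skeleton is what remains after replacing that path by an
   edge. *)
Fixpoint sub_vertex (T : dstree) (b i : nat) : bool :=
  if T is GN _ _ l r then
    let z := (b.+1 + gsize l)%N in [|| i == b, sub_vertex l b.+1 i | sub_vertex r z.+1 i]
  else false.

Fixpoint skeleton (T : dstree) (u v b i j : nat) : bool :=
  (i == u) && (j == v) ||
  (if T is GN _ _ l r then
    let z := (b.+1 + gsize l)%N in skeleton l u z b.+1 i j || skeleton r z v z.+1 i j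
  else false).

Lemma sub_vertex_supp T b i : outer_tree T -> sub_vertex T b i -> (b <= i < b + gsize T)%N.
Proof.
elim: T b => [|l1 _ r1 _ l I3 r I4] b //=.
case: l1 => //; case: r1 => // /andP[s1 s2] /or3P[|/(I3 _ s1)|/(I4 _ s2)] /=; clear; lia.
Qed.

Lemma skeleton_supp T u v b i j : outer_tree T -> (u < b)%N -> (b + gsize T <= v)%N -> skeleton T u v b i j ->
  [&& (i < j)%N, [|| i == u, i == v | (b <= i < b + gsize T)%N] &
   [|| j == u, j == v | (b <= j < b + gsize T)%N]].
Proof.
elim: T u v b => [|l1 _ r1 _ l I3 r I4] u v b /=.
  by move=> _; clear; lia.
case: l1 => //; case: r1 => // /andP[s1 s2] ub; rewrite /= => bv /or3P[].
- by move: ub bv; clear; lia.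
- move=> /(I3 u (b.+1 + gsize l)%N b.+1 s1); move: ub bv; clear; lia.
- move=> /(I4 (b.+1 + gsize l)%N v (b.+1 + gsize l).+1 s2); move: ub bv; clear; lia.
Qed.

(** The skeleton is the chord from [u] to [v] over two skeletons on the consecutive intervals from
    [u] to [z] and from [z] to [v], which share only [z]. *)
Lemma skeleton_noncross T u v b i j i' j' : outer_tree T -> (u < b)%N -> (b + gsize T <= v)%N ->
  skeleton T u v b i j -> skeleton T u v b i' j' -> (i < i')%N -> (i' < j)%N -> (j < j')%N -> False.
Proof.
elim: T u v b => [|l1 _ r1 _ l I3 r I4] u v b /=.
  by move=> _; clear; lia.
case: l1 => //; case: r1 => // /andP[s1 s2] ub; rewrite /= => bv.
have sl k k' : skeleton l u (b.+1 + gsize l)%N b.+1 k k' -> (u <= k < k')%N && (k' <= b.+1 + gsize l)%N.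
  by move=> /(skeleton_supp s1); move: ub bv; clear; lia.
have sr k k' : skeleton r (b.+1 + gsize l)%N v (b.+1 + gsize l).+1 k k' -> (b.+1 + gsize l <= k < k')%N && (k' <= v)%N.
  by move=> /(skeleton_supp s2); move: ub bv; clear; lia.
have eb : (b.+1 + gsize l <= v)%N by move: bv; clear; lia.
case/or3P => h /or3P[] h' l1 l2 l3.
- by move: h h' l1 l2 l3; clear; lia.
- by move: h (sl _ _ h') l1 l2 l3 eb; clear; lia.
- by move: h (sr _ _ h') l1 l2 l3; clear; lia.
- by move: h' (sl _ _ h) l1 l2 l3; clear; lia.
- by apply: (I3 u (b.+1 + gsize l)%N b.+1 s1 _ _ h h' l1 l2 l3) => //; apply: leq_trans ub _.
- by move: (sl _ _ h) (sr _ _ h') l1 l2 l3; clear; lia.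
- by move: h' (sr _ _ h) l1 l2 l3 ub; clear; lia.
- by move: (sr _ _ h) (sl _ _ h') l1 l2 l3; clear; lia.
- apply: (I4 (b.+1 + gsize l)%N v (b.+1 + gsize l).+1 s2 _ _ h h' l1 l2 l3) => //.
  by move: bv; clear; lia.
Qed.

Lemma tadj_skeleton T u v b i j : outer_tree T -> tadj T u v b i j -> ~~ sub_vertex T b i -> ~~ sub_vertex T b j ->
  skeleton T u v b i j.
Proof.
elim: T u v b => [|l1 _ r1 _ l I3 r I4] u v b /=; first by move=> _ ->.
case: l1 => //; case: r1 => // /andP[s1 s2]; rewrite /= !addn0 => h.
move=> /norP[ib /norP[i1 i2]] /norP[jb /norP[j1 j2]].
case/orP: h => /orP[] h.
- by move: h jb; clear; lia.
- by move: h ib; clear; lia.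
- by rewrite (I3 u (b.+1 + gsize l)%N b.+1 s1 h i1 j1) orbT.
- by rewrite (I4 (b.+1 + gsize l)%N v (b.+1 + gsize l).+1 s2 h i2 j2) !orbT.
Qed.

(** A subdivision vertex is created between the two current terminals, whose chord belongs to the
    skeleton, and later steps attach nothing to it. *)
Lemma sub_vertex_nbrs T u v b i : outer_tree T -> (u < b)%N -> (b + gsize T <= v)%N -> sub_vertex T b i ->
  exists j1 j2, [/\ skeleton T u v b j1 j2, ~~ sub_vertex T b j1, ~~ sub_vertex T b j2 &
    forall j, tsym T u v b i j -> j = j1 \/ j = j2].
Proof.
elim: T u v b => [|l1 _ r1 _ l I3 r I4] u v b //=.
case: l1 => //; case: r1 => // /andP[s1 s2] ub; rewrite /= => bv.
have ex (P Q : Prop) (B : bool) : (B -> P) -> (~~ B -> Q) -> P \/ Q.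
  by case: B => [p _|_ q]; [left; exact: p|right; exact: q].
set z := (b.+1 + gsize l)%N.
have symE k j : tsym (GN GL GL l r) u v b k j ->
   [\/ (k == u) && (j == b) || (k == b) && (j == u) || (k == b) && (j == v) || (k == v) && (j == b),
      tsym l u z b.+1 k j | tsym r z v z.+1 k j].
  rewrite {1}/tsym /= !addn0 -/z => h.
  case/orP: h => /orP[]/orP[] h; try (by constructor 1; move: h; clear; lia);
   [constructor 2|constructor 3|constructor 2|constructor 3]; by rewrite /tsym h ?orbT.
case/or3P => [/eqP ib|il|ir].
- exists u, v; split; first by rewrite !eqxx.
  + apply/norP; split; first by move: ub; clear; lia.
    by apply/norP; split; apply/negP => /sub_vertex_supp h; have := h ltac:(assumption); move: ub; rewrite /z; clear; lia.
  + apply/norP; split; first by move: bv; clear; lia.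
    apply/norP; split; apply/negP => /sub_vertex_supp h; have := h ltac:(assumption); move: bv; rewrite /z; clear; lia.
  move=> j /symE[h|/tsym_supp h|/tsym_supp h]; rewrite ib in h.
  + by apply: (ex _ _ (j == u)) => [/eqP//|]; move: h ub bv; clear; lia.
  + by exfalso; move: h ub; rewrite /z; clear; lia.
  + by exfalso; move: h ub bv; rewrite /z; clear; lia.
- have [j1 [j2 [o n1 n2 h]]] := I3 u z b.+1 s1 (ltnW (ltac:(done) : (u.+1 < b.+1)%N)) (leqnn _) il.
  have il' := sub_vertex_supp s1 il.
  have ub' : (u < b.+1)%N by exact: ltnW.
  have := skeleton_supp s1 ub' (leqnn _) o => sp.
  exists j1, j2; split.
  + by rewrite o orbT.
  + rewrite (negPf n1) /=; apply/norP; split; first by move: sp ub; rewrite /z; clear; lia.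
    by apply/negP => /(sub_vertex_supp s2) q; move: sp ub q; rewrite /z; clear; lia.
  + rewrite (negPf n2) /=; apply/norP; split; first by move: sp ub; rewrite /z; clear; lia.
    by apply/negP => /(sub_vertex_supp s2) q; move: sp ub q; rewrite /z; clear; lia.
  move=> j /symE[q|//|/tsym_supp q]; first by exfalso; move: q il' ub bv; rewrite /z; clear; lia.
  + exact: h.
  + by exfalso; move: q il' bv; rewrite /z; clear; lia.
- have zv : (z.+1 + gsize r <= v)%N by move: bv; rewrite /z; clear; lia.
  have [j1 [j2 [o n1 n2 h]]] := I4 z v z.+1 s2 (ltnSn _) zv ir.
  have ir' := sub_vertex_supp s2 ir.
  have sp := skeleton_supp s2 (ltnSn _) zv o.
  exists j1, j2; split.
  + by rewrite o !orbT.
  + rewrite (negPf n1) orbF; apply/norP; split; first by move: sp; rewrite /z; move: bv; clear; lia.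
    by apply/negP => /(sub_vertex_supp s1) q; move: sp bv q; rewrite /z; clear; lia.
  + rewrite (negPf n2) orbF; apply/norP; split; first by move: sp; rewrite /z; move: bv; clear; lia.
    by apply/negP => /(sub_vertex_supp s1) q; move: sp bv q; rewrite /z; clear; lia.
  move=> j /symE[q|/tsym_supp q|]; last exact: h.
  + by exfalso; move: q ir' ub bv; rewrite /z; clear; lia.
  + by exfalso; move: q ir' ub; rewrite /z; clear; lia.
Qed.

Lemma skeleton_chord T u v b i j : (i == u) && (j == v) -> skeleton T u v b i j.
Proof. by case: T => [|? ? ? ?] /= ->. Qed.

(** * The extremal graphs *)

Section ExtremalGraphs.
Variables (R : realType) (T : dstree).
Let n := gsize T.
Notation m := (gsize T).+2.

Definition tree_graph : graph 'I_m :=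
  gr [rel i j : 'I_m | tadj T 0 n.+1 1 i j || (nat_of_ord i == 0%N) && (nat_of_ord j == n.+1)].

(** With the edge between the terminals present, the value of the graph is the [pne] of the tree
    without it, which is a multiple of the first tree polynomial. *)
Lemma tree_graph_root (t : R) : t != 0 -> t != 1 -> root (tree_polys R T).1 t ->
  root (chromatic_poly (sg tree_graph) R) t.
Proof.
move=> t0 t1 /rootP r; pose u : 'I_m := ord0; pose v : 'I_m := ord_max.
have uv : u != v by [].
have [a _] : has_polys t (tree_polys R T) n (tree_rel_graph m T u v 1) u v.
  by apply: tree_rel_graph_polys => //; rewrite /= /n; lia.
have e : pr t tree_graph = 0.
  rewrite -[RHS](_ : pne t (tree_rel_graph m T u v 1) u v = 0); last by rewrite a r mul0r mulr0.
  apply: eq_pr => i j; rewrite addEE //; apply/idP/idP.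
    case/andP => ij /orP[]/orP[h|/andP[/eqP i0 /eqP j0]].
    - by rewrite /= /gr_adj /= ij h.
    - have -> : i = u by exact: val_inj.
      have -> : j = v by exact: val_inj.
      by rewrite !eqxx orbT.
    - by rewrite /= /gr_adj /= ij h orbT.
    - have -> : j = u by exact: val_inj.
      have -> : i = v by exact: val_inj.
      by rewrite !eqxx !orbT.
  case/or3P => [/andP[ij /orP[]h]|/andP[/eqP -> /eqP ->]|/andP[/eqP -> /eqP ->]].
  - by rewrite /= /gr_adj /= ij; move: h => /= ->.
  - by rewrite /= /gr_adj /= ij; move: h => /= ->; rewrite !orbT.
  - by rewrite /= /gr_adj /= eqxx orbT.
  - by rewrite /= /gr_adj /= eqxx !orbT.
move: e; rewrite prE => /eqP; rewrite mulf_eq0 invr_eq0 expf_eq0 (negPf t0) andbF orbF.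
by [].
Qed.

Lemma tree_graph_H0 : apex_tree T -> ~ minor H0 (sg tree_graph).
Proof.
move=> aT; apply: (@no_H0 _ _ ord0) => i j j' i0 ij ij' l l'; apply: val_inj.
have i0' : nat_of_ord i != 0%N by rewrite -(inj_eq val_inj) in i0.
have sy (k : 'I_m) : tree_graph i k -> (i < k)%N -> tsym T 0 n.+1 1 i k.
  rewrite /tsym => /andP[_ /orP[]/orP[->|]]; rewrite ?orbT //.
    by rewrite (negPf i0').
  by move=> /andP[/eqP -> _]; rewrite ltn0.
exact: (apex_up_unique aT _ _ i0' (sy _ ij l) (sy _ ij' l') l l').
Qed.

Lemma tree_graph_H12 : outer_tree T -> ~ minor H1 (sg tree_graph) /\ ~ minor H2 (sg tree_graph).
Proof.
move=> oT; pose W : {set 'I_m} := [set i : 'I_m | sub_vertex T 1 i].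
pose O : graph 'I_m := gr [rel i j : 'I_m | skeleton T 0 n.+1 1 i j].
have lt i j : skeleton T 0 n.+1 1 i j -> (i < j)%N by move=> /(skeleton_supp oT)/and3P[].
have OE (i j : 'I_m) : O i j -> (i < j)%N -> skeleton T 0 n.+1 1 i j.
  by move=> /andP[_ /orP[//|/lt]] /=; move=> h /(ltn_trans h); rewrite ltnn.
have Oot (i j : 'I_m) : skeleton T 0 n.+1 1 i j -> O i j.
  by move=> h; apply/andP; split; [rewrite -(inj_eq val_inj) /= ltn_eqF // lt|rewrite /= h].
have noX (i j i' j' : 'I_m) : O i j -> O i' j' -> (i < i')%N -> (i' < j)%N -> (j < j')%N -> False.
  move=> o o' l1 l2 l3; apply: (skeleton_noncross oT _ _ (OE _ _ o _) (OE _ _ o' _) l1 l2 l3) => //.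
  - exact: ltn_trans l2.
  - exact: ltn_trans l3.
have eout (i j : 'I_m) : tree_graph i j -> i \notin W -> j \notin W -> O i j.
  rewrite !inE => /andP[_ h] iW jW.
  have half (k l : 'I_m) : tadj T 0 n.+1 1 k l || (nat_of_ord k == 0%N) && (nat_of_ord l == n.+1) ->
      ~~ sub_vertex T 1 k -> ~~ sub_vertex T 1 l -> O k l.
    case/orP => h' kW lW; apply: Oot; first exact: tadj_skeleton.
    exact: skeleton_chord.
  case/orP: h => h; first exact: half.
  by rewrite grC; exact: half.
have ein (i : 'I_m) : i \in W -> exists j1 j2 : 'I_m,
  [/\ O j1 j2, j1 \notin W, j2 \notin W & forall j, tree_graph i j -> j = j1 \/ j = j2].
  rewrite inE => iW; have [j1 [j2 [o n1 n2 h]]] := sub_vertex_nbrs oT (ltnSn 0) (leqnn n.+1) iW.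
  have sp := skeleton_supp oT (ltnSn 0) (leqnn n.+1) o.
  have l1 : (j1 < m)%N by move: sp; rewrite -/n; lia.
  have l2 : (j2 < m)%N by move: sp; rewrite -/n; lia.
  exists (Ordinal l1), (Ordinal l2); rewrite !inE; split=> //; first exact: Oot.
  move=> j /andP[_ ij].
  have isp := sub_vertex_supp oT iW.
  have : tsym T 0 n.+1 1 i j.
    by case/orP: ij => /orP[] q; rewrite /tsym ?q ?orbT //; exfalso; move: q isp; rewrite -/n; lia.
  by case/h => e; [left|right]; apply: val_inj.
split; [exact: no_H1 noX eout ein|exact: no_H2 noX eout ein].
Qed.
End ExtremalGraphs.

Lemma fam1_apex n : apex_tree (fam step1 n).
Proof. by elim: n => //= n ->. Qed.
Lemma fam2_outer n : outer_tree (fam step2 n).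
Proof. by elim: n => //= n ->. Qed.
Lemma fam3_apex n : apex_tree (fam step3 n).
Proof. by elim: n => //= n ->. Qed.
Lemma fam3_outer n : outer_tree (fam step3 n).
Proof. by elim: n => //= n ->. Qed.

(** * The values of omega *)

From mathcomp Require Import classical_sets.

Lemma omegaE (R : realType) (C : sgraph -> Prop) (w : R) : w < 2 ->
  (forall G t, C G -> t != 0 -> t != 1 -> t < w -> ~~ root (chromatic_poly G R) t) ->
  (forall t1, w < t1 -> t1 < 2 -> exists G x, [/\ C G, 6 / 5 <= x, x <= t1 & root (chromatic_poly G R) x]) ->
  omega R C = w.
Proof.
move=> w2 lo up.
have ex t1 : w < t1 -> t1 < 2 -> exists2 x, @nontrivial_roots R C x & x <= t1.
  move=> a b; have [G [x [cG x1 x2 r]]] := up t1 a b; exists x => //.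
  by split; [rewrite gt_eqF //; lra|rewrite gt_eqF //; lra|exists G].
have ne : (@nontrivial_roots R C !=set0)%classic.
  by have [||x h _] := ex ((w + 2) / 2); [lra|lra|exists x].
have lb : lbound (@nontrivial_roots R C) w.
  move=> x [x0 x1 [G cG r]]; rewrite leNgt; apply/negP => xw.
  by have := lo G x cG x0 x1 xw; rewrite r.
rewrite /omega (asboolT ne); apply/eqP; rewrite eq_le; apply/andP; split; last exact: lb_le_inf.
rewrite leNgt; apply/negP => h; set i := inf _ in h.
(* The infimum might exceed 2 at this point, so [t1] is chosen below the smaller of the two
   numbers. *)
have [t1 [a b c]] : exists t1, [/\ w < t1, t1 < 2 & t1 < i].
  have [i2|i2] := leP i 2; first by exists ((w + i) / 2); split; lra.
  by exists ((w + 2) / 2); split; lra.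
have [x hx xt] := ex t1 a b.
have : i <= x by apply: ge_inf => //; exists w.
by move: xt c; lra.
Qed.

Section Omega.
Variable R : realType.

Lemma quartic_shift (t : R) : (2 - t) ^+ 4 - 4 * (t - 1) ^+ 2 * (3 - t) =
  t ^+ 4 - 4 * t ^+ 3 + 4 * t ^+ 2 - 4 * t + 4.
Proof. by ring. Qed.

Lemma cubic_shift (t : R) : 4 * (t - 1) ^+ 2 - (2 - t) ^+ 3 = t ^+ 3 - 2 * t ^+ 2 + 4 * t - 4.
Proof. by ring. Qed.

Lemma quartic_decr (s t : R) : 1 < s -> s < t -> t < 2 ->
  t ^+ 4 - 4 * t ^+ 3 + 4 * t ^+ 2 - 4 * t + 4 < s ^+ 4 - 4 * s ^+ 3 + 4 * s ^+ 2 - 4 * s + 4.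
Proof.
move=> s1 st t2; rewrite -subr_gt0; set u := s - 1; set v := t - 1.
(* In terms of [u] the quartic is [u^4 - 2 u^2 - 4 u + 1]; the cofactor of [v - u] is positive
   because [u] and [v] lie between 0 and 1. *)
have -> : s ^+ 4 - 4 * s ^+ 3 + 4 * s ^+ 2 - 4 * s + 4 - (t ^+ 4 - 4 * t ^+ 3 + 4 * t ^+ 2 - 4 * t + 4)
  = (v - u) * (4 + 2 * (u + v) - (u + v) * (u ^+ 2 + v ^+ 2)) by rewrite /u /v; ring.
have [u0 u1 v0 v1] : [/\ 0 < u, u < 1, 0 < v & v < 1] by rewrite /u /v; split; lra.
apply: mulr_gt0; first by rewrite /u /v; lra.
have u2 : u ^+ 2 < 1 by rewrite expr2; nra.
have v2 : v ^+ 2 < 1 by rewrite expr2; nra.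
have : (u + v) * (u ^+ 2 + v ^+ 2) <= (u + v) * 2 by rewrite ler_pM2l; lra.
lra.
Qed.

Lemma cubic_incr (s t : R) : s < t ->
  s ^+ 3 - 2 * s ^+ 2 + 4 * s - 4 < t ^+ 3 - 2 * t ^+ 2 + 4 * t - 4.
Proof.
move=> st; rewrite -subr_gt0.
have -> : t ^+ 3 - 2 * t ^+ 2 + 4 * t - 4 - (s ^+ 3 - 2 * s ^+ 2 + 4 * s - 4) =
  (t - s) * ((t + s / 2 - 1) ^+ 2 + 3 / 4 * (s - 2 / 3) ^+ 2 + 8 / 3) by field.
apply: mulr_gt0; first by rewrite subr_gt0.
have := sqr_ge0 (t + s / 2 - 1); have := sqr_ge0 (s - 2 / 3); lra.
Qed.

(** The endpoints are [1225 / 1000] plus and minus [1 / 2000]. The quartic is negated so that the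
    sign changes from negative to positive, as the intermediate value theorem requires. *)
Lemma quartic_root : exists q : R, [/\ 2449 / 2000 < q, q < 2451 / 2000 &
  q ^+ 4 - 4 * q ^+ 3 + 4 * q ^+ 2 - 4 * q + 4 = 0].
Proof.
pose p : {poly R} := - ('X^4 - 4%:P * 'X^3 + 4%:P * 'X^2 - 4%:P * 'X + 4%:P).
have pE x : p.[x] = - (x ^+ 4 - 4 * x ^+ 3 + 4 * x ^+ 2 - 4 * x + 4) by rewrite /p !hornerE.
have lo : p.[2449 / 2000] < 0 by rewrite pE; lra.
have hi : 0 < p.[2451 / 2000] by rewrite pE; lra.
have le : (2449 / 2000 : R) <= 2451 / 2000 by clear; lra.
have [q /andP[q1 q2] /rootP r] := poly_ivt le (introT andP (conj (ltW lo) (ltW hi))).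
exists q; split.
- by rewrite lt_neqAle q1 andbT; apply/eqP => e; move: lo; rewrite e r ltxx.
- by rewrite lt_neqAle q2 andbT; apply/eqP => e; move: hi; rewrite -e r ltxx.
- by move: r; rewrite pE => /eqP; rewrite oppr_eq0 => /eqP.
Qed.

Lemma cubic_root : exists q : R, [/\ 2591 / 2000 < q, q < 2593 / 2000 &
  q ^+ 3 - 2 * q ^+ 2 + 4 * q - 4 = 0].
Proof.
pose p : {poly R} := 'X^3 - 2%:P * 'X^2 + 4%:P * 'X - 4%:P.
have pE x : p.[x] = x ^+ 3 - 2 * x ^+ 2 + 4 * x - 4 by rewrite /p !hornerE.
have lo : p.[2591 / 2000] < 0 by rewrite pE; lra.
have hi : 0 < p.[2593 / 2000] by rewrite pE; lra.
have le : (2591 / 2000 : R) <= 2593 / 2000 by clear; lra.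
have [q /andP[q1 q2] /rootP r] := poly_ivt le (introT andP (conj (ltW lo) (ltW hi))).
exists q; split.
- by rewrite lt_neqAle q1 andbT; apply/eqP => e; move: lo; rewrite e r ltxx.
- by rewrite lt_neqAle q2 andbT; apply/eqP => e; move: hi; rewrite -e r ltxx.
- by rewrite -pE.
Qed.

Lemma tree_graph_witness (h0 h12 : bool) T (t1 x : R) : (h0 -> apex_tree T) -> (h12 -> outer_tree T) ->
  6 / 5 <= x -> x <= t1 -> root (tree_polys R T).1 x ->
  exists G y, [/\ avoids h0 h12 G, 6 / 5 <= y, y <= t1 & root (chromatic_poly G R) y].
Proof.
move=> a o x1 x2 r; exists (sg (tree_graph T)), x; split=> //.
  by split=> h; [apply: tree_graph_H0; exact: a|apply: tree_graph_H12; exact: o].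
by apply: tree_graph_root => //; rewrite gt_eqF //; lra.
Qed.

Lemma omega_ext (C D : sgraph -> Prop) : (forall G, C G <-> D G) -> omega R C = omega R D.
Proof. by move=> h; congr (omega R); apply/funext => G; apply/propext. Qed.
End Omega.

Theorem theorem1p4 (R : realType) :
  [/\ omega R (fun G => ~ minor H0 G) = 5 / 4,
      exists q : R,
        [/\ unique
              (fun t : R => 1 < t < 2 /\
                 t ^+ 4 - 4 * t ^+ 3 + 4 * t ^+ 2 - 4 * t + 4 = 0) q,
            `|q - 1225 / 1000| < 1 / 2000 &
            omega R (fun G => ~ minor H1 G /\ ~ minor H2 G) = q] &
      exists t0 : R,
        [/\ unique (fun t : R => t ^+ 3 - 2 * t ^+ 2 + 4 * t - 4 = 0) t0,
            `|t0 - 1296 / 1000| < 1 / 2000 &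
            omega R (fun G =>
              [/\ ~ minor H0 G, ~ minor H1 G & ~ minor H2 G]) = t0]].
Proof.
split.
- rewrite (@omega_ext R _ (avoids true false)) => [|G]; last by split=> [n|[n _]]; [split|exact: n].
  apply: omegaE => [|G t aG t0 t1 ltw|t1 l u]; first by lra.
    apply: (no_small_root aG t0 t1); last by lra.
    by move=> lt; split=> //; lra.
  have [n [x [/andP[x1 x2] r]]] := step1_root l u.
  by apply: tree_graph_witness x1 x2 r => // _; exact: fam1_apex.
- have [q [q1 q2 qr]] := quartic_root R.
  have [g1 g2] : 1 < q /\ q < 2 by split; lra.
  exists q; split.
  + split; first by rewrite g1 g2.
    move=> s [/andP[s1 s2] sr]; case: (ltgtP q s) => // l.
      by have := quartic_decr g1 l s2; rewrite qr sr ltxx.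
    by have := quartic_decr s1 l g2; rewrite qr sr ltxx.
  + by rewrite ltr_norml; apply/andP; split; lra.
  rewrite (@omega_ext R _ (avoids false true)) => [|G]; last by split=> [n|[_ n]]; [split|exact: n].
  apply: omegaE => [|G t aG t0 t1 ltw|t1 l u]; first by lra.
    apply: (no_small_root aG t0 t1); last by lra.
    move=> lt; split=> //; [lra|lra|].
    move=> _; rewrite -subr_gt0.
    have -> : (1 - (t - 1)) ^+ 4 - 4 * (t - 1) ^+ 2 * (2 - (t - 1)) =
       t ^+ 4 - 4 * t ^+ 3 + 4 * t ^+ 2 - 4 * t + 4 by ring.
    by rewrite -qr; apply: quartic_decr => //; lra.
  have l1 : 6 / 5 <= t1 by lra.
  have [|n [x [/andP[x1 x2] r]]] := step2_root l1 _ u.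
    by rewrite -subr_lt0 quartic_shift -qr; apply: quartic_decr => //; lra.
  by apply: tree_graph_witness x1 x2 r => // _; exact: fam2_outer.
- have [q [q1 q2 qr]] := cubic_root R; exists q; split.
  + split=> // s sr; case: (ltgtP q s) => // l.
      by have := cubic_incr l; rewrite qr sr ltxx.
    by have := cubic_incr l; rewrite qr sr ltxx.
  + by rewrite ltr_norml; apply/andP; split; lra.
  rewrite (@omega_ext R _ (avoids true true)) => [|G]; last first.
    split=> [[n0 n1 n2]|[n0 n12]]; first by split.
    by have [n1 n2] := n12 isT; split=> //; exact: n0.
  apply: omegaE => [|G t aG t0 t1 ltw|t1 l u]; first by lra.
    apply: (no_small_root aG t0 t1); last by lra.
    move=> lt; split=> //; [lra|lra|].
    move=> _; rewrite -subr_lt0.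
    have -> : 4 * (t - 1) ^+ 2 - (1 - (t - 1)) ^+ 3 = t ^+ 3 - 2 * t ^+ 2 + 4 * t - 4 by ring.
    by rewrite -qr; apply: cubic_incr.
  have l1 : 6 / 5 <= t1 by lra.
  have [|n [x [/andP[x1 x2] r]]] := step3_root l1 _ u.
    by rewrite -subr_gt0 cubic_shift -qr; apply: cubic_incr.
  by apply: tree_graph_witness x1 x2 r => // _; [exact: fam3_apex|exact: fam3_outer].
Qed.
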